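(* Let $\nu=2$ and let \begin{align*} f(t,x)={}&-0.6\sin(x)+0.7\cos(2x)+0.7\sin(2x)-0.8\cos(3x)-0.8\sin(3x)\\ &+\sin(t)\left[-0.6\cos(x)+0.7\cos(2x)+0.7\sin(2x)-0.8\cos(3x)-0.8\sin(3x)\right]\\ &+\sum_{k=1}^{3}\bigl(\beta_k(t)\sin(kx)+\gamma_k(t)\cos(kx)\bigr), \end{align*} where $\beta_k,\gamma_k:\mathbb{R}\to[-5\cdot10^{-5},5\cdot10^{-5}]$ ($k=1,2,3$) are continuous functions. Then there exists a classical solution $v$ of $$u_t+u\,u_x-\nu u_{xx}=f(t,x),\qquad u(t,x)=u(t,x+2\pi),$$ defined for all $t\in\mathbb{R}$, which attracts, with exponential rate of convergence, every initial datum $u_0$ ($2\pi$-periodic in $x$) satisfying $u_0\in C^4$ and $\int_0^{2\pi}u_0(x)\,dx=\pi$. Moreover, if $f$ is periodic in time, then $v$ is periodic in time.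
   Context: The equation is the viscous Burgers equation on the interval with periodic boundary conditions (period $2\pi$ in $x\in\mathbb{R}$), with initial condition $u(t_0,x)=u_0(x)$, where $t_0\in\mathbb{R}$ is arbitrary. A classical solution is a function possessing the derivatives appearing in the equation and satisfying it pointwise. ''$v$ attracts $u_0$ with exponential rate of convergence'' means: there is a rate $\lambda>0$ (independent of $u_0$ and $t_0$) such that for every $t_0\in\mathbb{R}$ the classical solution $u$ of the equation with $u(t_0,\cdot)=u_0$ exists for all $t\ge t_0$, and there is a constant $C$ with $\sup_{k\in\mathbb{Z}}|\hat u_k(t)-\hat v_k(t)|\le Ce^{-\lambda(t-t_0)}$ for all $t\ge t_0$, where $\hat w_k(t)=\frac1{2\pi}\int_0^{2\pi}w(t,x)e^{-ikx}\,dx$ denotes the $k$-th Fourier coefficient. *)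

(* Defs.v *)
From Stdlib Require Export Reals.
From Coquelicot Require Export Coquelicot.
Open Scope R_scope.

Definition space_periodic (w : R -> R) : Prop :=
  forall x : R, w (x + 2 * PI) = w x.

Definition class_C (n : nat) (w : R -> R) : Prop :=
  (forall (k : nat) (x : R), (k <= n)%nat -> ex_derive_n w k x) /\
  (forall x : R, continuous (Derive_n w n) x).

(* [d] is the derivative of [g] at [t] relative to the time domain [D]: the
   usual derivative at interior points of [D], the right derivative at the left
   endpoint of a half line. *)
Definition is_derive_within (D : R -> Prop) (g : R -> R) (t d : R) : Prop :=
  filterdiff g (within D (locally t)) (fun h : R => scal h d).

(* Joint continuity on [D] x R is part of the notion of solution: without it the
   initial datum does not determine the solution, since the heat equation has
   separately smooth, nonzero pointwise solutions with zero initial datum (the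
   x-derivative of the heat kernel). *)
Record classical_solution (nu : R) (f : R -> R -> R) (D : R -> Prop)
    (u : R -> R -> R) : Prop := {
  cs_continuous : forall t x : R, D t ->
    filterlim (fun p : R * R => u (fst p) (snd p))
      (within (fun p : R * R => D (fst p)) (locally (t, x)))
      (locally (u t x));
  cs_periodic : forall t : R, D t -> space_periodic (u t);
  cs_equation : forall t x : R, D t ->
    exists ut ux uxx : R,
      is_derive_within D (fun s => u s x) t ut /\
      is_derive (u t) x ux /\
      is_derive_n (u t) 2 x uxx /\
      ut + u t x * ux - nu * uxx = f t x
}.

Definition solves_ivp (nu : R) (f : R -> R -> R) (t0 : R) (u0 : R -> R)
    (u : R -> R -> R) : Prop :=
  classical_solution nu f (fun t => t0 <= t) u /\
  (forall x : R, u t0 x = u0 x).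

(* e^{i theta} *)
Definition cexpi (theta : R) : C := (cos theta, sin theta).

Definition fourier_coef (w : R -> R) (k : Z) : C :=
  Cmult (RtoC (1 / (2 * PI)))
    (RInt (V := C_R_CompleteNormedModule)
       (fun x : R => Cmult (RtoC (w x)) (cexpi (- (IZR k * x)))) 0 (2 * PI)).

Definition fourier_sup_dist (w1 w2 : R -> R) : Rbar :=
  Lub_Rbar (fun r : R => exists k : Z,
    r = Cmod (Cminus (fourier_coef w1 k) (fourier_coef w2 k))).

Definition attracts_exponentially (nu : R) (f v : R -> R -> R)
    (A : (R -> R) -> Prop) : Prop :=
  exists lambda : R, 0 < lambda /\
  forall (u0 : R -> R) (t0 : R), A u0 ->
  exists u : R -> R -> R,
    solves_ivp nu f t0 u0 u /\
    (forall u' : R -> R -> R, solves_ivp nu f t0 u0 u' ->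
       forall t x : R, t0 <= t -> u' t x = u t x) /\
    (exists K : R, forall t : R, t0 <= t ->
       Rbar_le (fourier_sup_dist (u t) (v t))
         (Finite (K * exp (- lambda * (t - t0))))).

Definition time_periodic (T : R) (g : R -> R -> R) : Prop :=
  forall t x : R, g (t + T) x = g t x.

Definition forcing (beta gamma : nat -> R -> R) (t x : R) : R :=
  - 0.6 * sin x + 0.7 * cos (2 * x) + 0.7 * sin (2 * x)
  - 0.8 * cos (3 * x) - 0.8 * sin (3 * x)
  + sin t * (- 0.6 * cos x + 0.7 * cos (2 * x) + 0.7 * sin (2 * x)
             - 0.8 * cos (3 * x) - 0.8 * sin (3 * x))
  + sum_n_m (fun k : nat => beta k t * sin (INR k * x)
                            + gamma k t * cos (INR k * x)) 1 3.

(* Main.v *)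
Require Import Defs.
From Stdlib Require Import Reals.
From Coquelicot Require Import Coquelicot.
From Stdlib Require Import Lra Lia ZArith Classical ClassicalEpsilon FunctionalExtensionality.
Open Scope R_scope.

(* The forcing has mean zero, so the mean [1/2] of the solution is conserved and the
   Cole-Hopf transformation [u = 1/2 - 4 phi_x / phi] turns the equation into the linear
   equation [phi_t = 2 phi_xx - phi_x / 2 + q phi], whose potential [q] is a trigonometric
   polynomial of degree 3 in [x].  In a frame moving at speed [1/2], the Fourier
   coefficients of [phi] solve a diagonal linear system with a bounded banded
   perturbation, which a Dyson series solves globally in time: coefficients of order
   [k^-5] (a [C^4] datum) keep that decay, and bounded coefficients become of order
   [e^(-2 |k| t)].  The minimum principle keeps [phi] positive and makes classical
   solutions unique.

   Attraction needs no computer-assisted bounds.  The energy [int (u - 1/2)^2] eventually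
   stays below 7, and below that level the squared L2 distance of two solutions decays
   exponentially, because the transport term is dominated by the viscosity.  The
   attracting solution is the limit, as [s] tends to minus infinity, of the solutions
   starting from the constant [1/2] at time [s]: at a fixed time their normalised
   Cole-Hopf transforms form a Cauchy family, and the linear flow carries the limit of
   their Fourier coefficients to a smooth solution. *)

(** Why the level is 7. The mean-zero primitive of the forcing has squared L2 norm at most 8, so the
    energy inequality drives int (u - 1/2)^2 towards 2 PI^2 / 3, about 6.58. For two solutions of
    energy at most E with difference w, Cauchy-Schwarz and the sawtooth inequality bound the
    transport term by sqrt (2 PI E / 3) int w_x^2, which stays below the viscous 4 int w_x^2 as long
    as E < 24 / PI, about 7.64. The level 7 fits between the two thresholds, with room for crude
    estimates. Why the limit is not taken on velocities. L2 closeness of velocities controls no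
    derivative. Since (ln phi)_x = - (u - 1/2) / 4, it does give uniform closeness of the normalised
    transforms, and the linear flow turns bounded coefficients into exponentially decaying ones, so
    the limit is again a smooth Cole-Hopf solution. Why one explicit solution settles uniqueness. A
    competitor is an arbitrary classical solution, with no bound on its derivatives; the comparison
    argument needs a bound on u_x for only one of the two solutions, and the Cole-Hopf solution
    provides it. *)

(* [ring] and [field] do not see through the carriers of Coquelicot's structures. *)
Ltac eqR := match goal with |- @eq _ ?a ?b => change (@eq R a b); apply Rminus_diag_uniq end.

Lemma continuous_mult_R (f g : R -> R) x : continuous f x -> continuous g x -> continuous (fun x => f x * g x) x.
Proof. intros. apply (continuous_mult (K := R_AbsRing)); assumption. Qed.

Lemma continuous_plus_R (f g : R -> R) x : continuous f x -> continuous g x -> continuous (fun x => f x + g x) x.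
Proof. intros. apply (continuous_plus (V := R_NormedModule)); assumption. Qed.

Lemma continuous_minus_R (f g : R -> R) x : continuous f x -> continuous g x -> continuous (fun x => f x - g x) x.
Proof. intros. apply (continuous_minus (V := R_NormedModule)); assumption. Qed.

Lemma continuous_opp_R (f : R -> R) x : continuous f x -> continuous (fun x => - f x) x.
Proof. intros. apply (continuous_opp (V := R_NormedModule)); assumption. Qed.

Ltac cont_tac := cbv beta;
  lazymatch goal with
  | |- continuous (fun _ => ?c) _ => apply continuous_const
  | |- continuous (fun x => @?a x * @?b x) _ => apply (continuous_mult_R a b); cont_tac
  | |- continuous (fun x => @?a x + @?b x) _ => apply (continuous_plus_R a b); cont_tac
  | |- continuous (fun x => @?a x - @?b x) _ => apply (continuous_minus_R a b); cont_tac
  | |- continuous (fun x => - @?a x) _ => apply (continuous_opp_R a); cont_tac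
  | |- continuous (fun x => x) _ => apply continuous_id
  | |- continuous (fun x => ?g x) _ => change (fun x => g x) with g; auto
  | |- _ => auto
  end.

(** * Series with a summable majorant: limits and termwise differentiation *)

Lemma ex_series_dominated (a M : nat -> R) :
  (forall n, Rabs (a n) <= M n) -> ex_series M -> ex_series a.
Proof. intros H HM. exact (@ex_series_le R_AbsRing R_CompleteNormedModule a M H HM). Qed.

Lemma Series_abs_le (a M : nat -> R) :
  (forall n, Rabs (a n) <= M n) -> ex_series M -> Rabs (Series a) <= Series M.
Proof.
  intros H HM.
  assert (Ha : ex_series (fun n => Rabs (a n))).
  { apply ex_series_dominated with M; [|exact HM]. intros n. rewrite Rabs_Rabsolu. apply H. }
  eapply Rle_trans; [apply Series_Rabs, Ha|].
  apply Series_le; [|exact HM]. intros n. split; [apply Rabs_pos|apply H].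
Qed.

Lemma Series_sum_tail_le (a M : nat -> R) (N : nat) :
  (forall n, Rabs (a n) <= M n) -> ex_series M ->
  Rabs (Series a - sum_f_R0 a N) <= Series (fun k => M (S N + k)%nat).
Proof.
  intros H HM.
  assert (Ha := ex_series_dominated a M H HM).
  rewrite (Series_incr_n a (S N)); [|lia|exact Ha]. simpl Init.Nat.pred.
  replace (_ + _ - _) with (Series (fun k => a (S N + k)%nat)) by ring.
  apply Series_abs_le; [intros n; apply H|].
  apply (ex_series_incr_n M (S N)), HM.
Qed.

Lemma Series_tail_small (M : nat -> R) : ex_series M -> forall eps : posreal,
  exists N, Rabs (Series (fun k => M (S N + k)%nat)) < eps.
Proof.
  intros HM eps.
  destruct (proj1 (is_lim_seq_Reals _ _) (Series_correct M HM) eps (cond_pos eps)) as [N HN].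
  exists N. specialize (HN N (le_n N)). unfold R_dist in HN.
  rewrite sum_n_Reals in HN.
  rewrite (Series_incr_n M (S N)) in HN; [|lia|exact HM]. simpl Init.Nat.pred in HN.
  rewrite Rabs_minus_sym in HN.
  replace (_ + _ - _) with (Series (fun k => M (S N + k)%nat)) in HN by ring. exact HN.
Qed.

Lemma filterlim_sum_f_R0 {U : Type} (F : (U -> Prop) -> Prop) {FF : Filter F}
  (a : nat -> U -> R) (b : nat -> R) (N : nat) :
  (forall n, filterlim (a n) F (locally (b n))) ->
  filterlim (fun u => sum_f_R0 (fun n => a n u) N) F (locally (sum_f_R0 b N)).
Proof.
  intros H. induction N; simpl; [apply H|].
  eapply filterlim_comp_2; [exact IHN|apply H|]. apply (filterlim_plus (V := R_NormedModule)).
Qed.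

(** Dominated convergence: the majorant makes both tails small beyond a common index, and the
    remaining finite sum converges term by term. A general filter lets it serve difference
    quotients, one-sided time limits and joint limits alike. *)
Lemma filterlim_Series {U : Type} (F : (U -> Prop) -> Prop) {FF : Filter F}
  (a : nat -> U -> R) (b M : nat -> R) :
  ex_series M -> F (fun u => forall n, Rabs (a n u) <= M n) ->
  (forall n, Rabs (b n) <= M n) ->
  (forall n, filterlim (a n) F (locally (b n))) ->
  filterlim (fun u => Series (fun n => a n u)) F (locally (Series b)).
Proof.
  intros HM Ha Hb Hlim. apply filterlim_locally. intros eps.
  assert (He : 0 < eps / 3) by (pose proof (cond_pos eps); lra).
  destruct (Series_tail_small M HM (mkposreal _ He)) as [N HN].
  change (Rabs (Series (fun k => M (S N + k)%nat)) < eps / 3) in HN.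
  pose proof (proj1 (filterlim_locally _ _) (filterlim_sum_f_R0 F a b N Hlim) (mkposreal _ He)) as Hs.
  generalize (filter_and _ _ Ha Hs). apply filter_imp. intros u [Hu1 Hu2].
  pose proof (Series_sum_tail_le _ M N Hu1 HM) as T1.
  pose proof (Series_sum_tail_le _ M N Hb HM) as T2.
  change (Rabs (sum_f_R0 (fun n => a n u) N - sum_f_R0 b N) < eps / 3) in Hu2.
  change (Rabs (Series (fun n => a n u) - Series b) < eps).
  apply Rabs_def2 in HN. apply Rabs_def2 in Hu2.
  apply Rabs_le_between in T1. apply Rabs_le_between in T2.
  apply Rabs_def1; lra.
Qed.

Lemma ex_series_inv_sqr : ex_series (fun n => / (1 + INR n) ^ 2).
Proof.
  assert (H : is_series (fun n => / (1 + INR n) - / (1 + INR (S n))) 1).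
  { assert (E : forall N, sum_n (fun n => / (1 + INR n) - / (1 + INR (S n)) : R) N
              = 1 - / (1 + INR (S N))).
    { intros N. rewrite sum_n_Reals. change (sum_f_R0 (fun n => / (1 + INR n) - / (1 + INR (S n))) N = 1 - / (1 + INR (S N))).
      induction N; [simpl; field|].
      cbn [sum_f_R0]. rewrite IHN, !S_INR. pose proof (pos_INR N). field. lra. }
    unfold is_series. eapply filterlim_ext; [intros N; symmetry; apply E|].
    assert (L : is_lim_seq (fun N => 1 - / (1 + INR (S N))) (1 - 0)).
    { apply is_lim_seq_minus'; [apply is_lim_seq_const|].
      replace (Finite 0) with (Rbar_inv p_infty) by reflexivity.
      apply is_lim_seq_inv; [|discriminate].
      apply is_lim_seq_le_p_loc with INR; [|apply is_lim_seq_INR].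
      exists 0%nat. intros n _. rewrite S_INR. lra. }
    rewrite Rminus_0_r in L. exact L. }
  (* Comparison with the telescoping series: 2 + n is at most 2 (1 + n). *)
  apply ex_series_dominated with (fun n => scal 2 (/ (1 + INR n) - / (1 + INR (S n)))).
  - intros n. change scal with Rmult. pose proof (pos_INR n). rewrite Rabs_pos_eq; [|left; apply Rinv_0_lt_compat; apply pow_lt; lra].
    rewrite S_INR. apply Rminus_le_0.
    replace (2 * (/ (1 + INR n) - / (1 + (INR n + 1))) - / (1 + INR n) ^ 2)
      with (INR n * / (1 + INR n) ^ 2 * / (1 + (INR n + 1))) by (field; lra).
    repeat apply Rmult_le_pos; try lra; left; apply Rinv_0_lt_compat; [apply pow_lt|]; lra.
  - apply (ex_series_scal (V := R_NormedModule)). eexists; exact H.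
Qed.

(* The mean value theorem bounds the difference quotients by the bound on the
   derivatives, so dominated convergence applies to them. *)
Lemma is_derive_Series (h h' : nat -> R -> R) (M : nat -> R) (t : R) (del : posreal) :
  ex_series M ->
  (forall n s, Rabs (s - t) < del -> is_derive (h n) s (h' n s)) ->
  (forall n s, Rabs (s - t) < del -> Rabs (h' n s) <= M n) ->
  (forall s, Rabs (s - t) < del -> ex_series (fun n => h n s)) ->
  is_derive (fun s => Series (fun n => h n s)) t (Series (fun n => h' n t)).
Proof.
  intros HM Hd HB Hex.
  assert (Ht : Rabs (t - t) < del) by (rewrite Rminus_diag, Rabs_R0; apply cond_pos).
  assert (Q : filterlim (fun k => Series (fun n => (h n (t + k) - h n t) / k))
     (locally' 0) (locally (Series (fun n => h' n t)))).
  { apply (filterlim_Series (locally' 0) (fun n k => (h n (t + k) - h n t) / k) _ M HM).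
    - exists del. intros k Hk Hk0 n.
      change (Rabs (k - 0) < del) in Hk. rewrite Rminus_0_r in Hk.
      destruct (MVT_gen (h n) t (t + k) (h' n)) as [c [Hc E]].
      + intros x Hx. apply Hd. revert Hx Hk. unfold Rmin, Rmax, Rabs.
        repeat destruct Rle_dec; repeat destruct Rcase_abs; lra.
      + intros x Hx. apply derivable_continuous_pt. exists (h' n x).
        apply is_derive_Reals, Hd. revert Hx Hk. unfold Rmin, Rmax, Rabs.
        repeat destruct Rle_dec; repeat destruct Rcase_abs; lra.
      + rewrite E. replace (h' n c * (t + k - t) / k) with (h' n c) by (field; exact Hk0).
        apply HB. revert Hc Hk. unfold Rmin, Rmax, Rabs.
        repeat destruct Rle_dec; repeat destruct Rcase_abs; lra.
    - intros n. apply HB, Ht.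
    - intros n. specialize (Hd n t Ht). apply is_derive_Reals in Hd.
      apply filterlim_locally. intros eps. destruct (Hd eps (cond_pos eps)) as [d Hdd].
      exists d. intros k Hk Hk0. change (Rabs (k - 0) < d) in Hk. rewrite Rminus_0_r in Hk.
      apply Hdd; assumption. }
  apply is_derive_Reals. intros eps Heps.
  destruct (proj1 (filterlim_locally _ _) Q (mkposreal _ Heps)) as [d Hdd].
  assert (Hm : 0 < Rmin d del) by (apply Rmin_glb_lt; apply cond_pos).
  exists (mkposreal _ Hm). simpl. intros k Hk0 Hk.
  assert (Hk1 := Rlt_le_trans _ _ _ Hk (Rmin_l _ _)).
  assert (Hk2 := Rlt_le_trans _ _ _ Hk (Rmin_r _ _)).
  specialize (Hdd k). 
  assert (E : Series (fun n => (h n (t + k) - h n t) / k) =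
     (Series (fun n => h n (t + k)) - Series (fun n => h n t)) / k).
  { unfold Rdiv. rewrite Series_scal_r. f_equal. apply Series_minus; apply Hex; auto.
    replace (t + k - t) with k by ring. exact Hk2. }
  rewrite E in Hdd. apply Hdd; [|exact Hk0].
  change (Rabs (k - 0) < d). rewrite Rminus_0_r. exact Hk1.
Qed.

(** * Joint continuity *)

(** Only the time is confined to [D]; this is the filter of [cs_continuous], so the two notions are
    convertible. *)
Definition jcont (D : R -> Prop) (g : R -> R -> R) : Prop :=
  forall t x, D t ->
    filterlim (fun p : R * R => g (fst p) (snd p))
      (within (fun p : R * R => D (fst p)) (locally (t, x))) (locally (g t x)).

Lemma jcont_const (D : R -> Prop) (c : R) : jcont D (fun _ _ => c).
Proof. intros t x _. apply filterlim_const. Qed.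

Lemma jcont_plus (D : R -> Prop) (f g : R -> R -> R) :
  jcont D f -> jcont D g -> jcont D (fun t x => f t x + g t x).
Proof.
  intros Hf Hg t x Ht. eapply filterlim_comp_2; [apply Hf, Ht|apply Hg, Ht|].
  apply (filterlim_plus (V := R_NormedModule)).
Qed.

Lemma jcont_mult (D : R -> Prop) (f g : R -> R -> R) :
  jcont D f -> jcont D g -> jcont D (fun t x => f t x * g t x).
Proof.
  intros Hf Hg t x Ht. eapply filterlim_comp_2; [apply Hf, Ht|apply Hg, Ht|].
  apply (filterlim_mult (K := R_AbsRing)).
Qed.

Lemma jcont_comp (D : R -> Prop) (f : R -> R -> R) (h : R -> R) :
  jcont D f -> (forall t x, D t -> continuous h (f t x)) ->
  jcont D (fun t x => h (f t x)).
Proof.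
  intros Hf Hh t x Ht. eapply filterlim_comp; [apply Hf, Ht|]. apply Hh, Ht.
Qed.

Lemma jcont_opp (D : R -> Prop) (f : R -> R -> R) :
  jcont D f -> jcont D (fun t x => - f t x).
Proof.
  intros Hf. apply (jcont_comp D f Ropp Hf). intros t x _.
  apply (continuous_opp (V := R_NormedModule) (fun y => y)), continuous_id.
Qed.

Lemma jcont_minus (D : R -> Prop) (f g : R -> R -> R) :
  jcont D f -> jcont D g -> jcont D (fun t x => f t x - g t x).
Proof. intros Hf Hg. apply jcont_plus; [exact Hf|]. apply jcont_opp, Hg. Qed.

Lemma jcont_div (D : R -> Prop) (f g : R -> R -> R) :
  jcont D f -> jcont D g -> (forall t x, D t -> g t x <> 0) ->
  jcont D (fun t x => f t x / g t x).
Proof.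
  intros Hf Hg H0. apply jcont_mult; [exact Hf|].
  apply (jcont_comp D g Rinv Hg). intros t x Ht.
  apply continuous_Rinv, H0, Ht.
Qed.

Lemma jcont_time (D : R -> Prop) (f : R -> R) :
  (forall t, D t -> filterlim f (within D (locally t)) (locally (f t))) ->
  jcont D (fun t _ => f t).
Proof.
  intros Hf t x Ht P HP. destruct (Hf t Ht P HP) as [e He].
  exists e. intros [s y] [H1 _] Hs. apply He; [exact H1|exact Hs].
Qed.

Lemma jcont_time_continuous (D : R -> Prop) (f : R -> R) :
  (forall t, D t -> continuous f t) -> jcont D (fun t _ => f t).
Proof.
  intros Hf. apply jcont_time. intros t Ht. eapply filterlim_filter_le_1; [|apply Hf, Ht].
  intros P HP. unfold within. revert HP. apply filter_imp. auto.
Qed.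

Lemma jcont_space (D : R -> Prop) (f : R -> R) :
  (forall x, continuous f x) -> jcont D (fun _ x => f x).
Proof.
  intros Hf t x Ht P HP. destruct (Hf x P HP) as [e He].
  exists e. intros [s y] [_ H2] _. apply He, H2.
Qed.

Lemma jcont_eps (D : R -> Prop) (g : R -> R -> R) : jcont D g ->
  forall t x, D t -> forall eps : posreal, exists del : posreal,
  forall s y, D s -> Rabs (s - t) < del -> Rabs (y - x) < del ->
    Rabs (g s y - g t x) < eps.
Proof.
  intros Hg t x Ht eps.
  destruct (proj1 (filterlim_locally _ _) (Hg t x Ht) eps) as [d Hd].
  exists d. intros s y Hs H1 H2. apply (Hd (s, y)); [split; assumption|exact Hs].
Qed.

Lemma jcont_slice (D : R -> Prop) (g : R -> R -> R) : jcont D g ->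
  forall t x, D t -> continuous (g t) x.
Proof.
  intros Hg t x Ht. apply filterlim_locally. intros eps.
  destruct (jcont_eps D g Hg t x Ht eps) as [d Hd]. exists d. intros y Hy.
  apply Hd; [exact Ht| |exact Hy]. rewrite Rminus_diag, Rabs_R0. apply cond_pos.
Qed.

Lemma jcont_subset (D D' : R -> Prop) (g : R -> R -> R) :
  (forall t, D' t -> D t) -> jcont D g -> jcont D' g.
Proof.
  intros H Hg t x Ht. eapply filterlim_filter_le_1; [|apply Hg, H, Ht].
  intros P. unfold within. apply filter_imp. intros p Hp Hp'. apply Hp, H, Hp'.
Qed.

(* Uniformity in [x] by compactness of [a, b]. *)
Lemma jcont_tube (D : R -> Prop) (g : R -> R -> R) (a b : R) : jcont D g ->
  forall t, D t -> forall eps : posreal, exists del : posreal,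
  forall s x, D s -> Rabs (s - t) < del -> a <= x <= b ->
    Rabs (g s x - g t x) < eps.
Proof.
  intros Hg t Ht eps.
  assert (He : 0 < eps / 2) by (pose proof (cond_pos eps); lra).
  set (del x := proj1_sig (ClassicalEpsilon.constructive_indefinite_description _
     (jcont_eps D g Hg t x Ht (mkposreal _ He)))).
  assert (Hdel : forall x s y, D s -> Rabs (s - t) < del x -> Rabs (y - x) < del x ->
    Rabs (g s y - g t x) < eps / 2).
  { intros x. exact (proj2_sig (ClassicalEpsilon.constructive_indefinite_description _
     (jcont_eps D g Hg t x Ht (mkposreal _ He)))). }
  destruct (compactness_value_1d a b del) as [d Hd].
  (* [compactness_value_1d] yields a covering centre only up to double negation. Given such a centre
     [u], both values are compared with [g t u]. *)
  exists d. intros s x Hs Hst Hx. apply Classical_Prop.NNPP. intros Hn.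
  apply (Hd x Hx). intros [u [Hu [H1 H2]]]. apply Hn.
  assert (A1 := Hdel u s x Hs (Rlt_le_trans _ _ _ Hst H2) H1).
  assert (A2 := Hdel u t x Ht).
  rewrite Rminus_diag, Rabs_R0 in A2. specialize (A2 (cond_pos _) H1).
  apply Rabs_def2 in A1. apply Rabs_def2 in A2. apply Rabs_def1; lra.
Qed.

(** * Elementary facts on exponentials and integrals *)

Lemma is_series_exp (x : R) : is_series (fun n => x ^ n / INR (fact n)) (exp x).
Proof.
  eapply is_series_ext; [|exact (proj1 (is_pseries_R _ _ _) (is_exp_Reals x))].
  intros n. unfold Rdiv. apply Rmult_comm.
Qed.

Lemma continuous_of_derive (f : R -> R) (x l : R) : is_derive f x l -> continuous f x.
Proof. intros H. apply (ex_derive_continuous (V := R_NormedModule)). exists l. exact H. Qed.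

Lemma ex_RInt_cont (f : R -> R) (a b : R) : (forall x, continuous f x) -> ex_RInt f a b.
Proof. intros H. apply (ex_RInt_continuous (V := R_CompleteNormedModule)). auto. Qed.

Lemma RInt_abs_le (f g : R -> R) (a b : R) : a <= b ->
  (forall x, a <= x <= b -> Rabs (f x) <= g x) -> ex_RInt f a b -> ex_RInt g a b ->
  Rabs (RInt f a b) <= RInt g a b.
Proof.
  intros Hab H Hf Hg.
  exact (norm_RInt_le f g a b _ _ Hab H (RInt_correct _ _ _ Hf) (RInt_correct _ _ _ Hg)).
Qed.

Lemma is_derive_exp_lin (a b t : R) :
  is_derive (fun s => exp (a * (s - b))) t (a * exp (a * (t - b))).
Proof. auto_derive; auto. unfold Rminus. ring. Qed.

Lemma continuous_exp_lin (a b t : R) : continuous (fun s => exp (a * (s - b))) t.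
Proof. eapply continuous_of_derive, is_derive_exp_lin. Qed.

(** * Diagonal linear systems with a bounded perturbation, by the Dyson series *)

Section Dyson.

Variable I : Type.
Variable d : I -> R.
Variable B : R -> (I -> R) -> I -> R.
Variable t0 : R.

(** Iterated Duhamel integrals for x_i' = - d_i x_i + (B x)_i. The factor depending on the final
    time stands outside the integral, so the integrand depends on [s] alone and each term is
    differentiated as a product. *)
Fixpoint dyson (g : I -> R) (n : nat) (i : I) (t : R) : R :=
  match n with
  | 0%nat => g i * exp (- d i * (t - t0))
  | S n => exp (- d i * (t - t0)) *
      RInt (fun s => exp (d i * (s - t0)) * B s (fun j => dyson g n j s) i) t0 t
  end.

Definition flow (g : I -> R) (t : R) (i : I) : R := Series (fun n => dyson g n i t).

Hypothesis d_ge0 : forall i, 0 <= d i.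
Hypothesis B_cont : forall (x : I -> R -> R) i t,
  (forall j, continuous (x j) t) -> continuous (fun s => B s (fun j => x j s) i) t.
Hypothesis B_minus : forall s x y i,
  B s (fun j => x j - y j) i = B s x i - B s y i.
Hypothesis B_series : forall s (x : nat -> I -> R) i,
  (forall j, ex_series (fun n => x n j)) ->
  is_series (fun n => B s (x n) i) (B s (fun j => Series (fun n => x n j)) i).

(** The diagonal flow respects such a weight (third clause) and [B] is bounded by [K] in it (fourth
    clause), so a bound [N * w] propagates through the series with growth exp (K (t - t0)). The
    constant weight serves convergence, [gevrey] serves smoothing. *)
Definition exp_weight (T K : R) (w : I -> R -> R) : Prop :=
  0 <= K /\
  (forall i t, t0 <= t <= T -> 0 <= w i t) /\
  (forall i s t, t0 <= s <= t -> t <= T -> exp (- d i * (t - s)) * w i s <= w i t) /\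
  (forall s x N, t0 <= s <= T -> 0 <= N -> (forall j, Rabs (x j) <= N * w j s) ->
     forall i, Rabs (B s x i) <= K * N * w i s).

Lemma is_derive_dyson_S g n i t :
  (forall j s, continuous (dyson g n j) s) ->
  is_derive (dyson g (S n) i) t (- d i * dyson g (S n) i t + B t (fun j => dyson g n j t) i).
Proof.
  intros Hc. cbn [dyson].
  set (h := fun s => exp (d i * (s - t0)) * B s (fun j => dyson g n j s) i).
  assert (Hh : forall s, continuous h s).
  { intros s. apply (continuous_mult (K := R_AbsRing)); [|apply B_cont; intros j; apply Hc].
    apply continuous_exp_lin. }
  evar_last.
  - apply (is_derive_mult (fun t => exp (- d i * (t - t0))) (fun t => RInt h t0 t)).
    + apply is_derive_exp_lin.
    + apply (is_derive_RInt h (fun t => RInt h t0 t) t0 t); [|apply Hh].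
      apply filter_forall. intros b. apply (RInt_correct (V := R_CompleteNormedModule)).
      apply ex_RInt_cont, Hh.
    + intros; apply Rmult_comm.
  - change plus with Rplus; change mult with Rmult. unfold h at 2.
    replace (exp (- d i * (t - t0)) * (exp (d i * (t - t0)) * B t (fun j => dyson g n j t) i))
      with (B t (fun j => dyson g n j t) i); [ring|].
    rewrite <- Rmult_assoc, <- exp_plus.
    replace (- d i * (t - t0) + d i * (t - t0)) with 0 by ring. rewrite exp_0. ring.
Qed.

Lemma continuous_dyson g n : forall i t, continuous (dyson g n i) t.
Proof.
  induction n; intros i t.
  - apply (continuous_scal_r (V := R_NormedModule) (g i)), continuous_exp_lin.
  - eapply continuous_of_derive, is_derive_dyson_S. exact IHn.
Qed.

(** The third clause of [exp_weight] carries the weight from [s] to [t], so that only a power of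
    [s - t0] is left to integrate. *)
Lemma dyson_bound T K w g N : exp_weight T K w -> 0 <= N ->
  (forall i, Rabs (g i) <= N * w i t0) ->
  forall n i t, t0 <= t <= T ->
    Rabs (dyson g n i t) <= (K * (t - t0)) ^ n / INR (fact n) * N * w i t.
Proof.
  intros [HK [Hw [Hmono HB]]] HN Hg. induction n; intros i t Ht.
  - cbn [dyson]. rewrite Rabs_mult, (Rabs_pos_eq (exp _)) by (left; apply exp_pos).
    simpl. replace (1 / 1 * N * w i t) with (N * w i t) by field.
    eapply Rle_trans; [apply Rmult_le_compat_r; [left; apply exp_pos|apply Hg]|].
    rewrite Rmult_assoc. apply Rmult_le_compat_l; [exact HN|].
    rewrite Rmult_comm. apply Hmono; lra.
  - cbn [dyson]. rewrite Rabs_mult, (Rabs_pos_eq (exp _)) by (left; apply exp_pos).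
    (* [c] freezes the weight at the final time; [P] is a primitive of the majorant [b] and vanishes
       at [t0]. *)
    set (c := exp (d i * (t - t0)) * w i t * N).
    set (P := fun s => K ^ S n * (s - t0) ^ S n / INR (fact (S n)) * c).
    set (b := fun s => K * (K * (s - t0)) ^ n / INR (fact n) * c).
    assert (HP : forall s, is_derive P s (b s)).
    { intros s. unfold P, b.
      assert (E : INR (fact (S n)) = INR (S n) * INR (fact n)).
      { rewrite fact_simpl. apply mult_INR. }
      assert (HS : INR (S n) <> 0) by (apply not_0_INR; lia).
      assert (Hf := INR_fact_neq_0 n).
      rewrite E. revert HS Hf. generalize (INR (fact n)). intros F HS Hf.
      evar_last.
      - apply (is_derive_ext (fun s => (s - t0) ^ S n * (K ^ S n / (INR (S n) * F) * c))).
        { intros u. unfold Rdiv. eqR; ring. }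
        apply (is_derive_scal_l (V := R_NormedModule)), (is_derive_pow (fun u => u - t0) (S n) s 1).
        auto_derive; auto.
      - change scal with Rmult. simpl Init.Nat.pred.
        rewrite Rpow_mult_distr, <- (tech_pow_Rmult K n). field. split; assumption. }
    assert (Hb : forall s, continuous b s).
    { intros s. eapply continuous_of_derive. unfold b. auto_derive; auto. }
    assert (Hint : is_RInt b t0 t (P t - P t0)).
    { apply (is_RInt_derive (V := R_CompleteNormedModule) P b); intros; auto. }
    assert (L : Rabs (RInt (fun s => exp (d i * (s - t0)) * B s (fun j => dyson g n j s) i) t0 t)
      <= P t).
    { replace (P t) with (RInt b t0 t).
      2:{ rewrite (is_RInt_unique _ _ _ _ Hint). unfold P at 2.
          rewrite Rminus_diag. rewrite (pow_i (S n)) by lia. unfold Rdiv. eqR; ring. }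
      apply RInt_abs_le; [lra| | |eexists; exact Hint].
      - intros s Hs. rewrite Rabs_mult, (Rabs_pos_eq (exp _)) by (left; apply exp_pos).
        assert (Hp : 0 <= (K * (s - t0)) ^ n / INR (fact n) * N).
        { apply Rmult_le_pos; [|exact HN]. apply Rmult_le_pos.
          - apply pow_le, Rmult_le_pos; lra.
          - left. apply Rinv_0_lt_compat, INR_fact_lt_0. }
        assert (HBs := HB s (fun j => dyson g n j s) _ ltac:(lra) Hp
           (fun j => IHn j s ltac:(lra)) i).
        eapply Rle_trans; [apply Rmult_le_compat_l; [left; apply exp_pos|apply HBs]|].
        unfold b, c.
        replace (exp (d i * (s - t0))) with (exp (d i * (t - t0)) * exp (- d i * (t - s))).
        2:{ rewrite <- exp_plus. f_equal. ring. }
        assert (Hm := Hmono i s t ltac:(lra) ltac:(lra)).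
        replace (_ * _ * (K * _ * w i s)) with
          (K * ((K * (s - t0)) ^ n / INR (fact n) * N) * exp (d i * (t - t0))
             * (exp (- d i * (t - s)) * w i s)) by ring.
        replace (_ * (_ * w i t * N)) with
          (K * ((K * (s - t0)) ^ n / INR (fact n) * N) * exp (d i * (t - t0)) * w i t)
          by (unfold Rdiv; ring).
        apply Rmult_le_compat_l; [|exact Hm].
        apply Rmult_le_pos; [|left; apply exp_pos]. apply Rmult_le_pos; assumption.
      - apply ex_RInt_cont. intros s.
        apply (continuous_mult (K := R_AbsRing)).
        + apply continuous_exp_lin.
        + apply B_cont. intros j. apply continuous_dyson. }
    eapply Rle_trans; [apply Rmult_le_compat_l; [left; apply exp_pos|exact L]|].
    unfold P, c. right. rewrite Rpow_mult_distr.
    transitivity (exp (- d i * (t - t0)) * exp (d i * (t - t0)) *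
       (K ^ S n * (t - t0) ^ S n / INR (fact (S n)) * N * w i t)); [ring|].
    rewrite <- exp_plus. replace (- d i * (t - t0) + d i * (t - t0)) with 0 by ring.
    rewrite exp_0. ring.
Qed.

Lemma ex_series_dyson T K w g N : exp_weight T K w -> 0 <= N ->
  (forall i, Rabs (g i) <= N * w i t0) ->
  forall i t, t0 <= t <= T -> ex_series (fun n => dyson g n i t).
Proof.
  intros Hw HN Hg i t Ht.
  apply ex_series_dominated with (fun n => (K * (t - t0)) ^ n / INR (fact n) * (N * w i t)).
  - intros n. rewrite <- Rmult_assoc. apply dyson_bound with T; auto.
  - apply ex_series_scal_r. eexists. apply is_series_exp.
Qed.

Lemma flow_bound T K w g N : exp_weight T K w -> 0 <= N ->
  (forall i, Rabs (g i) <= N * w i t0) ->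
  forall i t, t0 <= t <= T -> Rabs (flow g t i) <= exp (K * (t - t0)) * N * w i t.
Proof.
  intros Hw HN Hg i t Ht. unfold flow.
  replace (exp (K * (t - t0)) * N * w i t) with
    (Series (fun n => (K * (t - t0)) ^ n / INR (fact n) * (N * w i t))).
  - apply Series_abs_le.
    + intros n. rewrite <- Rmult_assoc. apply dyson_bound with T; auto.
    + apply ex_series_scal_r. eexists. apply is_series_exp.
  - rewrite Series_scal_r, Rmult_assoc. f_equal. apply is_series_unique, is_series_exp.
Qed.

Lemma dyson_minus g h n : forall i t,
  dyson (fun j => g j - h j) n i t = dyson g n i t - dyson h n i t.
Proof.
  induction n; intros i t; cbn [dyson]; [ring|].
  rewrite <- Rmult_minus_distr_l. f_equal.
  assert (Hex : forall f, ex_RInt (fun s => exp (d i * (s - t0)) * B s (fun j => dyson f n j s) i) t0 t).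
  { intros f. apply ex_RInt_cont. intros s. apply (continuous_mult (K := R_AbsRing)).
    - apply continuous_exp_lin.
    - apply B_cont. intros j. apply continuous_dyson. }
  rewrite <- (RInt_minus (V := R_CompleteNormedModule)) by apply Hex.
  apply RInt_ext. intros s _. change minus with Rminus.
  rewrite <- Rmult_minus_distr_l, <- B_minus. f_equal.
  assert (E : (fun j => dyson (fun j => g j - h j) n j s) = (fun j => dyson g n j s - dyson h n j s)).
  { apply FunctionalExtensionality.functional_extensionality. intros j. apply IHn. }
  rewrite E. reflexivity.
Qed.

Hypothesis unit_weight : forall T, exists K, exp_weight T K (fun _ _ => 1).

Lemma flow_minus g h N : (forall i, Rabs (g i) <= N) -> (forall i, Rabs (h i) <= N) ->
  forall t i, t0 <= t ->
  flow (fun j => g j - h j) t i = flow g t i - flow h t i.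
Proof.
  intros Hg Hh t i Ht. destruct (unit_weight t) as [K HK].
  assert (HN : 0 <= N) by (eapply Rle_trans; [apply Rabs_pos|apply (Hg i)]).
  unfold flow. rewrite <- Series_minus.
  - apply Series_ext. intros n. apply dyson_minus.
  - apply (ex_series_dyson t K _ g N HK HN); [|lra]. intros j. rewrite Rmult_1_r. apply Hg.
  - apply (ex_series_dyson t K _ h N HK HN); [|lra]. intros j. rewrite Rmult_1_r. apply Hh.
Qed.

Lemma dyson_bound_uniform T K g N : exp_weight T K (fun _ _ => 1) ->
  (forall i, Rabs (g i) <= N) ->
  forall n i t, t0 <= t <= T ->
    Rabs (dyson g n i t) <= (K * (T - t0)) ^ n / INR (fact n) * N.
Proof.
  intros Hw Hg n i t Ht.
  assert (HN : 0 <= N) by (eapply Rle_trans; [apply Rabs_pos|apply (Hg i)]).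
  assert (HK := proj1 Hw).
  eapply Rle_trans; [apply (dyson_bound T K _ g N Hw HN); [|exact Ht]|].
  - intros j. rewrite Rmult_1_r. apply Hg.
  - rewrite Rmult_1_r. apply Rmult_le_compat_r; [exact HN|].
    apply Rmult_le_compat_r; [left; apply Rinv_0_lt_compat, INR_fact_lt_0|].
    apply pow_incr. split; [apply Rmult_le_pos; lra|]. apply Rmult_le_compat_l; lra.
Qed.

Lemma flow_init g : (forall i, flow g t0 i = g i).
Proof.
  intros i. unfold flow. apply is_series_unique.
  assert (E : forall n, dyson g n i t0 = match n with 0%nat => g i | S _ => 0 end).
  { intros [|n]; cbn [dyson].
    - rewrite Rminus_diag, Rmult_0_r, exp_0. ring.
    - rewrite RInt_point. change zero with 0. ring. }
  apply is_series_decr_1.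
  apply (is_series_ext (fun _ => 0)).
  - intros n. symmetry. exact (E (S n)).
  - rewrite (E 0%nat). change (is_series (fun _ : nat => 0) (g i + - g i)).
    rewrite Rplus_opp_r. apply filterlim_ext with (fun _ => 0).
    + intros n. rewrite sum_n_Reals. induction n; simpl; [reflexivity|]. rewrite <- IHn. ring.
    + apply filterlim_const.
Qed.

Lemma flow_continuous g N : (forall i, Rabs (g i) <= N) ->
  forall i t, t0 <= t ->
  filterlim (fun s => flow g s i) (within (fun s => t0 <= s) (locally t)) (locally (flow g t i)).
Proof.
  intros Hg i t Ht. destruct (unit_weight (t + 1)) as [K HK].
  apply (filterlim_Series _ (fun n s => dyson g n i s) (fun n => dyson g n i t)
    (fun n => (K * (t + 1 - t0)) ^ n / INR (fact n) * N)).
  - apply ex_series_scal_r. eexists. apply is_series_exp.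
  - exists (mkposreal 1 Rlt_0_1). intros s Hs Hs0 n. change (Rabs (s - t) < 1) in Hs.
    apply Rabs_def2 in Hs. apply dyson_bound_uniform; auto. lra.
  - intros n. apply dyson_bound_uniform; auto. lra.
  - intros n. eapply filterlim_filter_le_1; [|apply (continuous_dyson g n i t)].
    intros P. unfold within. apply filter_imp. auto.
Qed.

Lemma is_derive_flow g N : (forall i, Rabs (g i) <= N) ->
  forall i t, t0 < t ->
  is_derive (fun s => flow g s i) t (- d i * flow g t i + B t (flow g t) i).
Proof.
  intros Hg i t Ht. destruct (unit_weight (t + 1)) as [K HK].
  assert (HN : 0 <= N) by (eapply Rle_trans; [apply Rabs_pos|apply (Hg i)]).
  assert (HK0 := proj1 HK).
  assert (Hdel : 0 < Rmin 1 (t - t0)) by (apply Rmin_glb_lt; lra).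
  set (e := fun n => (K * (t + 1 - t0)) ^ n / INR (fact n) * N).
  assert (He : ex_series e) by (apply ex_series_scal_r; eexists; apply is_series_exp).
  assert (Hin : forall s, Rabs (s - t) < Rmin 1 (t - t0) -> t0 <= s <= t + 1).
  { intros s Hs. assert (A := Rlt_le_trans _ _ _ Hs (Rmin_l _ _)).
    assert (A' := Rlt_le_trans _ _ _ Hs (Rmin_r _ _)).
    apply Rabs_def2 in A. apply Rabs_def2 in A'. lra. }
  assert (Hb : forall n j s, t0 <= s <= t + 1 -> Rabs (dyson g n j s) <= e n).
  { intros n j s Hs. apply dyson_bound_uniform; auto. }
  (* The derivative of term [n] involves [B] of term [n - 1]; for [n = 0] this part is 0, and
     dropping that zero at the end shifts the index back. *)
  set (h' := fun n s => - d i * dyson g n i s +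
     match n with 0%nat => 0 | S m => B s (fun j => dyson g m j s) i end).
  assert (D : is_derive (fun s => Series (fun n => dyson g n i s)) t (Series (fun n => h' n t))).
  { apply (is_derive_Series (fun n s => dyson g n i s) h'
      (fun n => d i * e n + match n with 0%nat => 0 | S m => K * e m end) t (mkposreal _ Hdel)).
    - apply (ex_series_plus (V := R_NormedModule)).
      + apply (ex_series_scal (V := R_NormedModule)), He.
      + apply ex_series_incr_1. apply (ex_series_scal (V := R_NormedModule)), He.
    - intros n s Hs. unfold h'. destruct n as [|n].
      + cbn [dyson]. auto_derive; auto. unfold Rminus. ring.
      + apply is_derive_dyson_S. apply continuous_dyson.
    - intros n s Hs. apply Hin in Hs. unfold h'.
      eapply Rle_trans; [apply Rabs_triang|]. apply Rplus_le_compat.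
      + rewrite Rabs_mult, Rabs_Ropp, (Rabs_pos_eq (d i)) by apply d_ge0.
        apply Rmult_le_compat_l; [apply d_ge0|]. apply Hb, Hs.
      + destruct n as [|n]; [rewrite Rabs_R0; lra|].
        destruct HK as [_ [_ [_ HB]]].
        rewrite <- (Rmult_1_r (K * e n)). apply HB; [exact Hs| |].
        * eapply Rle_trans; [apply Rabs_pos|apply (Hb n i s Hs)].
        * intros j. rewrite Rmult_1_r. apply Hb, Hs.
    - intros s Hs. apply (ex_series_dyson (t + 1) K _ g N HK HN); [|apply Hin, Hs].
      intros j. rewrite Rmult_1_r. apply Hg. }
  replace (- d i * flow g t i + B t (flow g t) i) with (Series (fun n => h' n t)); [exact D|].
  assert (Hex : forall j, ex_series (fun n => dyson g n j t)).
  { intros j. apply (ex_series_dyson (t + 1) K _ g N HK HN); [|lra].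
    intros k. rewrite Rmult_1_r. apply Hg. }
  assert (HS := B_series t (fun n j => dyson g n j t) i Hex).
  unfold h'. rewrite Series_plus.
  - rewrite Series_scal_l. unfold flow at 1. f_equal.
    rewrite Series_incr_1_aux by reflexivity. exact (is_series_unique _ _ HS).
  - apply (ex_series_scal (V := R_NormedModule)), Hex.
  - apply ex_series_incr_1. eexists; exact HS.
Qed.

End Dyson.

(** * Trigonometric series indexed by the integers *)

(** Pairing [n] with [- n - 1] meets every integer exactly once, so sums over the integers become
    series over [nat]. *)
Definition zfold (h : Z -> R) (n : nat) : R := h (Z.of_nat n) + h (- Z.of_nat n - 1)%Z.
Definition zsum (h : Z -> R) : R := Series (zfold h).
Definition wt (m : nat) (k : Z) : R := / (1 + Rabs (IZR k)) ^ m.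

Lemma base_pos (k : Z) : 0 < 1 + Rabs (IZR k).
Proof. pose proof (Rabs_pos (IZR k)). lra. Qed.

Lemma wt_pos m k : 0 < wt m k.
Proof. apply Rinv_0_lt_compat, pow_lt, base_pos. Qed.

Lemma wt_0 k : wt 0 k = 1.
Proof. unfold wt. simpl. apply Rinv_1. Qed.

Lemma wt_le_1 m k : wt m k <= 1.
Proof.
  unfold wt. rewrite <- Rinv_1. apply Rinv_le_contravar; [lra|].
  apply pow_R1_Rle. pose proof (Rabs_pos (IZR k)). lra.
Qed.

Lemma wt_S m k : Rabs (IZR k) * wt (S m) k <= wt m k.
Proof.
  unfold wt. pose proof (base_pos k). pose proof (Rabs_pos (IZR k)).
  rewrite <- tech_pow_Rmult, Rinv_mult, <- Rmult_assoc.
  rewrite <- (Rmult_1_l (/ (1 + Rabs (IZR k)) ^ m)) at 2.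
  apply Rmult_le_compat_r; [left; apply Rinv_0_lt_compat, pow_lt; lra|].
  apply (Rmult_le_reg_r (1 + Rabs (IZR k))); [lra|].
  rewrite Rmult_assoc, Rinv_l; lra.
Qed.

Lemma wt_mono m m' k : (m <= m')%nat -> wt m' k <= wt m k.
Proof.
  intros H. apply Rinv_le_contravar; [apply pow_lt, base_pos|].
  apply Rle_pow; [|exact H]. pose proof (Rabs_pos (IZR k)). lra.
Qed.

(** Peetre's inequality: 1 + |k| is at most (1 + |k + j|) (1 + |j|). *)
Lemma wt_shift m k j : wt m (k + j) <= (1 + Rabs (IZR j)) ^ m * wt m k.
Proof.
  unfold wt. pose proof (base_pos k). pose proof (base_pos j). pose proof (base_pos (k + j)).
  rewrite <- !pow_inv, <- Rpow_mult_distr.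
  apply pow_incr. split; [left; apply Rinv_0_lt_compat; lra|].
  apply (Rmult_le_reg_r (1 + Rabs (IZR (k + j)))); [lra|]. rewrite Rinv_l by lra.
  apply (Rmult_le_reg_l (1 + Rabs (IZR k))); [lra|].
  replace (_ * (_ * _ * _)) with ((1 + Rabs (IZR j)) * (1 + Rabs (IZR (k + j)))) by (field; lra).
  assert (Rabs (IZR k) <= Rabs (IZR (k + j)) + Rabs (IZR j)).
  { replace (IZR k) with (IZR (k + j) - IZR j) by (rewrite plus_IZR; ring).
    eapply Rle_trans; [apply Rabs_triang|]. rewrite Rabs_Ropp. lra. }
  pose proof (Rabs_pos (IZR j)). pose proof (Rabs_pos (IZR (k + j))). nra.
Qed.

Definition zdom (C : R) (h : Z -> R) : Prop := forall k, Rabs (h k) <= C * wt 2 k.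

Definition zbound (n : nat) : R := 2 * / (1 + INR n) ^ 2.

Lemma ex_series_zbound : ex_series zbound.
Proof. apply (ex_series_scal (V := R_NormedModule)), ex_series_inv_sqr. Qed.

Lemma zdom_ge0 C h : zdom C h -> 0 <= C.
Proof.
  intros H. specialize (H 0%Z). pose proof (wt_pos 2 0). pose proof (Rabs_pos (h 0%Z)).
  apply Rmult_le_reg_r with (wt 2 0); lra.
Qed.

Lemma zfold_bound C h : zdom C h -> forall n, Rabs (zfold h n) <= C * zbound n.
Proof.
  intros H n. unfold zfold, zbound. eapply Rle_trans; [apply Rabs_triang|].
  assert (HC := zdom_ge0 _ _ H). pose proof (pos_INR n).
  replace (C * (2 * / (1 + INR n) ^ 2)) with (C * / (1 + INR n) ^ 2 + C * / (1 + INR n) ^ 2) by ring.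
  assert (E1 : Rabs (IZR (Z.of_nat n)) = INR n).
  { rewrite <- INR_IZR_INZ. apply Rabs_pos_eq. lra. }
  assert (E2 : Rabs (IZR (- Z.of_nat n - 1)) = INR n + 1).
  { rewrite minus_IZR, opp_IZR, <- INR_IZR_INZ. rewrite <- Rabs_Ropp. rewrite Rabs_pos_eq; lra. }
  apply Rplus_le_compat; (eapply Rle_trans; [apply H|]); apply Rmult_le_compat_l; try exact HC;
    unfold wt.
  - rewrite E1. lra.
  - rewrite E2. apply Rinv_le_contravar; [apply pow_lt; lra|]. apply pow_incr. lra.
Qed.

Lemma ex_zsum C h : zdom C h -> ex_series (zfold h).
Proof.
  intros H. apply ex_series_dominated with (fun n => C * zbound n).
  - apply zfold_bound, H.
  - apply (ex_series_scal (V := R_NormedModule)), ex_series_zbound.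
Qed.

Lemma zsum_bound C h : zdom C h -> Rabs (zsum h) <= C * Series zbound.
Proof.
  intros H. rewrite <- Series_scal_l. apply Series_abs_le.
  - apply zfold_bound, H.
  - apply (ex_series_scal (V := R_NormedModule)), ex_series_zbound.
Qed.

Lemma zsum_ext g h : (forall k, g k = h k) -> zsum g = zsum h.
Proof. intros H. apply Series_ext. intros n. unfold zfold. rewrite !H. reflexivity. Qed.

Lemma zsum_plus C C' g h : zdom C g -> zdom C' h ->
  zsum (fun k => g k + h k) = zsum g + zsum h.
Proof.
  intros Hg Hh. unfold zsum. rewrite <- Series_plus.
  - apply Series_ext. intros n. unfold zfold. ring.
  - exact (ex_zsum _ _ Hg).
  - exact (ex_zsum _ _ Hh).
Qed.

Lemma zsum_scal a h : zsum (fun k => a * h k) = a * zsum h.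
Proof.
  unfold zsum. rewrite <- Series_scal_l. apply Series_ext. intros n. unfold zfold. ring.
Qed.

Lemma zdom_shift C h j : zdom C h -> zdom (C * (1 + Rabs (IZR j)) ^ 2) (fun k => h (k + j)%Z).
Proof.
  intros H k. eapply Rle_trans; [apply H|]. rewrite Rmult_assoc.
  apply Rmult_le_compat_l; [apply (zdom_ge0 _ _ H)|]. apply wt_shift.
Qed.

(* The partial sums of both sides differ by two boundary terms. *)
Lemma zsum_shift1 C h : zdom C h -> zsum (fun k => h (k + 1)%Z) = zsum h.
Proof.
  intros H. apply Rminus_diag_uniq. unfold zsum.
  rewrite <- Series_minus; [|exact (ex_zsum _ _ (zdom_shift C h 1 H))|exact (ex_zsum _ _ H)].
  apply is_series_unique.
  assert (E : forall N, sum_f_R0 (fun n => zfold (fun k => h (k + 1)%Z) n - zfold h n) N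
     = h (Z.of_nat N + 1)%Z - h (- Z.of_nat N - 1)%Z).
  { intros N. induction N.
    - simpl. unfold zfold. simpl. ring.
    - cbn [sum_f_R0]. rewrite IHN. unfold zfold. rewrite Nat2Z.inj_succ.
      replace (- Z.succ (Z.of_nat N) - 1 + 1)%Z with (- Z.of_nat N - 1)%Z by lia.
      replace (Z.of_nat N + 1)%Z with (Z.succ (Z.of_nat N)) by lia. eqR. ring. }
  unfold is_series. eapply filterlim_ext; [intros N; symmetry; etransitivity; [apply sum_n_Reals|apply E]|].
  assert (L0 : forall g : nat -> Z, (forall n, INR n <= Rabs (IZR (g n))) ->
     is_lim_seq (fun n => h (g n)) 0).
  { intros g Hg. apply is_lim_seq_abs_0.
    apply is_lim_seq_le_le with (fun _ => 0) (fun n => C * zbound n).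
    - intros n. split; [apply Rabs_pos|]. eapply Rle_trans; [apply H|].
      apply Rmult_le_compat_l; [apply (zdom_ge0 _ _ H)|]. unfold wt, zbound.
      pose proof (pos_INR n). specialize (Hg n).
      apply Rle_trans with (/ (1 + INR n) ^ 2).
      + apply Rinv_le_contravar; [apply pow_lt; lra|]. apply pow_incr. lra.
      + assert (0 < / (1 + INR n) ^ 2) by (apply Rinv_0_lt_compat, pow_lt; lra). lra.
    - apply is_lim_seq_const.
    - replace 0 with (C * 0) by ring. apply (is_lim_seq_scal_l _ C 0).
      apply ex_series_lim_0, ex_series_zbound. }
  assert (L : is_lim_seq (fun N => h (Z.of_nat N + 1)%Z - h (- Z.of_nat N - 1)%Z) (0 - 0)).
  { apply is_lim_seq_minus'; apply L0; intros n; pose proof (pos_INR n).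
    - rewrite plus_IZR, <- INR_IZR_INZ, Rabs_pos_eq; lra.
    - rewrite minus_IZR, opp_IZR, <- INR_IZR_INZ, <- Rabs_Ropp, Rabs_pos_eq; lra. }
  rewrite Rminus_0_r in L. exact L.
Qed.

Lemma zsum_shift C h j : zdom C h -> zsum (fun k => h (k + j)%Z) = zsum h.
Proof.
  intros H.
  assert (P : forall n, zsum (fun k => h (k + Z.of_nat n)%Z) = zsum h).
  { induction n.
    - apply zsum_ext. intros k. f_equal. lia.
    - rewrite <- IHn. rewrite <- (zsum_shift1 _ _ (zdom_shift C h (Z.of_nat n) H)).
      apply zsum_ext. intros k. f_equal. lia. }
  destruct (Z_le_gt_dec 0 j) as [Hj|Hj].
  - rewrite <- (Z2Nat.id j) by exact Hj. apply P.
  - assert (Q : forall n, zsum (fun k => h (k - Z.of_nat n)%Z) = zsum h).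
    { induction n.
      - apply zsum_ext. intros k. f_equal. lia.
      - rewrite <- IHn. transitivity (zsum (fun k => h (k + - Z.of_nat (S n))%Z)).
        + apply zsum_ext. intros k. f_equal.
        + rewrite <- (zsum_shift1 _ _ (zdom_shift C h (- Z.of_nat (S n)) H)).
          apply zsum_ext. intros k. f_equal. lia. }
    rewrite <- (Q (Z.to_nat (- j))). apply zsum_ext. intros k. f_equal. lia.
Qed.

(* Coefficients: [p (k, true)] multiplies [cos (k th)] and [p (k, false)]
   multiplies [sin (k th)], for all integers [k].  This spanning set is redundant, but
   multiplication by a trigonometric monomial becomes a plain shift of indices. *)
Definition coefs : Type := (Z * bool -> R)%type.

Definition mode (p : coefs) (th : R) (k : Z) : R :=
  p (k, true) * cos (IZR k * th) + p (k, false) * sin (IZR k * th).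

Definition trig (p : coefs) (th : R) : R := zsum (mode p th).

Definition decay (m : nat) (C : R) (p : coefs) : Prop :=
  forall k b, Rabs (p (k, b)) <= C * wt m k.

Definition dcoef (p : coefs) : coefs := fun i =>
  match i with
  | (k, true) => IZR k * p (k, false)
  | (k, false) => - IZR k * p (k, true)
  end.

(** The product-to-sum formulas for multiplication by al cos (j th) + be sin (j th). *)
Definition mulcoef (j : Z) (al be : R) (p : coefs) : coefs := fun i =>
  match i with
  | (k, true) => al / 2 * (p ((k - j)%Z, true) + p ((k + j)%Z, true))
                 + be / 2 * (p ((k + j)%Z, false) - p ((k - j)%Z, false))
  | (k, false) => al / 2 * (p ((k - j)%Z, false) + p ((k + j)%Z, false))
                 + be / 2 * (p ((k - j)%Z, true) - p ((k + j)%Z, true))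
  end.

Lemma Rabs_lincomb_le a b u v M : Rabs u <= 1 -> Rabs v <= 1 ->
  Rabs a <= M -> Rabs b <= M -> Rabs (a * u + b * v) <= 2 * M.
Proof.
  intros Hu Hv Ha Hb. eapply Rle_trans; [apply Rabs_triang|]. rewrite !Rabs_mult.
  pose proof (Rabs_pos a). pose proof (Rabs_pos b).
  pose proof (Rabs_pos u). pose proof (Rabs_pos v). nra.
Qed.

Lemma Rabs_cos_le x : Rabs (cos x) <= 1.
Proof. apply Rabs_le, COS_bound. Qed.

Lemma Rabs_sin_le x : Rabs (sin x) <= 1.
Proof. apply Rabs_le, SIN_bound. Qed.

Lemma decay_ge0 m C p : decay m C p -> 0 <= C.
Proof.
  intros H. specialize (H 0%Z true). pose proof (wt_pos m 0).
  pose proof (Rabs_pos (p (0%Z, true))). apply Rmult_le_reg_r with (wt m 0); lra.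
Qed.

Lemma decay_mono m m' C C' p : (m' <= m)%nat -> C <= C' -> decay m C p -> decay m' C' p.
Proof.
  intros Hm HC H k b. assert (H0 := decay_ge0 _ _ _ H).
  eapply Rle_trans; [apply H|].
  pose proof (wt_mono m' m k Hm). pose proof (wt_pos m k). nra.
Qed.

Lemma decay_zdom C p th : decay 2 C p -> zdom (2 * C) (mode p th).
Proof.
  intros H k. rewrite Rmult_assoc.
  apply Rabs_lincomb_le; auto using Rabs_cos_le, Rabs_sin_le.
Qed.

Lemma decay_dcoef m C p : decay (S m) C p -> decay m C (dcoef p).
Proof.
  intros H k b. assert (H0 := decay_ge0 _ _ _ H). pose proof (wt_S m k).
  destruct b; cbn [dcoef]; rewrite Rabs_mult, ?Rabs_Ropp.
  - specialize (H k false). pose proof (Rabs_pos (IZR k)).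
    eapply Rle_trans; [apply Rmult_le_compat_l, H; assumption|]. nra.
  - specialize (H k true). pose proof (Rabs_pos (IZR k)).
    eapply Rle_trans; [apply Rmult_le_compat_l, H; assumption|]. nra.
Qed.

Lemma decay_plus m C C' p q : decay m C p -> decay m C' q -> decay m (C + C') (fun i => p i + q i).
Proof.
  intros Hp Hq k b. eapply Rle_trans; [apply Rabs_triang|].
  specialize (Hp k b). specialize (Hq k b). lra.
Qed.

Lemma decay_scal m C p a : decay m C p -> decay m (Rabs a * C) (fun i => a * p i).
Proof.
  intros Hp k b. rewrite Rabs_mult, Rmult_assoc. apply Rmult_le_compat_l; [apply Rabs_pos|apply Hp].
Qed.

(** The weight stays general because only its change under a shift by [j], at most a factor [L],
    matters; polynomial and exponential weights are both plugged in later. *)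
Lemma mulcoef_bound (w : Z -> R) (L N al be Q : R) (j : Z) (p : coefs) :
  0 <= N -> Rabs al <= Q -> Rabs be <= Q ->
  (forall k b, Rabs (p (k, b)) <= N * w k) ->
  (forall k, w (k + j)%Z <= L * w k) -> (forall k, w (k - j)%Z <= L * w k) ->
  forall k b, Rabs (mulcoef j al be p (k, b)) <= 2 * Q * L * N * w k.
Proof.
  intros HN Hal Hbe Hp H1 H2 k b.
  assert (P1 : forall b, Rabs (p ((k + j)%Z, b)) <= N * (L * w k)).
  { intros b'. eapply Rle_trans; [apply Hp|]. apply Rmult_le_compat_l; auto. }
  assert (P2 : forall b, Rabs (p ((k - j)%Z, b)) <= N * (L * w k)).
  { intros b'. eapply Rle_trans; [apply Hp|]. apply Rmult_le_compat_l; auto. }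
  assert (G : forall x y z u M, Rabs x <= M -> Rabs y <= M -> Rabs z <= M -> Rabs u <= M ->
     Rabs (al / 2 * (x + y) + be / 2 * (z - u)) <= 2 * Q * M).
  { clear - Hal Hbe. intros x y z u M Hx Hy Hz Hu.
    eapply Rle_trans; [apply Rabs_triang|]. rewrite !Rabs_mult.
    assert (A1 : Rabs (x + y) <= 2 * M) by (eapply Rle_trans; [apply Rabs_triang|]; lra).
    assert (A2 : Rabs (z - u) <= 2 * M)
      by (eapply Rle_trans; [apply Rabs_triang|]; rewrite Rabs_Ropp; lra).
    rewrite (Rabs_div al), (Rabs_div be), (Rabs_pos_eq 2) by lra.
    pose proof (Rabs_pos al). pose proof (Rabs_pos be).
    pose proof (Rabs_pos (x + y)). pose proof (Rabs_pos (z - u)). nra. }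
  replace (2 * Q * L * N * w k) with (2 * Q * (N * (L * w k))) by ring.
  destruct b; cbn [mulcoef]; apply G; auto.
Qed.

Lemma decay_mulcoef m C j al be p : decay m C p ->
  decay m (2 * (Rabs al + Rabs be) * (1 + Rabs (IZR j)) ^ m * C) (mulcoef j al be p).
Proof.
  intros H. intros k b.
  assert (HC := decay_ge0 _ _ _ H). pose proof (Rabs_pos al). pose proof (Rabs_pos be).
  apply mulcoef_bound; try lra; [exact H| |].
  - intros k'. apply wt_shift.
  - intros k'. pose proof (wt_shift m k' (- j)) as W.
    rewrite opp_IZR, Rabs_Ropp in W. exact W.
Qed.

Lemma trig_ext p q th : (forall i, p i = q i) -> trig p th = trig q th.
Proof. intros H. apply zsum_ext. intros k. unfold mode. rewrite !H. reflexivity. Qed.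

Lemma trig_plus C C' p q th : decay 2 C p -> decay 2 C' q ->
  trig (fun i => p i + q i) th = trig p th + trig q th.
Proof.
  intros Hp Hq. unfold trig.
  rewrite <- (zsum_plus _ _ _ _ (decay_zdom _ _ th Hp) (decay_zdom _ _ th Hq)).
  apply zsum_ext. intros k. unfold mode. ring.
Qed.

Lemma trig_scal a p th : trig (fun i => a * p i) th = a * trig p th.
Proof. unfold trig. rewrite <- zsum_scal. apply zsum_ext. intros k. unfold mode. ring. Qed.

Lemma trig_bound C p th : decay 2 C p -> Rabs (trig p th) <= 2 * C * Series zbound.
Proof. intros H. apply zsum_bound, decay_zdom, H. Qed.

Lemma trig_mulcoef C j al be p th : decay 2 C p ->
  trig (mulcoef j al be p) th = (al * cos (IZR j * th) + be * sin (IZR j * th)) * trig p th.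
Proof.
  intros H.
  (* [h1 k] is what mode [k] contributes at frequency k + j, and [h2 k] at frequency k - j. Shift
     invariance of [zsum] realigns the two families. *)
  set (h1 := fun k => / 2 * (al * (p (k, true) * cos (IZR (k + j) * th) + p (k, false) * sin (IZR (k + j) * th))
      + be * (p (k, true) * sin (IZR (k + j) * th) - p (k, false) * cos (IZR (k + j) * th)))).
  set (h2 := fun k => / 2 * (al * (p (k, true) * cos (IZR (k - j) * th) + p (k, false) * sin (IZR (k - j) * th))
      + be * (p (k, false) * cos (IZR (k - j) * th) - p (k, true) * sin (IZR (k - j) * th)))).
  assert (HD : forall u v u' v' k, Rabs u <= 1 -> Rabs v <= 1 -> Rabs u' <= 1 -> Rabs v' <= 1 ->
    Rabs (/ 2 * (al * (p (k, true) * u + p (k, false) * v) + be * (p (k, true) * u' + p (k, false) * v')))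
     <= (Rabs al + Rabs be) * C * wt 2 k).
  { intros u v u' v' k Hu Hv Hu' Hv'.
    assert (A := Rabs_lincomb_le _ _ _ _ _ Hu Hv (H k true) (H k false)).
    assert (A' := Rabs_lincomb_le _ _ _ _ _ Hu' Hv' (H k true) (H k false)).
    rewrite Rabs_mult, (Rabs_pos_eq (/ 2)) by lra.
    pose proof (Rabs_triang (al * (p (k, true) * u + p (k, false) * v)) (be * (p (k, true) * u' + p (k, false) * v'))) as T.
    rewrite !Rabs_mult in T. pose proof (Rabs_pos al). pose proof (Rabs_pos be). nra. }
  assert (No : forall x, Rabs x <= 1 -> Rabs (- x) <= 1) by (intros x; rewrite Rabs_Ropp; auto).
  assert (D1 : zdom ((Rabs al + Rabs be) * C) h1).
  { intros k. unfold h1.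
    replace (p (k, true) * sin (IZR (k + j) * th) - p (k, false) * cos (IZR (k + j) * th))
      with (p (k, true) * sin (IZR (k + j) * th) + p (k, false) * - cos (IZR (k + j) * th)) by ring.
    apply HD; auto using Rabs_cos_le, Rabs_sin_le. }
  assert (D2 : zdom ((Rabs al + Rabs be) * C) h2).
  { intros k. unfold h2.
    replace (p (k, false) * cos (IZR (k - j) * th) - p (k, true) * sin (IZR (k - j) * th))
      with (p (k, true) * - sin (IZR (k - j) * th) + p (k, false) * cos (IZR (k - j) * th)) by ring.
    apply HD; auto using Rabs_cos_le, Rabs_sin_le. }
  transitivity (zsum (fun k => h1 (k + - j)%Z + h2 (k + j)%Z)).
  { apply zsum_ext. intros k. unfold mode, h1, h2. cbn [mulcoef].
    replace (k + - j + j)%Z with k by lia. replace (k + j - j)%Z with k by lia.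
    replace (k + - j)%Z with (k - j)%Z by lia. field. }
  rewrite (zsum_plus _ _ _ _ (zdom_shift _ _ (- j) D1) (zdom_shift _ _ j D2)).
  rewrite (zsum_shift _ _ _ D1), (zsum_shift _ _ _ D2).
  rewrite <- (zsum_plus _ _ _ _ D1 D2). unfold trig. rewrite <- zsum_scal.
  apply zsum_ext. intros k. unfold h1, h2, mode.
  rewrite plus_IZR, minus_IZR, Rmult_plus_distr_r, Rmult_minus_distr_r, cos_plus, sin_plus, cos_minus, sin_minus.
  field.
Qed.

Lemma is_derive_trig C p th : decay 3 C p -> is_derive (trig p) th (trig (dcoef p) th).
Proof.
  intros H.
  assert (H2 : decay 2 C p) by (apply (decay_mono 3 2 C C); auto; lra).
  assert (HC := decay_ge0 _ _ _ H).
  apply (is_derive_Series (fun n th => zfold (mode p th) n) (fun n th => zfold (mode (dcoef p) th) n)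
    (fun n => 2 * C * zbound n) th (mkposreal 1 Rlt_0_1)).
  - apply (ex_series_scal (V := R_NormedModule)), ex_series_zbound.
  - intros n s _. unfold zfold, mode. cbn [dcoef]. auto_derive; auto. ring.
  - intros n s _. apply zfold_bound, decay_zdom, decay_dcoef, H.
  - intros s _. apply (ex_zsum (2 * C)), decay_zdom, H2.
Qed.

Lemma trig_periodic p th : trig p (th + 2 * PI) = trig p th.
Proof.
  apply zsum_ext. intros k. unfold mode.
  assert (E : forall n : nat, forall x, cos (x + INR n * (2 * PI)) = cos x /\ sin (x + INR n * (2 * PI)) = sin x).
  { intros n x. replace (x + INR n * (2 * PI)) with (x + 2 * INR n * PI) by ring.
    split; [apply cos_period|apply sin_period]. }
  rewrite Rmult_plus_distr_l.
  destruct (Z_le_gt_dec 0 k) as [Hk|Hk].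
  - assert (Ek : IZR k = INR (Z.to_nat k)) by (rewrite INR_IZR_INZ, Z2Nat.id; auto).
    rewrite Ek at 2 4. destruct (E (Z.to_nat k) (IZR k * th)) as [-> ->]. reflexivity.
  - assert (Ek : IZR k = - INR (Z.to_nat (- k))).
    { rewrite INR_IZR_INZ, Z2Nat.id by lia. rewrite opp_IZR. ring. }
    destruct (E (Z.to_nat (- k)) (IZR k * th + IZR k * (2 * PI))) as [E1 E2].
    rewrite <- E1, <- E2.
    replace (IZR k * th + IZR k * (2 * PI) + INR (Z.to_nat (- k)) * (2 * PI)) with (IZR k * th);
      [reflexivity|]. rewrite Ek at 3. ring.
Qed.

(** * Series with time-dependent coefficients in a frame moving at speed [c] *)

(** The constant may depend on the time but must serve a whole neighbourhood of it, as dominated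
    convergence requires. *)
Definition loc_decay (D : R -> Prop) (m : nat) (p : R -> coefs) : Prop :=
  forall t, D t -> exists (C : R) (del : posreal), forall s, D s -> Rabs (s - t) < del -> decay m C (p s).

Lemma jcont_trig (D : R -> Prop) (c : R) (p : R -> coefs) :
  loc_decay D 2 p ->
  (forall i t, D t -> filterlim (fun s => p s i) (within D (locally t)) (locally (p t i))) ->
  jcont D (fun t x => trig (p t) (x - c * t)).
Proof.
  intros Hd Hc t x Ht. destruct (Hd t Ht) as [C [del HC]].
  apply (filterlim_Series _ (fun n (q : R * R) => zfold (mode (p (fst q)) (snd q - c * fst q)) n)
    (fun n => zfold (mode (p t) (x - c * t)) n) (fun n => 2 * C * zbound n)).
  - apply (ex_series_scal (V := R_NormedModule)), ex_series_zbound.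
  - exists del. intros [s y] [Hs _] Ds n. apply zfold_bound, decay_zdom, HC; assumption.
  - apply zfold_bound, decay_zdom, HC; [exact Ht|]. rewrite Rminus_diag, Rabs_R0. apply cond_pos.
  - intros n. unfold zfold, mode.
    assert (J : forall i, jcont D (fun t _ => p t i)).
    { intros i. apply jcont_time. intros s Hs. apply Hc, Hs. }
    assert (L : jcont D (fun t x => x - c * t)).
    { apply jcont_minus; [apply (jcont_space D (fun x => x)); intros; apply continuous_id|].
      apply (jcont_time_continuous D (fun t => c * t)). intros s _.
      apply (continuous_scal_r (V := R_NormedModule) c), continuous_id. }
    assert (JC : forall k, jcont D (fun t x => cos (IZR k * (x - c * t)))).
    { intros k. apply (jcont_comp D (fun t x => x - c * t) (fun z => cos (IZR k * z)) L).
      intros s y _. apply continuous_of_derive with (IZR k * - sin (IZR k * (y - c * s))).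
      auto_derive; auto. ring. }
    assert (JS : forall k, jcont D (fun t x => sin (IZR k * (x - c * t)))).
    { intros k. apply (jcont_comp D (fun t x => x - c * t) (fun z => sin (IZR k * z)) L).
      intros s y _. apply continuous_of_derive with (IZR k * cos (IZR k * (y - c * s))).
      auto_derive; auto. ring. }
    assert (G := jcont_plus D _ _
      (jcont_plus D _ _ (jcont_mult D _ _ (J (Z.of_nat n, true)) (JC (Z.of_nat n)))
                  (jcont_mult D _ _ (J (Z.of_nat n, false)) (JS (Z.of_nat n))))
      (jcont_plus D _ _ (jcont_mult D _ _ (J ((- Z.of_nat n - 1)%Z, true)) (JC (- Z.of_nat n - 1)%Z))
                  (jcont_mult D _ _ (J ((- Z.of_nat n - 1)%Z, false)) (JS (- Z.of_nat n - 1)%Z)))).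
    exact (G t x Ht).
Qed.

Lemma is_derive_trig_time (c : R) (p p' : R -> coefs) (C t x : R) (del : posreal) :
  (forall s i, Rabs (s - t) < del -> is_derive (fun s => p s i) s (p' s i)) ->
  (forall s, Rabs (s - t) < del -> decay 3 C (p s)) ->
  (forall s, Rabs (s - t) < del -> decay 2 C (p' s)) ->
  is_derive (fun s => trig (p s) (x - c * s)) t
    (trig (p' t) (x - c * t) - c * trig (dcoef (p t)) (x - c * t)).
Proof.
  intros Hd H3 H2.
  assert (Ht : Rabs (t - t) < del) by (rewrite Rminus_diag, Rabs_R0; apply cond_pos).
  assert (HC := decay_ge0 _ _ _ (H2 t Ht)).
  set (C' := C + Rabs (- c) * C).
  assert (Hdc : forall s, Rabs (s - t) < del -> decay 2 C' (fun i => p' s i + - c * dcoef (p s) i)).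
  { intros s Hs. apply decay_plus; [apply H2, Hs|]. apply decay_scal, decay_dcoef, H3, Hs. }
  assert (E : trig (p' t) (x - c * t) - c * trig (dcoef (p t)) (x - c * t) =
    trig (fun i => p' t i + - c * dcoef (p t) i) (x - c * t)).
  { rewrite (trig_plus C (Rabs (- c) * C) (p' t) (fun i => - c * dcoef (p t) i));
      [rewrite trig_scal; ring|apply H2, Ht|apply decay_scal, decay_dcoef, H3, Ht]. }
  rewrite E.
  apply (is_derive_Series (fun n s => zfold (mode (p s) (x - c * s)) n)
    (fun n s => zfold (mode (fun i => p' s i + - c * dcoef (p s) i) (x - c * s)) n)
    (fun n => 2 * C' * zbound n) t del).
  - apply (ex_series_scal (V := R_NormedModule)), ex_series_zbound.
  - intros n s Hs. unfold zfold.
    assert (M : forall k, is_derive (fun s => mode (p s) (x - c * s) k) s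
       (mode (fun i => p' s i + - c * dcoef (p s) i) (x - c * s) k)).
    { intros k. unfold mode. cbn [dcoef].
      evar_last.
      - apply (is_derive_plus (K := R_AbsRing) (V := R_NormedModule)).
        + apply (is_derive_mult (fun s => p s (k, true)) (fun s => cos (IZR k * (x - c * s)))).
          * apply Hd, Hs.
          * apply (is_derive_comp cos (fun s => IZR k * (x - c * s)) s (- sin (IZR k * (x - c * s))) (- c * IZR k)).
            -- apply is_derive_Reals, derivable_pt_lim_cos.
            -- auto_derive; auto. ring.
          * intros; apply Rmult_comm.
        + apply (is_derive_mult (fun s => p s (k, false)) (fun s => sin (IZR k * (x - c * s)))).
          * apply Hd, Hs.
          * apply (is_derive_comp sin (fun s => IZR k * (x - c * s)) s (cos (IZR k * (x - c * s))) (- c * IZR k)).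
            -- apply is_derive_Reals, derivable_pt_lim_sin.
            -- auto_derive; auto. ring.
          * intros; apply Rmult_comm.
      - change plus with Rplus. change scal with Rmult. change mult with Rmult. eqR. ring. }
    apply (is_derive_plus (K := R_AbsRing) (V := R_NormedModule)); apply M.
  - intros n s Hs. apply zfold_bound, decay_zdom, Hdc, Hs.
  - intros s Hs. apply (ex_zsum (2 * C)), decay_zdom.
    apply (decay_mono 3 2 C C); [lia|lra|]. apply H3, Hs.
Qed.

(** * The heat equation with a trigonometric potential, on the level of coefficients *)

Lemma exp_le_compat (x y : R) : x <= y -> exp x <= exp y.
Proof. intros [H| ->]; [left; apply exp_increasing, H|right; reflexivity]. Qed.

Lemma exp_decay_wt (m : nat) (eta : R) : 0 < eta ->
  exists C, 0 <= C /\ forall k, exp (- eta * Rabs (IZR k)) <= C * wt m k.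
Proof.
  intros He. destruct m as [|m].
  - exists 1. split; [lra|]. intros k. rewrite wt_0, Rmult_1_r, <- exp_0.
    apply exp_le_compat. pose proof (Rabs_pos (IZR k)). nra.
  (* The exponential is split into [S m] equal factors, each absorbing one factor 1 + r: since 1 + z
     <= exp z, the product (1 + r) exp (- eta r / M) is at most 1 + M / eta. *)
  - set (M := INR (S m)). assert (HM : 0 < M) by (apply lt_0_INR; lia).
    exists ((1 + M / eta) ^ S m). assert (0 < M / eta) by (apply Rdiv_lt_0_compat; lra).
    split; [apply pow_le; lra|]. intros k. unfold wt.
    set (r := Rabs (IZR k)). assert (Hr : 0 <= r) by apply Rabs_pos.
    apply (Rmult_le_reg_r ((1 + r) ^ S m)); [apply pow_lt; lra|].
    rewrite Rmult_assoc, Rinv_l, Rmult_1_r by (apply pow_nonzero; lra).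
    replace (exp (- eta * r)) with (exp (- (eta * r / M)) ^ S m).
    2:{ rewrite <- Rpower_pow by apply exp_pos. unfold Rpower. rewrite ln_exp. f_equal.
        fold M. field. lra. }
    rewrite <- Rpow_mult_distr. apply pow_incr.
    assert (Hz : 0 <= eta * r / M) by (apply Rmult_le_pos; [nra|left; apply Rinv_0_lt_compat; lra]).
    split; [apply Rmult_le_pos; [left; apply exp_pos|lra]|].
    assert (E1 := exp_ineq1_le (eta * r / M)).
    rewrite exp_Ropp. apply (Rmult_le_reg_l (exp (eta * r / M))); [apply exp_pos|].
    rewrite <- Rmult_assoc, Rinv_r, Rmult_1_l by (apply Rgt_not_eq, exp_pos).
    apply Rle_trans with ((1 + eta * r / M) * (1 + M / eta)).
    + replace ((1 + eta * r / M) * (1 + M / eta)) with (1 + r + eta * r / M + M / eta) by (field; lra).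
      lra.
    + apply Rmult_le_compat_r; lra.
Qed.

Lemma pow_shift_le m j : (-3 <= j <= 3)%Z -> (1 + Rabs (IZR j)) ^ m <= 4 ^ m.
Proof.
  intros Hj. apply pow_incr. pose proof (Rabs_pos (IZR j)).
  assert (Rabs (IZR j) <= 3) by (rewrite <- abs_IZR; apply IZR_le; lia). lra.
Qed.

Section LinearHeat.

(* [a j t] and [b j t] are the coefficients of [cos (j y)] and [sin (j y)] in the
   potential, [y = x - c t] being the coordinate of the moving frame. *)
Variables (a b : nat -> R -> R) (Q : R).
Hypothesis a_cont : forall j t, continuous (a j) t.
Hypothesis b_cont : forall j t, continuous (b j) t.
Hypothesis a_bound : forall j t, Rabs (a j t) <= Q.
Hypothesis b_bound : forall j t, Rabs (b j t) <= Q.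

Definition pert (t : R) (p : coefs) : coefs := fun i =>
  mulcoef 1 (a 1 t) (b 1 t) p i + mulcoef 2 (a 2 t) (b 2 t) p i + mulcoef 3 (a 3 t) (b 3 t) p i.

(** Decay rate of frequency k under the viscosity 2; the transport term is absorbed by the moving
    frame. *)
Definition heat_rate (i : Z * bool) : R := 2 * (IZR (fst i)) ^ 2.

Definition pot (t y : R) : R :=
  (a 1 t * cos (1 * y) + b 1 t * sin (1 * y)) + (a 2 t * cos (2 * y) + b 2 t * sin (2 * y))
  + (a 3 t * cos (3 * y) + b 3 t * sin (3 * y)).

Definition dpot (t y : R) : R :=
  (b 1 t * cos (1 * y) - a 1 t * sin (1 * y)) + 2 * (b 2 t * cos (2 * y) - a 2 t * sin (2 * y))
  + 3 * (b 3 t * cos (3 * y) - a 3 t * sin (3 * y)).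

Lemma Q_ge0 : 0 <= Q.
Proof. eapply Rle_trans; [apply Rabs_pos|apply (a_bound 0 0)]. Qed.

Lemma heat_rate_ge0 i : 0 <= heat_rate i.
Proof. unfold heat_rate. pose proof (pow2_ge_0 (IZR (fst i))). lra. Qed.

Lemma mulcoef_cont j (x : Z * bool -> R -> R) al be i t :
  continuous al t -> continuous be t -> (forall j, continuous (x j) t) ->
  continuous (fun s => mulcoef j (al s) (be s) (fun l => x l s) i) t.
Proof.
  intros Ha Hb Hx.
  assert (G : forall i1 i2 i3 i4, continuous (fun s => al s / 2 * (x i1 s + x i2 s) + be s / 2 * (x i3 s - x i4 s)) t).
  { intros. apply (continuous_plus (V := R_NormedModule)); apply (continuous_mult (K := R_AbsRing)).
    - apply (continuous_mult (K := R_AbsRing)); [exact Ha|apply continuous_const].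
    - apply (continuous_plus (V := R_NormedModule)); apply Hx.
    - apply (continuous_mult (K := R_AbsRing)); [exact Hb|apply continuous_const].
    - apply (continuous_minus (V := R_NormedModule)); apply Hx. }
  destruct i as [k [|]]; cbn [mulcoef]; apply G.
Qed.

Lemma pert_cont (x : Z * bool -> R -> R) i t :
  (forall j, continuous (x j) t) -> continuous (fun s => pert s (fun j => x j s) i) t.
Proof.
  intros Hx. unfold pert.
  apply continuous_plus_R; [apply continuous_plus_R|]; apply mulcoef_cont; auto.
Qed.

Lemma pert_minus s x y i : pert s (fun j => x j - y j) i = pert s x i - pert s y i.
Proof. unfold pert. destruct i as [k [|]]; cbn [mulcoef]; field. Qed.

Lemma is_series_mulcoef j al be (x : nat -> coefs) i :
  (forall l, ex_series (fun n => x n l)) ->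
  is_series (fun n => mulcoef j al be (x n) i) (mulcoef j al be (fun l => Series (fun n => x n l)) i).
Proof.
  intros Hx.
  assert (S : forall l, is_series (fun n => x n l) (Series (fun n => x n l))).
  { intros l. apply Series_correct, Hx. }
  assert (G : forall i1 i2 i3 i4, is_series
     (fun n => al / 2 * (x n i1 + x n i2) + be / 2 * (x n i3 - x n i4))
     (al / 2 * (Series (fun n => x n i1) + Series (fun n => x n i2))
     + be / 2 * (Series (fun n => x n i3) - Series (fun n => x n i4)))).
  { intros. apply (is_series_plus (V := R_NormedModule)).
    - apply (is_series_scal (V := R_NormedModule) (al / 2)), (is_series_plus (V := R_NormedModule)); apply S.
    - apply (is_series_scal (V := R_NormedModule) (be / 2)), (is_series_minus (V := R_NormedModule)); apply S. }
  destruct i as [k [|]]; cbn [mulcoef]; apply G.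
Qed.

Lemma pert_series s (x : nat -> coefs) i :
  (forall j, ex_series (fun n => x n j)) ->
  is_series (fun n => pert s (x n) i) (pert s (fun j => Series (fun n => x n j)) i).
Proof.
  intros Hx. unfold pert.
  apply (is_series_plus (V := R_NormedModule)); [apply (is_series_plus (V := R_NormedModule))|];
    apply is_series_mulcoef, Hx.
Qed.

Lemma pert_bound (w : Z -> R) (L N : R) (t : R) (p : coefs) :
  0 <= N -> (forall k b, Rabs (p (k, b)) <= N * w k) ->
  (forall k j, (-3 <= j <= 3)%Z -> w (k + j)%Z <= L * w k) ->
  forall k b, Rabs (pert t p (k, b)) <= 6 * Q * L * N * w k.
Proof.
  intros HN Hp Hw k b'. unfold pert.
  assert (G : forall j, (1 <= j <= 3)%Z -> forall al be, Rabs al <= Q -> Rabs be <= Q ->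
     Rabs (mulcoef j al be p (k, b')) <= 2 * Q * L * N * w k).
  { intros j Hj al be Hal Hbe. apply mulcoef_bound; auto.
    - intros k'. apply Hw. lia.
    - intros k'. apply (Hw k' (- j)%Z). lia. }
  assert (G1 := G 1%Z ltac:(lia) _ _ (a_bound 1 t) (b_bound 1 t)).
  assert (G2 := G 2%Z ltac:(lia) _ _ (a_bound 2 t) (b_bound 2 t)).
  assert (G3 := G 3%Z ltac:(lia) _ _ (a_bound 3 t) (b_bound 3 t)).
  eapply Rle_trans; [apply Rabs_triang|].
  eapply Rle_trans; [apply Rplus_le_compat_r, Rabs_triang|]. lra.
Qed.

(** The gain is linear in |k|, although the heat flow offers k^2: a shift of the frequency by at
    most 3 then costs a bounded factor, so the potential stays bounded in this weight. The diagonal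
    flow respects it because |k| <= k^2 for integers. *)
Definition gevrey (t0 : R) (m : nat) (i : Z * bool) (t : R) : R :=
  exp (- 2 * Rabs (IZR (fst i)) * (t - t0)) * wt m (fst i).

Lemma gevrey_weight t0 m T : exists K, exp_weight (Z * bool) heat_rate pert t0 T K (gevrey t0 m).
Proof.
  pose proof Q_ge0 as HQ.
  (* A shift by at most 3 costs exp (6 (T - t0)) in the exponential part and (1 + 3)^m in the
     polynomial part. *)
  set (L := exp (6 * Rabs (T - t0)) * 4 ^ m).
  assert (HL : 0 <= L) by (apply Rmult_le_pos; [left; apply exp_pos|apply pow_le; lra]).
  exists (6 * Q * L). repeat split.
  - apply Rmult_le_pos; lra.
  - intros [k b'] t _. apply Rmult_le_pos; [left; apply exp_pos|left; apply wt_pos].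
  - intros [k b'] s t Hs Ht. unfold gevrey, heat_rate. cbn [fst].
    rewrite <- Rmult_assoc, <- exp_plus.
    apply Rmult_le_compat_r; [left; apply wt_pos|].
    apply exp_le_compat.
    assert (Hk : Rabs (IZR k) <= (IZR k) ^ 2).
    { destruct (Z.eq_dec k 0) as [->|Hk]; [rewrite Rabs_R0; simpl; lra|].
      rewrite <- pow2_abs.
      assert (1 <= Rabs (IZR k)) by (rewrite <- abs_IZR; apply IZR_le; lia). nra. }
    nra.
  - intros s p N Hs HN Hp [k b'].
    set (w := fun k => gevrey t0 m (k, true) s).
    assert (W := pert_bound w L N s p HN (fun k b => Hp (k, b))).
    unfold gevrey. cbn [fst]. apply W. clear - Hs HQ.
    intros k j Hj. unfold w, gevrey, L. cbn [fst].
    assert (E : exp (- 2 * Rabs (IZR (k + j)) * (s - t0)) <=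
      exp (6 * Rabs (T - t0)) * exp (- 2 * Rabs (IZR k) * (s - t0))).
    { rewrite <- exp_plus. apply exp_le_compat.
      assert (Rabs (IZR k) <= Rabs (IZR (k + j)) + 3).
      { replace (IZR k) with (IZR (k + j) + - IZR j) by (rewrite plus_IZR; ring).
        eapply Rle_trans; [apply Rabs_triang|]. apply Rplus_le_compat_l.
        rewrite Rabs_Ropp, <- abs_IZR. apply IZR_le. lia. }
      rewrite (Rabs_pos_eq (T - t0)) by lra. nra. }
    assert (W := wt_shift m k j).
    assert (W' : (1 + Rabs (IZR j)) ^ m <= 4 ^ m).
    { apply pow_shift_le, Hj. }
    pose proof (wt_pos m k). pose proof (wt_pos m (k + j)).
    replace (exp (6 * Rabs (T - t0)) * 4 ^ m * (exp (- 2 * Rabs (IZR k) * (s - t0)) * wt m k))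
      with (exp (6 * Rabs (T - t0)) * exp (- 2 * Rabs (IZR k) * (s - t0)) * (4 ^ m * wt m k)) by ring.
    apply Rmult_le_compat; [left; apply exp_pos|lra|exact E|].
    eapply Rle_trans; [exact W|]. apply Rmult_le_compat_r; lra.
Qed.

Lemma pert_unit_weight t0 T :
  exists K, exp_weight (Z * bool) heat_rate pert t0 T K (fun _ _ => 1).
Proof.
  pose proof Q_ge0. exists (6 * Q * 1). repeat split.
  - lra.
  - intros; lra.
  - intros i s t Hs Ht. rewrite Rmult_1_r, <- exp_0. apply exp_le_compat.
    pose proof (heat_rate_ge0 i). nra.
  - intros s p N Hs HN Hp [k b'].
    apply (pert_bound (fun _ => 1) 1 N s p HN (fun k b => Hp (k, b))). intros; lra.
Qed.

Definition heat_flow (t0 : R) (g : coefs) : R -> coefs := flow (Z * bool) heat_rate pert t0 g.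

Lemma heat_flow_gevrey t0 m T : exists C, 0 <= C /\ forall N g, decay m N g ->
  forall t, t0 <= t <= T -> forall k b,
  Rabs (heat_flow t0 g t (k, b)) <= C * N * (exp (- 2 * Rabs (IZR k) * (t - t0)) * wt m k).
Proof.
  destruct (gevrey_weight t0 m T) as [K HK].
  assert (HK0 := proj1 HK).
  exists (exp (K * Rabs (T - t0))). split; [left; apply exp_pos|].
  intros N g Hg t Ht k b'. assert (HN := decay_ge0 _ _ _ Hg).
  eapply Rle_trans.
  - apply (flow_bound _ _ _ _ pert_cont T K _ g N HK HN); [|exact Ht].
    intros [k' b'']. unfold gevrey. cbn [fst]. rewrite Rminus_diag, Rmult_0_r, exp_0, Rmult_1_l. apply Hg.
  - unfold gevrey. cbn [fst]. apply Rmult_le_compat_r.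
    + apply Rmult_le_pos; [left; apply exp_pos|left; apply wt_pos].
    + apply Rmult_le_compat_r; [exact HN|]. apply exp_le_compat.
      rewrite Rabs_pos_eq by lra. nra.
Qed.

(** Decay of order 5 leaves order 2, hence summability, for the third space derivative of phi, which
    enters u_xx. The equation is asked only after [t1], where two-sided time derivatives make
    sense. *)
Record heat_solution (t1 : R) (p : R -> coefs) : Prop := {
  hs_decay : loc_decay (fun t => t1 <= t) 5 p;
  hs_cont : forall i t, t1 <= t ->
    filterlim (fun s => p s i) (within (fun s => t1 <= s) (locally t)) (locally (p t i));
  hs_derive : forall i t, t1 < t ->
    is_derive (fun s => p s i) t (- heat_rate i * p t i + pert t (p t) i)
}.

Lemma decay_le_const m N g : decay m N g -> forall i, Rabs (g i) <= N.
Proof.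
  intros H [k b']. eapply Rle_trans; [apply H|].
  pose proof (decay_ge0 _ _ _ H). pose proof (wt_le_1 m k). nra.
Qed.

Lemma heat_flow_solution t0 N g : decay 5 N g -> heat_solution t0 (heat_flow t0 g).
Proof.
  intros Hg. assert (Hg' := decay_le_const _ _ _ Hg). assert (HN := decay_ge0 _ _ _ Hg). split.
  - intros t Ht. destruct (heat_flow_gevrey t0 5 (t + 1)) as [C [HC HB]].
    exists (C * N), (mkposreal 1 Rlt_0_1). intros s Hs Hst. simpl in Hst. apply Rabs_def2 in Hst.
    intros k b'. eapply Rle_trans; [apply (HB N g Hg s ltac:(lra))|].
    apply Rmult_le_compat_l; [apply Rmult_le_pos; assumption|].
    rewrite <- (Rmult_1_l (wt 5 k)) at 2. apply Rmult_le_compat_r; [left; apply wt_pos|].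
    rewrite <- exp_0. apply exp_le_compat. pose proof (Rabs_pos (IZR k)). nra.
  - intros i t Ht. apply (flow_continuous _ _ _ _ pert_cont) with N; auto.
    apply pert_unit_weight.
  - intros i t Ht. apply (is_derive_flow _ _ _ _ heat_rate_ge0 pert_cont pert_series) with N; auto.
    apply pert_unit_weight.
Qed.

(** After a delay [eta] the factor exp (- 2 eta |k|) beats every power of k. The constant is uniform
    over the data, which allows differences of data to be treated with it. *)
Lemma heat_flow_decay t0 eta T m : 0 < eta -> exists C, 0 <= C /\
  forall N g, (forall i, Rabs (g i) <= N) ->
  forall t, t0 + eta <= t <= T -> decay m (C * N) (heat_flow t0 g t).
Proof.
  intros He. destruct (heat_flow_gevrey t0 0 T) as [C [HC HB]].
  destruct (exp_decay_wt m (2 * eta)) as [C' [HC' HB']]; [lra|].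
  exists (C * C'). split; [apply Rmult_le_pos; assumption|].
  intros N g Hg t Ht k b'.
  assert (HN : 0 <= N) by (eapply Rle_trans; [apply Rabs_pos|apply (Hg (0%Z, true))]).
  assert (Hg0 : decay 0 N g).
  { intros k' b''. rewrite wt_0, Rmult_1_r. apply Hg. }
  eapply Rle_trans; [apply (HB N g Hg0 t ltac:(lra))|].
  replace (C * C' * N * wt m k) with (C * N * (C' * wt m k)) by ring.
  apply Rmult_le_compat_l; [apply Rmult_le_pos; assumption|].
  eapply Rle_trans; [|apply HB'].
  rewrite wt_0, Rmult_1_r. apply exp_le_compat.
  pose proof (Rabs_pos (IZR k)). nra.
Qed.

(** For data known only to be bounded, such as the limit coefficients [glim]: regularity is
    available from any positive delay on. *)
Lemma heat_flow_solution_later t0 eta N g : 0 < eta ->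
  (forall i, Rabs (g i) <= N) -> heat_solution (t0 + eta) (heat_flow t0 g).
Proof.
  intros He Hg. split.
  - intros t Ht. destruct (heat_flow_decay t0 eta (t + 1) 5 He) as [C [HC HB]].
    exists (C * N), (mkposreal 1 Rlt_0_1). intros s Hs Hst. simpl in Hst. apply Rabs_def2 in Hst.
    apply HB; auto. lra.
  - intros i t Ht.
    eapply filterlim_filter_le_1; [|apply (flow_continuous _ _ _ t0 pert_cont)
      with (N := N); auto; [apply pert_unit_weight|lra]].
    intros P. unfold within. apply filter_imp. intros s Hs Hs'. apply Hs. lra.
  - intros i t Ht. apply (is_derive_flow _ _ _ _ heat_rate_ge0 pert_cont pert_series) with N; auto.
    + apply pert_unit_weight.
    + lra.
Qed.

Lemma heat_flow_minus t0 g h N t : (forall i, Rabs (g i) <= N) -> (forall i, Rabs (h i) <= N) ->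
  t0 <= t -> forall i, heat_flow t0 (fun j => g j - h j) t i = heat_flow t0 g t i - heat_flow t0 h t i.
Proof.
  intros Hg Hh Ht i. unfold heat_flow.
  apply (flow_minus _ _ _ _ pert_cont pert_minus) with N; auto.
  apply pert_unit_weight.
Qed.

(** * The solution of the heat equation with potential *)

Section Potential.

Variables (c t1 : R) (p : R -> coefs).
Hypothesis Hp : heat_solution t1 p.

Definition dcoefs (n : nat) (t : R) : coefs := Nat.iter n dcoef (p t).
(** The [n]-th space derivative of the Cole-Hopf transform, in the fixed coordinate [x]. *)
Definition phi (n : nat) (t x : R) : R := trig (dcoefs n t) (x - c * t).

Lemma loc_decay_dcoefs n : (n <= 5)%nat -> loc_decay (fun t => t1 <= t) (5 - n) (dcoefs n).
Proof.
  intros Hn t Ht. destruct (hs_decay _ _ Hp t Ht) as [C [del H]].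
  exists C, del. intros s Hs Hst. specialize (H s Hs Hst). unfold dcoefs.
  induction n as [|n IH]; [exact H|]. cbn [Nat.iter].
  apply decay_dcoef. replace (S (5 - S n)) with (5 - n)%nat by lia. apply IH. lia.
Qed.

Lemma decay_dcoefs n t : (n <= 5)%nat -> t1 <= t -> exists C, decay (5 - n) C (dcoefs n t).
Proof.
  intros Hn Ht. destruct (loc_decay_dcoefs n Hn t Ht) as [C [del H]].
  exists C. apply H; [exact Ht|]. rewrite Rminus_diag, Rabs_R0. apply cond_pos.
Qed.

Lemma cont_dcoefs n : forall i t, t1 <= t ->
  filterlim (fun s => dcoefs n s i) (within (fun s => t1 <= s) (locally t)) (locally (dcoefs n t i)).
Proof.
  induction n as [|n IH]; intros i t Ht; [apply (hs_cont _ _ Hp i t Ht)|].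
  assert (G : forall a i, filterlim (fun s => a * dcoefs n s i) (within (fun s => t1 <= s) (locally t)) (locally (a * dcoefs n t i))).
  { intros a0 i0. eapply filterlim_comp; [apply IH, Ht|].
    apply (filterlim_scal_r (V := R_NormedModule) a0). }
  unfold dcoefs. cbn [Nat.iter]. destruct i as [k [|]]; cbn [dcoef]; apply G.
Qed.

Lemma phi_jcont n : (n <= 3)%nat -> jcont (fun t => t1 <= t) (phi n).
Proof.
  intros Hn. apply jcont_trig; [|apply cont_dcoefs].
  intros t Ht. destruct (loc_decay_dcoefs n ltac:(lia) t Ht) as [C [del H]].
  exists C, del. intros s Hs Hst. apply (decay_mono (5 - n) 2 C C); [lia|lra|]. apply H; assumption.
Qed.

Lemma phi_derive_x n t x : (n <= 2)%nat -> t1 <= t -> is_derive (phi n t) x (phi (S n) t x).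
Proof.
  intros Hn Ht. destruct (decay_dcoefs n t ltac:(lia) Ht) as [C H].
  assert (H3 : decay 3 C (dcoefs n t)) by (apply (decay_mono (5 - n) 3 C C); [lia|lra|exact H]).
  evar_last.
  - apply (is_derive_comp (trig (dcoefs n t)) (fun x => x - c * t)).
    + apply (is_derive_trig C), H3.
    + instantiate (1 := 1). auto_derive; auto.
  - change scal with Rmult. rewrite Rmult_1_l. reflexivity.
Qed.

Lemma phi_periodic n t x : phi n t (x + 2 * PI) = phi n t x.
Proof.
  unfold phi. replace (x + 2 * PI - c * t) with (x - c * t + 2 * PI) by ring. apply trig_periodic.
Qed.

Lemma trig_pert C t (q : coefs) y : decay 2 C q -> trig (pert t q) y = pot t y * trig q y.
Proof.
  intros H. unfold pert.
  rewrite (trig_plus _ _ _ _ y (decay_plus 2 _ _ _ _ (decay_mulcoef 2 C 1 (a 1 t) (b 1 t) q H)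
       (decay_mulcoef 2 C 2 (a 2 t) (b 2 t) q H)) (decay_mulcoef 2 C 3 (a 3 t) (b 3 t) q H)).
  rewrite (trig_plus _ _ _ _ y (decay_mulcoef 2 C 1 (a 1 t) (b 1 t) q H)
       (decay_mulcoef 2 C 2 (a 2 t) (b 2 t) q H)).
  rewrite !(trig_mulcoef C) by exact H. unfold pot. ring.
Qed.

Lemma decay_pert m C t (q : coefs) : decay m C q -> decay m (6 * Q * 4 ^ m * C) (pert t q).
Proof.
  intros H k b'. apply pert_bound; [apply (decay_ge0 _ _ _ H)|exact H|].
  intros k' j Hj. eapply Rle_trans; [apply wt_shift|].
  apply Rmult_le_compat_r; [left; apply wt_pos|]. apply pow_shift_le, Hj.
Qed.

(** The vector field of [hs_derive]: applying [dcoef] twice multiplies by - k^2. In this form decay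
    bounds and the summed series can be read off. *)
Definition rhs (t : R) : coefs := fun i => 2 * dcoefs 2 t i + pert t (p t) i.

Lemma rhs_derive i t : t1 < t -> is_derive (fun s => p s i) t (rhs t i).
Proof.
  intros Ht. evar_last; [apply (hs_derive _ _ Hp i t Ht)|].
  unfold rhs, heat_rate. change (dcoefs 2 t) with (dcoef (dcoef (p t))).
  destruct i as [k [|]]; cbn [dcoef fst]; eqR; ring.
Qed.

Lemma rhs_loc_decay t : t1 < t -> exists (C : R) (del : posreal), forall s, Rabs (s - t) < del ->
  t1 < s /\ decay 5 C (p s) /\ decay 3 C (rhs s).
Proof.
  intros Ht. destruct (hs_decay _ _ Hp t ltac:(lra)) as [C [del H]].
  assert (Hm : 0 < Rmin del (t - t1)) by (apply Rmin_glb_lt; [apply cond_pos|lra]).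
  pose proof Q_ge0.
  exists (C + (2 * C + 6 * Q * 4 ^ 3 * C)), (mkposreal _ Hm). simpl. intros s Hs.
  assert (Hs1 := Rlt_le_trans _ _ _ Hs (Rmin_l _ _)).
  assert (Hs2 := Rlt_le_trans _ _ _ Hs (Rmin_r _ _)). apply Rabs_def2 in Hs2.
  specialize (H s ltac:(lra) Hs1). assert (HC := decay_ge0 _ _ _ H).
  assert (0 <= 6 * Q * 4 ^ 3 * C).
  { apply Rmult_le_pos; [|exact HC]. apply Rmult_le_pos; [lra|apply pow_le; lra]. }
  split; [lra|]. split.
  - apply (decay_mono 5 5 C); [lia| |exact H]. simpl in *; lra.
  - apply (decay_mono 3 3 (Rabs 2 * C + 6 * Q * 4 ^ 3 * C)); [lia| |].
    + rewrite (Rabs_pos_eq 2) by lra. lra.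
    + apply decay_plus.
      * apply decay_scal. unfold dcoefs. cbn [Nat.iter]. apply decay_dcoef, decay_dcoef, H.
      * apply decay_pert, (decay_mono 5 3 C C); [lia|lra|exact H].
Qed.

Lemma trig_rhs t y : t1 <= t -> trig (rhs t) y = 2 * trig (dcoefs 2 t) y + pot t y * trig (p t) y.
Proof.
  intros Ht. destruct (decay_dcoefs 0 t ltac:(lia) Ht) as [C H].
  destruct (decay_dcoefs 2 t ltac:(lia) Ht) as [C2 H2].
  assert (H' : decay 2 C (p t)) by (apply (decay_mono 5 2 C C); [lia|lra|exact H]).
  unfold rhs. rewrite (trig_plus (Rabs 2 * C2) (6 * Q * 4 ^ 2 * C)).
  - rewrite trig_scal, (trig_pert C); auto.
  - apply decay_scal, (decay_mono 3 2 C2 C2); [lia|lra|exact H2].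
  - apply decay_pert, H'.
Qed.

Lemma phi_derive_t t x : t1 < t ->
  is_derive (fun s => phi 0 s x) t
    (2 * phi 2 t x - c * phi 1 t x + pot t (x - c * t) * phi 0 t x).
Proof.
  intros Ht. destruct (rhs_loc_decay t Ht) as [C [del H]].
  evar_last.
  - apply (is_derive_trig_time c p rhs C t x del).
    + intros s i Hs. apply rhs_derive, H, Hs.
    + intros s Hs. apply (decay_mono 5 3 C C); [lia|lra|]. apply H, Hs.
    + intros s Hs. apply (decay_mono 3 2 C C); [lia|lra|]. apply H, Hs.
  - rewrite trig_rhs by lra. unfold phi.
    change (dcoef (p t)) with (dcoefs 1 t). change (p t) with (dcoefs 0 t). eqR. ring.
Qed.

Lemma is_derive_pot t y : is_derive (pot t) y (dpot t y).
Proof. unfold pot, dpot. auto_derive; auto. ring. Qed.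

(** Both sides are the derivative in [y] of the identity [trig_rhs]; this avoids a Leibniz rule on
    coefficients. *)
Lemma trig_dcoef_rhs t y : t1 < t -> trig (dcoef (rhs t)) y =
  2 * trig (dcoefs 3 t) y + dpot t y * trig (p t) y + pot t y * trig (dcoefs 1 t) y.
Proof.
  intros Ht. destruct (rhs_loc_decay t Ht) as [C [del H]].
  specialize (H t). rewrite Rminus_diag, Rabs_R0 in H. destruct (H (cond_pos del)) as [_ [H5 H3]].
  assert (D1 := is_derive_trig C (rhs t) y H3).
  assert (D2 : is_derive (trig (rhs t)) y (2 * trig (dcoefs 3 t) y + (dpot t y * trig (p t) y + pot t y * trig (dcoefs 1 t) y))).
  { apply (is_derive_ext (fun y => 2 * trig (dcoefs 2 t) y + pot t y * trig (p t) y)).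
    { intros z. symmetry. apply trig_rhs. lra. }
    apply (is_derive_plus (K := R_AbsRing) (V := R_NormedModule)).
    - apply (is_derive_scal (trig (dcoefs 2 t)) y 2).
      apply (is_derive_trig C). unfold dcoefs. cbn [Nat.iter]. apply decay_dcoef, decay_dcoef, H5.
    - apply (is_derive_mult (pot t) (trig (p t)) y).
      + apply is_derive_pot.
      + apply (is_derive_trig C), (decay_mono 5 3 C C); [lia|lra|exact H5].
      + intros; apply Rmult_comm. }
  rewrite <- (is_derive_unique _ _ _ D1), (is_derive_unique _ _ _ D2). ring.
Qed.

Lemma phi1_derive_t t x : t1 < t ->
  is_derive (fun s => phi 1 s x) t
    (2 * phi 3 t x - c * phi 2 t x + dpot t (x - c * t) * phi 0 t x + pot t (x - c * t) * phi 1 t x).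
Proof.
  intros Ht. destruct (rhs_loc_decay t Ht) as [C [del H]].
  evar_last.
  - apply (is_derive_trig_time c (dcoefs 1) (fun s => dcoef (rhs s)) C t x del).
    + intros s [k b'] Hs. assert (Hs' : t1 < s) by apply H, Hs.
      unfold dcoefs. cbn [Nat.iter]. destruct b'; cbn [dcoef].
      * apply (is_derive_scal (fun s => p s (k, false)) s (IZR k)), rhs_derive, Hs'.
      * apply (is_derive_scal (fun s => p s (k, true)) s (- IZR k)), rhs_derive, Hs'.
    + intros s Hs. unfold dcoefs. cbn [Nat.iter]. apply decay_dcoef, (decay_mono 5 4 C C); [lia|lra|].
      apply H, Hs.
    + intros s Hs. apply decay_dcoef, H, Hs.
  - rewrite trig_dcoef_rhs by exact Ht. unfold phi.
    change (dcoef (dcoefs 1 t)) with (dcoefs 2 t). change (p t) with (dcoefs 0 t). eqR. ring.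
Qed.

End Potential.
End LinearHeat.

(** * A minimum principle on the circle *)

Lemma two_PI_pos : 0 < 2 * PI.
Proof. pose proof PI_RGT_0. lra. Qed.

Lemma periodic_shift_Z (g : R -> R) : space_periodic g ->
  forall (k : Z) x, g (x + IZR k * (2 * PI)) = g x.
Proof.
  intros Hg.
  assert (N : forall (n : nat) x, g (x + INR n * (2 * PI)) = g x).
  { induction n; intros x; [simpl; f_equal; ring|].
    rewrite S_INR. replace (x + (INR n + 1) * (2 * PI)) with (x + INR n * (2 * PI) + 2 * PI) by ring.
    rewrite Hg. apply IHn. }
  intros k x. destruct (Z_le_gt_dec 0 k) as [Hk|Hk].
  - rewrite <- (Z2Nat.id k) by exact Hk. rewrite <- INR_IZR_INZ. apply N.
  - rewrite <- (N (Z.to_nat (- k)) (x + _)). f_equal.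
    rewrite INR_IZR_INZ, Z2Nat.id, opp_IZR by lia. ring.
Qed.

Lemma reduce_mod_period (x : R) : exists y, 0 <= y <= 2 * PI /\
  forall g, space_periodic g -> g x = g y.
Proof.
  pose proof two_PI_pos as HP.
  destruct (base_Int_part (x / (2 * PI))) as [H1 H2].
  set (k := Int_part (x / (2 * PI))) in *.
  assert (E : x = x / (2 * PI) * (2 * PI)) by (field; lra).
  exists (x - IZR k * (2 * PI)). split.
  - set (q := x / (2 * PI)) in *. split; nra.
  - intros g Hg. rewrite <- (periodic_shift_Z g Hg k (x - _)). f_equal. ring.
Qed.

Lemma derive_le0_of_left_min (g : R -> R) (a t l : R) : a < t -> is_derive g t l ->
  (forall s, a <= s <= t -> g t <= g s) -> l <= 0.
Proof.
  intros Hat Hd Hmin. apply Rnot_lt_le. intros Hl.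
  apply is_derive_Reals in Hd. destruct (Hd l Hl) as [del Hdel].
  set (h := - Rmin (del / 2) (t - a)).
  pose proof (cond_pos del).
  assert (H1 : 0 < Rmin (del / 2) (t - a)) by (apply Rmin_glb_lt; lra).
  pose proof (Rmin_l (del / 2) (t - a)). pose proof (Rmin_r (del / 2) (t - a)).
  assert (Hh : h < 0) by (unfold h; lra).
  specialize (Hdel h ltac:(lra)). rewrite Rabs_left in Hdel by exact Hh.
  specialize (Hdel ltac:(unfold h; lra)). apply Rabs_def2 in Hdel. destruct Hdel as [_ Hdel].
  assert (Hm := Hmin (t + h) ltac:(unfold h; lra)).
  assert ((g (t + h) - g t) / h <= 0).
  { apply Rmult_le_reg_r with (- h); [lra|].
    replace ((g (t + h) - g t) / h * - h) with (g t - g (t + h)) by (field; lra). lra. }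
  lra.
Qed.

Lemma second_derivative_test (g g1 : R -> R) (x l : R) :
  (forall y, is_derive g y (g1 y)) -> is_derive g1 x l -> (forall y, g x <= g y) ->
  g1 x = 0 /\ 0 <= l.
Proof.
  intros Hg Hl Hmin.
  assert (E : g1 x = 0).
  { assert (Hd : derivable_pt g x) by (exists (g1 x); apply is_derive_Reals, Hg).
    rewrite <- (derive_pt_eq_0 g x (g1 x) Hd); [|apply is_derive_Reals, Hg].
    apply (deriv_minimum g (x - 1) (x + 1) x Hd); auto; lra. }
  split; [exact E|]. apply Rnot_lt_le. intros Hn.
  apply is_derive_Reals in Hl. destruct (Hl (- l) ltac:(lra)) as [del Hdel].
  pose proof (cond_pos del).
  assert (Hneg : forall y, x < y < x + del -> g1 y < 0).
  { intros y Hy. specialize (Hdel (y - x) ltac:(lra)). rewrite Rabs_pos_eq in Hdel by lra.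
    specialize (Hdel ltac:(lra)). replace (x + (y - x)) with y in Hdel by ring.
    rewrite E, Rminus_0_r in Hdel. apply Rabs_def2 in Hdel.
    assert (g1 y / (y - x) < 0) by lra.
    apply Rnot_le_lt. intros Hp. assert (0 <= g1 y / (y - x)); [|lra].
    apply Rmult_le_pos; [exact Hp|left; apply Rinv_0_lt_compat; lra]. }
  destruct (MVT_gen g x (x + del / 2) g1) as [c [Hc Ec]].
  - intros y _. apply Hg.
  - intros y _. apply derivable_continuous_pt. exists (g1 y). apply is_derive_Reals, Hg.
  - rewrite Rmin_left, Rmax_right in Hc by lra.
    (* [MVT_gen] may return the end point [x], where [g1] vanishes. Then [g] takes its minimum at x
       + del / 2 as well, and a second application to the right of that point gives a smaller
       value. *)
    destruct (Req_dec c x) as [->|Hcx].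
    + destruct (MVT_gen g (x + del / 2) (x + 3 * del / 4) g1) as [c' [Hc' Ec']].
      * intros y _. apply Hg.
      * intros y _. apply derivable_continuous_pt. exists (g1 y). apply is_derive_Reals, Hg.
      * rewrite Rmin_left, Rmax_right in Hc' by lra.
        assert (A := Hneg c' ltac:(lra)). assert (A' := Hmin (x + 3 * del / 4)).
        rewrite E in Ec.
        assert (g1 c' * del < 0) by (apply Rmult_neg_pos; [exact A|apply cond_pos]). lra.
    + assert (A := Hneg c ltac:(lra)). assert (A' := Hmin (x + del / 2)).
      assert (g1 c * del < 0) by (apply Rmult_neg_pos; lra). lra.
Qed.

(** Minimise in [x] over one period first; the minimum is continuous in time because joint
    continuity is uniform over the period. *)
Lemma jcont_min_attained (t0 T : R) (z : R -> R -> R) : t0 <= T ->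
  jcont (fun t => t0 <= t) z -> (forall t, t0 <= t -> space_periodic (z t)) ->
  exists t1 x1, t0 <= t1 <= T /\ forall t x, t0 <= t <= T -> z t1 x1 <= z t x.
Proof.
  intros HT Hz Hper. pose proof two_PI_pos as HP.
  assert (Hx : forall t, exists x, t0 <= t -> forall y, 0 <= y <= 2 * PI -> z t x <= z t y).
  { intros t. destruct (Rle_dec t0 t) as [Ht|Ht]; [|exists 0; intros; lra].
    destruct (continuity_ab_min (z t) 0 (2 * PI)) as [x [Hx _]]; [lra| |].
    - intros c _. apply continuity_pt_filterlim. apply (jcont_slice _ _ Hz t c Ht).
    - exists x. intros _. exact Hx. }
  set (xm t := proj1_sig (constructive_indefinite_description _ (Hx t))).
  assert (Hxm : forall t, t0 <= t -> forall y, z t (xm t) <= z t y).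
  { intros t Ht y. destruct (reduce_mod_period y) as [y' [Hy' Ey]].
    rewrite (Ey _ (Hper t Ht)).
    exact (proj2_sig (constructive_indefinite_description _ (Hx t)) Ht y' Hy'). }
  (* [Rmax t0 t] extends the minimum to times before [t0] by a constant, since [continuity_ab_min]
     asks for two-sided continuity. *)
  set (m t := z (Rmax t0 t) (xm (Rmax t0 t))).
  destruct (continuity_ab_min m t0 T HT) as [t1 [Ht1 Ht1']].
  - intros t Ht. apply continuity_pt_filterlim, filterlim_locally. intros eps.
    destruct (jcont_tube _ z 0 (2 * PI) Hz t (proj1 Ht) eps) as [del Hdel].
    exists del. intros s Hs. change (Rabs (s - t) < del) in Hs. change (Rabs (m s - m t) < eps).
    unfold m. rewrite (Rmax_right t0 t) by lra.
    set (s' := Rmax t0 s). assert (Hs0 : t0 <= s') by apply Rmax_l.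
    assert (Hs' : Rabs (s' - t) < del).
    { revert Hs. unfold s', Rmax, Rabs. destruct Rle_dec; repeat destruct Rcase_abs; lra. }
    assert (B : forall y, Rabs (z s' y - z t y) < eps).
    { intros y. destruct (reduce_mod_period y) as [y' [Hy' Ey]].
      rewrite (Ey _ (Hper t (proj1 Ht))), (Ey _ (Hper s' Hs0)). apply Hdel; assumption. }
    assert (B1 := B (xm t)). assert (B2 := B (xm s')).
    assert (M1 := Hxm t (proj1 Ht) (xm s')). assert (M2 := Hxm s' Hs0 (xm t)).
    apply Rabs_def2 in B1. apply Rabs_def2 in B2. apply Rabs_def1; lra.
  - exists t1, (xm t1). split; [exact Ht1'|]. intros t x Ht.
    specialize (Ht1 t Ht). unfold m in Ht1.
    rewrite (Rmax_right t0 t), (Rmax_right t0 t1) in Ht1 by lra.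
    eapply Rle_trans; [exact Ht1|]. apply Hxm. lra.
Qed.

(** At a negative minimum of exp (- L (t - t0)) w the space derivative vanishes, the second one is
    nonnegative and the time derivative is at most 0, that is w_t <= L w. The last hypothesis denies
    exactly this, and only at points where [w] is negative. *)
Lemma min_principle (t0 T L : R) (w : R -> R -> R) :
  jcont (fun t => t0 <= t) w -> (forall t, t0 <= t -> space_periodic (w t)) ->
  (forall x, 0 <= w t0 x) ->
  (forall t x, t0 < t <= T -> w t x < 0 -> exists wt w1 wxx,
     is_derive (fun s => w s x) t wt /\ (forall y, is_derive (w t) y (w1 y)) /\
     is_derive w1 x wxx /\ (w1 x = 0 -> 0 <= wxx -> L * w t x < wt)) ->
  forall t x, t0 <= t <= T -> 0 <= w t x.
Proof.
  intros Hw Hper H0 Hd t x Ht. apply Rnot_lt_le. intros Hneg.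
  set (e := fun s => exp (- L * (s - t0))).
  assert (He : forall s, 0 < e s) by (intros; apply exp_pos).
  set (z := fun t x => e t * w t x).
  assert (Hz : jcont (fun t => t0 <= t) z).
  { apply jcont_mult; [|exact Hw]. apply (jcont_time_continuous _ e).
    intros s _. apply continuous_exp_lin. }
  destruct (jcont_min_attained t0 T z ltac:(lra) Hz) as [t1 [x1 [Ht1 Hmin]]].
  { intros s Hs y. unfold z. rewrite (Hper s Hs). reflexivity. }
  assert (N1 : w t1 x1 < 0).
  { assert (A := Hmin t x Ht). unfold z in A. pose proof (He t1). pose proof (He t).
    apply Rnot_le_lt. intros P. assert (e t * w t x < 0) by nra.
    assert (0 <= e t1 * w t1 x1) by (apply Rmult_le_pos; lra). lra. }
  assert (T1 : t0 < t1).
  { destruct (Rle_lt_or_eq_dec t0 t1 (proj1 Ht1)) as [A|A]; [exact A|].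
    rewrite <- A in N1. specialize (H0 x1). lra. }
  destruct (Hd t1 x1 ltac:(lra) N1) as [wt [w1 [wxx [Dt [Dx [Dxx Hc]]]]]].
  destruct (second_derivative_test (w t1) w1 x1 wxx Dx Dxx) as [E1 E2].
  { intros y. assert (A := Hmin t1 y Ht1). unfold z in A.
    apply Rmult_le_reg_l with (e t1); auto. }
  specialize (Hc E1 E2).
  assert (Dz : is_derive (fun s => z s x1) t1 (- L * e t1 * w t1 x1 + e t1 * wt)).
  { apply (is_derive_mult e (fun s => w s x1)).
    - apply is_derive_exp_lin.
    - exact Dt.
    - intros; apply Rmult_comm. }
  assert (A := derive_le0_of_left_min _ t0 t1 _ T1 Dz (fun s Hs => Hmin s x1 ltac:(lra))).
  pose proof (He t1). nra.
Qed.

Lemma jcont_bounded (t0 T : R) (g : R -> R -> R) :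
  jcont (fun t => t0 <= t) g -> (forall t, t0 <= t -> space_periodic (g t)) ->
  exists M, 0 <= M /\ forall t x, t0 <= t <= T -> Rabs (g t x) <= M.
Proof.
  intros Hg Hper. destruct (Rle_dec t0 T) as [HT|HT]; [|exists 0; split; [lra|intros; lra]].
  destruct (jcont_min_attained t0 T (fun t x => - Rabs (g t x)) HT) as [t1 [x1 [Ht1 Hmin]]].
  - apply jcont_opp. apply (jcont_comp _ g Rabs Hg). intros t x _. apply continuous_Rabs.
  - intros t Ht x. rewrite (Hper t Ht). reflexivity.
  - exists (Rabs (g t1 x1)). split; [apply Rabs_pos|]. intros t x Ht. specialize (Hmin t x Ht). lra.
Qed.

(** * Relative derivatives and uniqueness *)

Lemma is_derive_of_within (t0 t : R) (g : R -> R) (l : R) : t0 < t ->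
  is_derive_within (fun s => t0 <= s) g t l -> is_derive g t l.
Proof.
  intros Ht [Hl H]. split; [exact Hl|]. intros x Hx.
  assert (E := is_filter_lim_locally_unique (V := AbsRing_NormedModule R_AbsRing) t x Hx). subst x.
  assert (Hf : is_filter_lim (within (fun s => t0 <= s) (locally t)) t).
  { intros P. unfold within. apply filter_imp. auto. }
  specialize (H t Hf). intros eps. specialize (H eps).
  assert (Hn : 0 < t - t0) by lra.
  assert (Hloc : locally t (fun s => t0 <= s)).
  { exists (mkposreal _ Hn). intros s Hs. change (Rabs (s - t) < t - t0) in Hs. apply Rabs_def2 in Hs. lra. }
  generalize (filter_and _ _ Hloc H). apply filter_imp. intros s [A B]. apply B, A.
Qed.

(** [filterdiff] quantifies over every limit of the filter; the first hypothesis makes the filter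
    proper, so that [t] is its only limit. *)
Lemma is_derive_within_intro (D : R -> Prop) (g : R -> R) (t l : R) :
  (forall e : posreal, exists s, D s /\ s <> t /\ Rabs (s - t) < e) ->
  (forall eps : posreal, exists del : posreal, forall s, D s -> Rabs (s - t) < del ->
     Rabs (g s - g t - (s - t) * l) <= eps * Rabs (s - t)) ->
  is_derive_within D g t l.
Proof.
  intros Hacc H. split.
  - apply (is_linear_scal_l (V := R_NormedModule)).
  - intros x Hx.
    assert (E : x = t).
    { apply NNPP. intros Hne.
      assert (Hp : 0 < Rabs (x - t) / 2) by (pose proof (Rabs_pos_lt (x - t) ltac:(lra)); lra).
      assert (A := Hx (fun s => Rabs (s - x) < Rabs (x - t) / 2)).
      assert (B : locally x (fun s => Rabs (s - x) < Rabs (x - t) / 2)).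
      { exists (mkposreal _ Hp). intros s Hs. exact Hs. }
      destruct (A B) as [e He].
      assert (Hm : 0 < Rmin e (Rabs (x - t) / 2)) by (apply Rmin_glb_lt; [apply cond_pos|exact Hp]).
      destruct (Hacc (mkposreal _ Hm)) as [s [Ds [_ Hs]]]. simpl in Hs.
      assert (Hs1 := Rlt_le_trans _ _ _ Hs (Rmin_l _ _)).
      assert (Hs2 := Rlt_le_trans _ _ _ Hs (Rmin_r _ _)).
      specialize (He s Hs1 Ds). 
      assert (Rabs (x - t) <= Rabs (s - t) + Rabs (s - x)).
      { replace (x - t) with ((s - t) - (s - x)) by ring.
        eapply Rle_trans; [apply Rabs_triang|]. rewrite Rabs_Ropp. lra. }
      lra. }
    subst x. intros eps. destruct (H eps) as [del Hdel].
    exists del. intros s Hs Ds. exact (Hdel s Ds Hs).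
Qed.

Lemma is_derive_within_of_derive (D : R -> Prop) (g : R -> R) (t l : R) :
  (forall e : posreal, exists s, D s /\ s <> t /\ Rabs (s - t) < e) ->
  is_derive g t l -> is_derive_within D g t l.
Proof.
  intros Hacc Hd. apply is_derive_within_intro; [exact Hacc|]. intros eps.
  destruct Hd as [_ Hd].
  assert (Ht : is_filter_lim (locally t) t) by (intros P HP; exact HP).
  destruct (Hd t Ht eps) as [del Hdel]. exists del. intros s _ Hs. exact (Hdel s Hs).
Qed.

Lemma half_line_limit_point (t0 t : R) : t0 <= t ->
  forall e : posreal, exists s, t0 <= s /\ s <> t /\ Rabs (s - t) < e.
Proof.
  intros Ht e. pose proof (cond_pos e). exists (t + e / 2).
  replace (t + e / 2 - t) with (e / 2) by ring. rewrite Rabs_pos_eq by lra. lra.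
Qed.

(** By the mean value theorem, a function continuous at the end point whose derivative has a limit
    there has that limit as one-sided derivative. *)
Lemma is_derive_within_endpoint (t0 : R) (g g' : R -> R) :
  filterlim g (within (fun s => t0 <= s) (locally t0)) (locally (g t0)) ->
  (forall t, t0 < t -> is_derive g t (g' t)) ->
  filterlim g' (within (fun s => t0 <= s) (locally t0)) (locally (g' t0)) ->
  is_derive_within (fun s => t0 <= s) g t0 (g' t0).
Proof.
  intros Hc Hd Hl. apply is_derive_within_intro; [apply half_line_limit_point; lra|]. intros eps.
  destruct (proj1 (filterlim_locally _ _) Hl eps) as [del Hdel].
  exists del. intros s Hs0 Hs. destruct (Req_dec s t0) as [->|Hne].
  { replace (g t0 - g t0 - (t0 - t0) * g' t0) with 0 by ring.
    rewrite (Rminus_diag t0), Rabs_R0, Rmult_0_r. lra. }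
  apply Rabs_def2 in Hs.
  destruct (MVT_gen (fun t => g (Rmax t0 t)) t0 s g') as [c [Hcc E]].
  - intros t Ht. rewrite Rmin_left, Rmax_right in Ht by lra.
    eapply is_derive_ext_loc; [|apply (Hd t); lra].
    assert (Hp : 0 < t - t0) by lra. exists (mkposreal _ Hp).
    intros r Hr. change (Rabs (r - t) < t - t0) in Hr. apply Rabs_def2 in Hr.
    rewrite Rmax_right by lra. reflexivity.
  - intros t Ht. rewrite Rmin_left, Rmax_right in Ht by lra.
    apply continuity_pt_filterlim. destruct (Req_dec t t0) as [->|Hne'].
    + rewrite (Rmax_left t0 t0) by lra. apply filterlim_locally. intros e.
      destruct (proj1 (filterlim_locally _ _) Hc e) as [d Hdd]. exists d. intros r Hr.
      apply Hdd; [|apply Rmax_l]. change (Rabs (r - t0) < d) in Hr. change (Rabs (Rmax t0 r - t0) < d).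
      revert Hr. unfold Rmax. destruct Rle_dec; auto. rewrite Rminus_diag, Rabs_R0.
      intros _. apply cond_pos.
    + apply (continuous_ext_loc (fun t => g (Rmax t0 t)) g t).
      * assert (Hp : 0 < t - t0) by lra. exists (mkposreal _ Hp).
        intros r Hr. change (Rabs (r - t) < t - t0) in Hr. apply Rabs_def2 in Hr.
        rewrite Rmax_right by lra. reflexivity.
      * apply continuous_of_derive with (g' t). apply Hd. lra.
  - rewrite Rmin_left, Rmax_right in Hcc by lra.
    rewrite (Rmax_right t0 s), (Rmax_left t0 t0) in E by lra. rewrite E.
    replace (g' c * (s - t0) - (s - t0) * g' t0) with ((g' c - g' t0) * (s - t0)) by ring.
    rewrite Rabs_mult. apply Rmult_le_compat_r; [apply Rabs_pos|]. left.
    apply (Hdel c); [|lra]. change (Rabs (c - t0) < del). apply Rabs_def1; lra.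
Qed.

Lemma classical_solution_jcont nu f D u : classical_solution nu f D u -> jcont D u.
Proof. intros H t x Ht. apply (cs_continuous _ _ _ _ H), Ht. Qed.

Lemma is_derive_minus_R (f g : R -> R) (x a b : R) :
  is_derive f x a -> is_derive g x b -> is_derive (fun y => f y - g y) x (a - b).
Proof. intros. apply (is_derive_minus (K := R_AbsRing) (V := R_NormedModule)); assumption. Qed.

(** Where w = v - u has a spatial minimum the two space derivatives agree, so w_t = nu w_xx - w v_x.
    Hence a bound on the derivative of either solution is enough, and the other solution may be
    arbitrary. *)
Lemma classical_solution_le (nu : R) (f : R -> R -> R) (t0 T : R) (u v : R -> R -> R) (M : R) :
  0 < nu ->
  classical_solution nu f (fun t => t0 <= t) u -> classical_solution nu f (fun t => t0 <= t) v ->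
  (forall x, u t0 x <= v t0 x) ->
  (forall t x, t0 < t <= T -> Rabs (Derive (v t) x) <= M \/ Rabs (Derive (u t) x) <= M) ->
  forall t x, t0 <= t <= T -> u t x <= v t x.
Proof.
  intros Hnu Hu Hv H0 HM t x Ht. apply Rminus_le_0.
  (* With |v_x| <= M and w < 0, w_t >= M w; the rate M + 1 turns this into the strict inequality. *)
  apply (min_principle t0 T (M + 1) (fun t x => v t x - u t x)); [| | | |exact Ht].
  - apply jcont_minus; eapply classical_solution_jcont; eassumption.
  - intros s Hs y. rewrite (cs_periodic _ _ _ _ Hu s Hs), (cs_periodic _ _ _ _ Hv s Hs). reflexivity.
  - intros y. specialize (H0 y). lra.
  - clear t x Ht. intros t x Ht Hneg.
    destruct (cs_equation _ _ _ _ Hu t x ltac:(lra)) as [ut [ux [uxx [Du1 [Du2 [Du3 Eu]]]]]].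
    destruct (cs_equation _ _ _ _ Hv t x ltac:(lra)) as [vt [vx [vxx [Dv1 [Dv2 [Dv3 Ev]]]]]].
    apply is_derive_of_within in Du1; [|lra]. apply is_derive_of_within in Dv1; [|lra].
    exists (vt - ut), (fun y => Derive (v t) y - Derive (u t) y), (vxx - uxx).
    split; [|split; [|split]].
    + apply (is_derive_minus_R (fun s => v s x) (fun s => u s x)); assumption.
    + intros y.
      destruct (cs_equation _ _ _ _ Hu t y ltac:(lra)) as [ut' [ux' [uxx' [_ [Du2' _]]]]].
      destruct (cs_equation _ _ _ _ Hv t y ltac:(lra)) as [vt' [vx' [vxx' [_ [Dv2' _]]]]].
      apply is_derive_minus_R; apply Derive_correct; eexists; eassumption.
    + apply is_derive_minus_R; assumption.
    + intros E1 E2.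
      rewrite (is_derive_unique _ _ _ Dv2), (is_derive_unique _ _ _ Du2) in E1.
      assert (Exy : ux = vx) by lra. subst ux.
      assert (Et : vt - ut = nu * (vxx - uxx) - (v t x - u t x) * vx) by lra.
      assert (Hb : Rabs vx <= M).
      { destruct (HM t x Ht) as [B|B].
        - rewrite (is_derive_unique _ _ _ Dv2) in B. exact B.
        - rewrite (is_derive_unique _ _ _ Du2) in B. exact B. }
      apply Rabs_le_between in Hb. rewrite Et.
      assert (0 <= nu * (vxx - uxx)) by (apply Rmult_le_pos; lra). nra.
Qed.

(** * The Cole-Hopf transformation *)

(** The working notion, with viscosity 2: derivatives are named and jointly continuous up to [t0],
    as the energy estimates require, and the mean is fixed. The time derivative is stated after [t0]
    only; the one-sided derivative at [t0] follows by continuity. *)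
Record smooth_solution (f : R -> R -> R) (t0 : R) (u u1 u2 : R -> R -> R) : Prop := {
  ss_jcont : jcont (fun t => t0 <= t) u;
  ss_jcont1 : jcont (fun t => t0 <= t) u1;
  ss_jcont2 : jcont (fun t => t0 <= t) u2;
  ss_periodic : forall t, t0 <= t -> space_periodic (u t);
  ss_periodic1 : forall t, t0 <= t -> space_periodic (u1 t);
  ss_derive : forall t x, t0 <= t -> is_derive (u t) x (u1 t x);
  ss_derive1 : forall t x, t0 <= t -> is_derive (u1 t) x (u2 t x);
  ss_derive_t : forall t x, t0 < t ->
    is_derive (fun s => u s x) t (f t x - u t x * u1 t x + 2 * u2 t x);
  ss_mean : forall t, t0 <= t -> RInt (u t) 0 (2 * PI) = PI
}.

Lemma jcont_within_time (D : R -> Prop) (g : R -> R -> R) : jcont D g ->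
  forall t x, D t -> filterlim (fun s => g s x) (within D (locally t)) (locally (g t x)).
Proof.
  intros Hg t x Ht. apply filterlim_locally. intros eps.
  destruct (jcont_eps D g Hg t x Ht eps) as [d Hd]. exists d. intros s Hs Ds.
  apply Hd; auto. rewrite Rminus_diag, Rabs_R0. apply cond_pos.
Qed.

Lemma is_derive_2_intro (g g1 : R -> R) (x l : R) :
  (forall y, is_derive g y (g1 y)) -> is_derive g1 x l -> is_derive_n g 2 x l.
Proof.
  intros H1 H2. simpl. eapply is_derive_ext; [|exact H2].
  intros y. symmetry. apply is_derive_unique, H1.
Qed.

Lemma smooth_solution_classical f t0 u u1 u2 : jcont (fun t => t0 <= t) f ->
  smooth_solution f t0 u u1 u2 -> classical_solution 2 f (fun t => t0 <= t) u.
Proof.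
  intros Hf H. split.
  - intros t x Ht. apply (ss_jcont _ _ _ _ _ H t x Ht).
  - apply (ss_periodic _ _ _ _ _ H).
  - intros t x Ht. exists (f t x - u t x * u1 t x + 2 * u2 t x), (u1 t x), (u2 t x).
    split; [|split; [|split]].
    + destruct (Rle_lt_or_eq_dec t0 t Ht) as [Hlt|<-].
      * apply is_derive_within_of_derive; [apply half_line_limit_point, Ht|].
        apply (ss_derive_t _ _ _ _ _ H), Hlt.
      * apply (is_derive_within_endpoint t0 (fun s => u s x)
          (fun s => f s x - u s x * u1 s x + 2 * u2 s x)).
        -- apply (jcont_within_time _ _ (ss_jcont _ _ _ _ _ H)), Ht.
        -- intros t Ht'. apply (ss_derive_t _ _ _ _ _ H), Ht'.
        -- apply (jcont_within_time (fun t => t0 <= t)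
             (fun s x => f s x - u s x * u1 s x + 2 * u2 s x)); [|exact Ht].
           apply jcont_plus; [apply jcont_minus; [exact Hf|apply jcont_mult]|apply jcont_mult; [apply jcont_const|]];
             apply H.
    + apply (ss_derive _ _ _ _ _ H), Ht.
    + apply (is_derive_2_intro (u t) (u1 t)); [intros y; apply (ss_derive _ _ _ _ _ H), Ht|].
      apply (ss_derive1 _ _ _ _ _ H), Ht.
    + ring.
Qed.

Lemma classical_solution_unique f t0 u u1 u2 v : jcont (fun t => t0 <= t) f ->
  smooth_solution f t0 u u1 u2 -> classical_solution 2 f (fun t => t0 <= t) v ->
  (forall x, v t0 x = u t0 x) -> forall t x, t0 <= t -> v t x = u t x.
Proof.
  intros Hf Hu Hv H0 t x Ht.
  destruct (jcont_bounded t0 t u1 (ss_jcont1 _ _ _ _ _ Hu) (ss_periodic1 _ _ _ _ _ Hu)) as [M [_ HM]].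
  assert (Hu' := smooth_solution_classical _ _ _ _ _ Hf Hu).
  assert (HD : forall s y, t0 < s <= t -> Rabs (Derive (u s) y) <= M).
  { intros s y Hs. rewrite (is_derive_unique _ _ _ (ss_derive _ _ _ _ _ Hu s y ltac:(lra))).
    apply HM. lra. }
  apply Rle_antisym.
  - apply (classical_solution_le 2 f t0 t v u M); auto; try lra. intros y. rewrite H0. lra.
  - apply (classical_solution_le 2 f t0 t u v M); auto; try lra. intros y. rewrite H0. lra.
Qed.

(* Mean velocity of the solutions. *)
Definition cm : R := 1 / 2.

Definition trig_force (A B : nat -> R -> R) (t x : R) : R :=
  (A 1%nat t * cos (1 * x) + B 1%nat t * sin (1 * x))
  + (A 2%nat t * cos (2 * x) + B 2%nat t * sin (2 * x))
  + (A 3%nat t * cos (3 * x) + B 3%nat t * sin (3 * x)).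

Section ColeHopf.

Variables (A B : nat -> R -> R) (Q : R).
Hypothesis A_cont : forall j t, continuous (A j) t.
Hypothesis B_cont : forall j t, continuous (B j) t.
Hypothesis A_bound : forall j t, Rabs (A j t) <= Q.
Hypothesis B_bound : forall j t, Rabs (B j t) <= Q.

Let f := trig_force A B.

(* The potential is [- F / 4] with [F_x = f]; its coefficients are rotated into the
   frame [y = x - cm t]; [j = 0] gives [0] since [/ 0 = 0]. *)
Definition pot_cos (j : nat) (t : R) : R :=
  (B j t * cos (INR j * cm * t) - A j t * sin (INR j * cm * t)) * / (4 * INR j).
Definition pot_sin (j : nat) (t : R) : R :=
  (- A j t * cos (INR j * cm * t) - B j t * sin (INR j * cm * t)) * / (4 * INR j).

Lemma pot_coef_cont (X Y : R -> R) (w k t : R) : continuous X t -> continuous Y t ->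
  continuous (fun s => (X s * cos (w * s) + Y s * sin (w * s)) * k) t.
Proof.
  intros HX HY. apply (continuous_mult (K := R_AbsRing)); [|apply continuous_const].
  apply (continuous_plus (V := R_NormedModule)); apply (continuous_mult (K := R_AbsRing)); auto;
    eapply continuous_of_derive; auto_derive; auto.
Qed.

Lemma pot_cos_cont j t : continuous (pot_cos j) t.
Proof.
  apply (continuous_ext (fun s => (B j s * cos (INR j * cm * s) + - A j s * sin (INR j * cm * s)) * / (4 * INR j))).
  - intros s. unfold pot_cos. eqR. ring.
  - apply pot_coef_cont; auto. apply (continuous_opp (V := R_NormedModule)); auto.
Qed.

Lemma pot_sin_cont j t : continuous (pot_sin j) t.
Proof.
  apply (continuous_ext (fun s => (- A j s * cos (INR j * cm * s) + - B j s * sin (INR j * cm * s)) * / (4 * INR j))).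
  - intros s. unfold pot_sin. eqR. ring.
  - apply pot_coef_cont; apply (continuous_opp (V := R_NormedModule)); auto.
Qed.

Lemma inv_4j_bound j : Rabs (/ (4 * INR j)) <= / 4.
Proof.
  destruct j as [|j]; [simpl; rewrite Rmult_0_r, Rinv_0, Rabs_R0; lra|].
  rewrite S_INR. pose proof (pos_INR j). rewrite Rabs_pos_eq by (left; apply Rinv_0_lt_compat; lra).
  apply Rinv_le_contravar; lra.
Qed.

Lemma pot_coef_bound a b u v k : Rabs a <= Q -> Rabs b <= Q -> Rabs u <= 1 -> Rabs v <= 1 ->
  Rabs k <= / 4 -> Rabs ((a * u + b * v) * k) <= Q.
Proof.
  intros Ha Hb Hu Hv Hk. rewrite Rabs_mult.
  assert (L := Rabs_lincomb_le a b u v Q Hu Hv Ha Hb).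
  pose proof (Rabs_pos a). pose proof (Rabs_pos (a * u + b * v)). pose proof (Rabs_pos k). nra.
Qed.

Lemma pot_cos_bound j t : Rabs (pot_cos j t) <= Q.
Proof.
  unfold pot_cos, Rminus. rewrite <- Ropp_mult_distr_l_reverse.
  apply pot_coef_bound; auto using Rabs_cos_le, Rabs_sin_le, inv_4j_bound.
  rewrite Rabs_Ropp. auto.
Qed.

Lemma pot_sin_bound j t : Rabs (pot_sin j t) <= Q.
Proof.
  unfold pot_sin, Rminus. rewrite <- (Ropp_mult_distr_l_reverse (B j t)).
  apply pot_coef_bound; auto using Rabs_cos_le, Rabs_sin_le, inv_4j_bound; rewrite Rabs_Ropp; auto.
Qed.

(** The property for which the potential is chosen: differentiating - 4 phi_x / phi in time produces
    - 4 q_x, which must be the force in the fixed coordinate. *)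
Lemma dpot_force t x : -4 * dpot pot_cos pot_sin t (x - cm * t) = f t x.
Proof.
  assert (G : forall j n, n = INR j -> j <> 0%nat ->
    -4 * (n * (pot_sin j t * cos (n * (x - cm * t)) - pot_cos j t * sin (n * (x - cm * t))))
      = A j t * cos (n * x) + B j t * sin (n * x)).
  { intros j n Hn Hj. assert (Hn0 : n <> 0) by (subst n; apply not_0_INR, Hj).
    unfold pot_sin, pot_cos. rewrite <- Hn.
    set (y := n * (x - cm * t)). set (w := n * cm * t).
    replace (n * x) with (y + w) by (unfold y, w; ring).
    rewrite cos_plus, sin_plus. field. exact Hn0. }
  assert (G1 := G 1%nat 1 eq_refl ltac:(lia)).
  assert (G2 := G 2%nat 2 ltac:(simpl; ring) ltac:(lia)).
  assert (G3 := G 3%nat 3 ltac:(simpl; ring) ltac:(lia)).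
  unfold f, trig_force. rewrite <- G1, <- G2, <- G3. unfold dpot. ring.
Qed.

Lemma jcont_force D : jcont D f.
Proof.
  assert (G : forall j n, jcont D (fun t x => A j t * cos (n * x) + B j t * sin (n * x))).
  { intros j n. apply jcont_plus; apply jcont_mult.
    - apply jcont_time_continuous. auto.
    - apply (jcont_space D (fun x => cos (n * x))). intros x. eapply continuous_of_derive. auto_derive; auto.
    - apply jcont_time_continuous. auto.
    - apply (jcont_space D (fun x => sin (n * x))). intros x. eapply continuous_of_derive. auto_derive; auto. }
  unfold f, trig_force. apply jcont_plus; [apply jcont_plus|]; apply G.
Qed.

Lemma pot_abs_le t y : Rabs (pot pot_cos pot_sin t y) <= 6 * Q.
Proof.
  unfold pot.
  assert (G : forall j n, Rabs (pot_cos j t * cos (n * y) + pot_sin j t * sin (n * y)) <= 2 * Q).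
  { intros j n. apply Rabs_lincomb_le; auto using Rabs_cos_le, Rabs_sin_le, pot_cos_bound, pot_sin_bound. }
  assert (G1 := G 1%nat 1). assert (G2 := G 2%nat 2). assert (G3 := G 3%nat 3).
  eapply Rle_trans; [apply Rabs_triang|].
  eapply Rle_trans; [apply Rplus_le_compat_r, Rabs_triang|]. lra.
Qed.

Section Solution.

Variables (t1 : R) (p : R -> coefs).
Hypothesis Hp : heat_solution pot_cos pot_sin t1 p.

Let ph := phi cm p.

Let jc n (Hn : (n <= 3)%nat) : jcont (fun t => t1 <= t) (ph n) :=
  phi_jcont _ _ cm t1 p Hp n Hn.

(** The potential is bounded by 6 Q, so the function delta exp (- (6 Q + 1) (t - t1)) is a strict
    subsolution. *)
Lemma phi_lower_bound delta : 0 < delta -> (forall x, delta <= ph 0 t1 x) ->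
  forall t x, t1 <= t -> delta * exp (- (6 * Q + 1) * (t - t1)) <= ph 0 t x.
Proof.
  intros Hdelta H0 T x0 HT. apply Rminus_le_0.
  assert (HQ : 0 <= Q) by (eapply Rle_trans; [apply Rabs_pos|apply (A_bound 0 0)]).
  set (e := fun s => exp (- (6 * Q + 1) * (s - t1))).
  apply (min_principle t1 T (6 * Q) (fun t x => ph 0%nat t x - delta * e t)); [| | | |lra].
  - apply jcont_minus; [apply jc; lia|]. apply (jcont_time_continuous _ (fun t => delta * e t)).
    intros s _. apply (continuous_scal_r (V := R_NormedModule) delta), continuous_exp_lin.
  - intros s _ y. unfold ph. rewrite phi_periodic. reflexivity.
  - intros y. unfold e. rewrite Rminus_diag, Rmult_0_r, exp_0. specialize (H0 y). lra.
  - intros t x Ht Hneg.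
    eexists _, (ph 1%nat t), (ph 2%nat t x). split; [|split; [|split]].
    + apply is_derive_minus_R.
      * apply (phi_derive_t _ _ Q pot_cos_bound pot_sin_bound cm t1 p Hp). lra.
      * apply (is_derive_scal e t delta), is_derive_exp_lin.
    + intros y. rewrite <- (Rminus_0_r (ph 1%nat t y)). apply is_derive_minus_R.
      * apply (phi_derive_x _ _ cm t1 p Hp); [lia|lra].
      * apply (is_derive_const (V := R_NormedModule)).
    + apply (phi_derive_x _ _ cm t1 p Hp); [lia|lra].
    + intros E1 E2. fold (ph 0%nat). fold (ph 1%nat). fold (ph 2%nat).
      unfold ph in E1, E2, Hneg |- *. rewrite E1.
      set (q := pot pot_cos pot_sin t (x - cm * t)).
      assert (Hq : Rabs q <= 6 * Q) by apply pot_abs_le.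
      apply Rabs_le_between in Hq. fold (e t). 
      set (F := phi cm p 0 t x) in *. assert (He : 0 < delta * e t) by (apply Rmult_lt_0_compat; [exact Hdelta|apply exp_pos]).
      set (E := delta * e t) in *.
      replace (delta * (- (6 * Q + 1) * e t)) with (- (6 * Q + 1) * E) by (unfold E; ring).
      destruct (Rle_dec 0 F); nra.
Qed.

Hypothesis pos : forall t x, t1 <= t -> 0 < ph 0 t x.

Definition cole (t x : R) : R := cm - 4 * (phi cm p 1 t x / phi cm p 0 t x).
Definition cole1 (t x : R) : R :=
  -4 * (phi cm p 2 t x / phi cm p 0 t x - (phi cm p 1 t x / phi cm p 0 t x) ^ 2).
Definition cole2 (t x : R) : R :=
  -4 * (phi cm p 3 t x / phi cm p 0 t x
        - 3 * (phi cm p 1 t x / phi cm p 0 t x) * (phi cm p 2 t x / phi cm p 0 t x)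
        + 2 * (phi cm p 1 t x / phi cm p 0 t x) ^ 3).

Lemma ratio_jcont n : (n <= 3)%nat -> jcont (fun t => t1 <= t) (fun t x => ph n t x / ph 0%nat t x).
Proof.
  intros Hn. apply jcont_div; [apply jc, Hn|apply jc; lia|].
  intros t x Ht. apply Rgt_not_eq, pos, Ht.
Qed.

(** [cole], [cole1] and [cole2] are polynomials in these ratios, so this rule gives all the space
    derivatives needed. *)
Lemma ratio_derive n t x : (n <= 2)%nat -> t1 <= t ->
  is_derive (fun x => ph n t x / ph 0%nat t x) x
    (ph (S n) t x / ph 0%nat t x - (ph n t x / ph 0%nat t x) * (ph 1%nat t x / ph 0%nat t x)).
Proof.
  intros Hn Ht. assert (H0 := pos t x Ht). evar_last.
  - apply (is_derive_div (ph n t) (ph 0%nat t)).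
    + apply (phi_derive_x _ _ cm t1 p Hp); [lia|lra].
    + apply (phi_derive_x _ _ cm t1 p Hp); [lia|lra].
    + apply Rgt_not_eq, H0.
  - fold ph. field. apply Rgt_not_eq, H0.
Qed.

Lemma cole_hopf : smooth_solution f t1 cole cole1 cole2.
Proof.
  assert (R1 := ratio_jcont 1 ltac:(lia)). assert (R2 := ratio_jcont 2 ltac:(lia)).
  assert (R3 := ratio_jcont 3 ltac:(lia)).
  assert (Dx : forall t x, t1 <= t -> is_derive (cole t) x (cole1 t x)).
  { intros t x Ht. evar_last.
    - apply is_derive_minus_R; [apply (is_derive_const (V := R_NormedModule))|].
      apply (is_derive_scal (fun x => ph 1%nat t x / ph 0%nat t x) x 4), ratio_derive; [lia|exact Ht].
    - unfold cole1, ph. change zero with 0. eqR. ring. }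
  split.
  - apply (jcont_minus _ (fun _ _ => cm)); [apply jcont_const|].
    apply (jcont_mult _ (fun _ _ => 4)); [apply jcont_const|exact R1].
  - apply (jcont_mult _ (fun _ _ => -4)); [apply jcont_const|].
    apply jcont_minus; [exact R2|].
    apply (jcont_comp _ _ (fun z => z ^ 2) R1). intros s y _.
    eapply continuous_of_derive. auto_derive; auto.
  - apply (jcont_mult _ (fun _ _ => -4)); [apply jcont_const|].
    apply jcont_plus; [apply jcont_minus; [exact R3|]|].
    + apply jcont_mult; [|exact R2]. apply (jcont_mult _ (fun _ _ => 3)); [apply jcont_const|exact R1].
    + apply (jcont_mult _ (fun _ _ => 2)); [apply jcont_const|].
      apply (jcont_comp _ _ (fun z => z ^ 3) R1). intros s y _.
      eapply continuous_of_derive. auto_derive; auto.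
  - intros t _ x. unfold cole. rewrite !phi_periodic. reflexivity.
  - intros t _ x. unfold cole1. rewrite !phi_periodic. reflexivity.
  - exact Dx.
  - intros t x Ht. evar_last.
    + apply (is_derive_scal (fun x => ph 2%nat t x / ph 0%nat t x - (ph 1%nat t x / ph 0%nat t x) ^ 2) x (-4)).
      apply is_derive_minus_R; [apply ratio_derive; [lia|exact Ht]|].
      apply (is_derive_pow (fun x => ph 1%nat t x / ph 0%nat t x) 2), ratio_derive; [lia|exact Ht].
    + unfold cole2, ph. simpl. eqR. unfold Rdiv. ring.
  - intros t x Ht. assert (H0 := pos t x ltac:(lra)).
    evar_last.
    + apply is_derive_minus_R; [apply (is_derive_const (V := R_NormedModule))|].
      apply (is_derive_scal (fun s => ph 1%nat s x / ph 0%nat s x) t 4).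
      apply (is_derive_div (fun s => ph 1%nat s x) (fun s => ph 0%nat s x)).
      * apply (phi1_derive_t _ _ Q pot_cos_bound pot_sin_bound cm t1 p Hp), Ht.
      * apply (phi_derive_t _ _ Q pot_cos_bound pot_sin_bound cm t1 p Hp), Ht.
      * apply Rgt_not_eq, H0.
    (* Once the force is - 4 q_x, the equation is a rational identity in phi and its first three
       space derivatives. *)
    + rewrite <- dpot_force. unfold cole, cole1, cole2, ph in *. change zero with 0. eqR.
      field. apply Rgt_not_eq, H0.
  - intros t Ht.
    (* [cole t] is the derivative of cm x - 4 ln phi with phi periodic, so its integral over a
       period is 2 PI cm = PI. *)
    assert (HL : forall x, is_derive (fun x => cm * x - 4 * ln (ph 0%nat t x)) x (cole t x)).
    { intros x. assert (H0 := pos t x Ht). evar_last.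
      - apply is_derive_minus_R.
        + apply (is_derive_scal (fun x => x) x cm), (is_derive_id (K := R_AbsRing)).
        + apply (is_derive_scal (fun x => ln (ph 0%nat t x)) x 4).
          apply (is_derive_comp ln (ph 0%nat t) x (/ ph 0%nat t x)).
          * apply is_derive_Reals, derivable_pt_lim_ln, H0.
          * apply (phi_derive_x _ _ cm t1 p Hp); [lia|exact Ht].
      - change one with 1. change scal with Rmult. unfold cole, ph, Rdiv. eqR. ring. }
    assert (HI : is_RInt (cole t) 0 (2 * PI)
      (cm * (2 * PI) - 4 * ln (ph 0%nat t (2 * PI)) - (cm * 0 - 4 * ln (ph 0%nat t 0)))).
    { apply (is_RInt_derive (V := R_CompleteNormedModule) (fun x => cm * x - 4 * ln (ph 0%nat t x))).
      - intros x _. apply HL.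
      - intros x _. eapply continuous_of_derive, Dx, Ht. }
    rewrite (is_RInt_unique _ _ _ _ HI).
    replace (ph 0%nat t (2 * PI)) with (ph 0%nat t 0).
    + unfold cm. eqR. field.
    + unfold ph. rewrite <- (phi_periodic cm p 0 t 0). f_equal. ring.
Qed.

End Solution.
End ColeHopf.

(** * Fourier coefficients *)

(** Derivatives are given by witnesses instead of [Derive_n], which makes closure under sums and
    products a direct induction. *)
Fixpoint Ck (n : nat) (g : R -> R) : Prop :=
  match n with
  | 0%nat => forall x, continuous g x
  | S n => exists g', (forall x, is_derive g x (g' x)) /\ Ck n g'
  end.

Lemma Ck_ext n : forall f g, (forall x, f x = g x) -> Ck n f -> Ck n g.
Proof.
  destruct n as [|n]; intros f g E.
  - intros Hf x. apply (continuous_ext f g x); auto.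
  - intros [f' [Hd Hf']]. exists f'. split; [|exact Hf'].
    intros x. apply (is_derive_ext f g); auto.
Qed.

Lemma Ck_continuous n g : Ck n g -> forall x, continuous g x.
Proof.
  destruct n as [|n]; [auto|]. intros [g' [Hd _]] x. eapply continuous_of_derive, Hd.
Qed.

Lemma Ck_pred n : forall g, Ck (S n) g -> Ck n g.
Proof.
  induction n as [|n IH]; intros g Hg.
  - exact (Ck_continuous _ _ Hg).
  - destruct Hg as [g' [Hd Hg']]. exists g'. auto.
Qed.

Lemma Ck_plus n : forall f g, Ck n f -> Ck n g -> Ck n (fun x => f x + g x).
Proof.
  induction n as [|n IH]; intros f g Hf Hg.
  - intros x. apply (continuous_plus (V := R_NormedModule)); auto.
  - destruct Hf as [f' [Df Hf']]. destruct Hg as [g' [Dg Hg']].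
    exists (fun x => f' x + g' x). split; [|auto].
    intros x. apply (is_derive_plus (K := R_AbsRing) (V := R_NormedModule)); auto.
Qed.

Lemma Ck_mult n : forall f g, Ck n f -> Ck n g -> Ck n (fun x => f x * g x).
Proof.
  induction n as [|n IH]; intros f g Hf Hg.
  - intros x. apply (continuous_mult (K := R_AbsRing)); auto.
  - assert (Hf0 := Ck_pred _ _ Hf). assert (Hg0 := Ck_pred _ _ Hg).
    destruct Hf as [f' [Df Hf']]. destruct Hg as [g' [Dg Hg']].
    exists (fun x => f' x * g x + f x * g' x). split.
    + intros x. apply (is_derive_mult f g x (f' x) (g' x)); auto. intros; apply Rmult_comm.
    + apply Ck_plus; auto.
Qed.

Lemma Ck_const n : forall a, Ck n (fun _ => a).
Proof.
  induction n as [|n IH]; intros a; [intros x; apply continuous_const|].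
  exists (fun _ => 0). split; [|apply IH]. intros x. apply (is_derive_const (V := R_NormedModule)).
Qed.

(** Bootstrap: every derivative known for [phi] carries over to the product h phi, hence yields one
    more for [phi], until the regularity of [h] is used up. *)
Lemma Ck_log_derivative n h phi : Ck n h -> (forall x, is_derive phi x (h x * phi x)) -> Ck (S n) phi.
Proof.
  intros Hh Hd.
  assert (G : forall m, (m <= S n)%nat -> Ck m phi).
  { induction m as [|m IH]; intros Hm.
    - intros x. eapply continuous_of_derive, Hd.
    - exists (fun x => h x * phi x). split; [exact Hd|]. apply Ck_mult; [|apply IH; lia].
      assert (Hmn : (m <= n)%nat) by lia. clear - Hh Hmn.
      induction Hmn; [exact Hh|]. apply IHHmn, Ck_pred, Hh. }
  apply G. lia.
Qed.

Lemma Ck_trig n : forall C p, decay (n + 3) C p -> Ck n (trig p).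
Proof.
  induction n as [|n IH]; intros C p Hp.
  - intros x. eapply continuous_of_derive, is_derive_trig, Hp.
  - exists (trig (dcoef p)). split.
    + intros x. apply (is_derive_trig C), (decay_mono (S n + 3) 3 C C); [lia|lra|exact Hp].
    + apply (IH C), decay_dcoef. exact Hp.
Qed.

Lemma Ck_shift n : forall g a, Ck n g -> Ck n (fun x => g (x + a)).
Proof.
  induction n as [|n IH]; intros g a Hg.
  - intros x. apply (continuous_comp (fun x => x + a) g); [|apply Hg].
    eapply continuous_of_derive. auto_derive; auto.
  - destruct Hg as [g' [Hd Hg']]. exists (fun x => g' (x + a)). split; [|apply IH, Hg'].
    intros x. evar_last.
    + apply (is_derive_comp g (fun x => x + a) x (g' (x + a)) 1); [apply Hd|]. auto_derive; auto.
    + change scal with Rmult. eqR. ring.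
Qed.

Lemma RInt_shift (g : R -> R) (a : R) : (forall x, continuous g x) -> space_periodic g ->
  RInt (fun x => g (x + a)) 0 (2 * PI) = RInt g 0 (2 * PI).
Proof.
  intros Hc Hp.
  assert (Hex : forall u v, ex_RInt g u v) by (intros; apply ex_RInt_cont, Hc).
  assert (Tr : forall b u v, RInt (fun x => g (x + b)) u v = RInt g (u + b) (v + b)).
  { intros b u v.
    transitivity (RInt (fun y => scal 1 (g (1 * y + b))) u v).
    - apply RInt_ext. intros x _. change scal with Rmult. rewrite !Rmult_1_l. reflexivity.
    - rewrite (RInt_comp_lin (V := R_CompleteNormedModule)) by apply Hex. f_equal; ring. }
  rewrite Tr, Rplus_0_l.
  rewrite <- (RInt_Chasles g a 0 (2 * PI + a)) by apply Hex.
  rewrite <- (RInt_Chasles g 0 (2 * PI) (2 * PI + a)) by apply Hex.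
  replace (RInt g (2 * PI) (2 * PI + a)) with (RInt g 0 a).
  2:{ replace (2 * PI) with (0 + 2 * PI) at 1 by ring.
      replace (2 * PI + a) with (a + 2 * PI) by ring. rewrite <- Tr.
      apply RInt_ext. intros x _. symmetry. apply Hp. }
  rewrite <- (opp_RInt_swap g 0 a) by apply Hex.
  change plus with Rplus. change opp with Ropp. eqR. ring.
Qed.

(** The sum of the integrals up to [y] can be differentiated term by term in [y], so it is a
    primitive of the sum. *)
Lemma RInt_Series (h : nat -> R -> R) (M : nat -> R) (b : R) :
  ex_series M -> (forall n x, continuous (h n) x) -> (forall n x, Rabs (h n x) <= M n) -> 0 <= b ->
  RInt (fun x => Series (fun n => h n x)) 0 b = Series (fun n => RInt (h n) 0 b).
Proof.
  intros HM Hc HB Hb.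
  set (G := fun y => Series (fun n => RInt (h n) 0 y)).
  assert (Hbd : forall n y, Rabs (RInt (h n) 0 y) <= Rabs y * M n).
  { intros n y. assert (A := abs_RInt_le_const (h n) 0 y (M n)). 
    destruct (Rle_dec 0 y) as [Hy|Hy].
    - rewrite (Rabs_pos_eq y) by exact Hy. rewrite <- (Rminus_0_r y) at 2. apply A; auto.
      apply ex_RInt_cont, Hc.
    - rewrite <- (opp_RInt_swap (h n) y 0) by apply ex_RInt_cont, Hc.
      change opp with Ropp. rewrite Rabs_Ropp, (Rabs_left y) by lra.
      replace (- y) with (0 - y) by ring. apply (abs_RInt_le_const (h n) y 0 (M n)); auto; [lra|].
      apply ex_RInt_cont, Hc. }
  assert (D : forall y, is_derive G y (Series (fun n => h n y))).
  { intros y. apply (is_derive_Series (fun n y => RInt (h n) 0 y) h M y (mkposreal 1 Rlt_0_1) HM).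
    - intros n s _. apply (is_derive_RInt (h n) (fun y => RInt (h n) 0 y) 0 s); [|apply Hc].
      apply filter_forall. intros z. apply (RInt_correct (V := R_CompleteNormedModule)), ex_RInt_cont, Hc.
    - intros n s _. apply HB.
    - intros s _. apply ex_series_dominated with (fun n => Rabs s * M n); [intros n; apply Hbd|].
      apply (ex_series_scal (V := R_NormedModule)), HM. }
  assert (C : forall y, continuous (fun x => Series (fun n => h n x)) y).
  { intros y. apply (filterlim_Series (locally y) (fun n x => h n x) (fun n => h n y) M HM); auto.
    - apply filter_forall. intros x n. apply HB.
    - intros n. apply Hc. }
  assert (I := is_RInt_derive (V := R_CompleteNormedModule) G _ 0 b (fun y _ => D y) (fun y _ => C y)).
  rewrite (is_RInt_unique _ _ _ _ I). unfold G.
  rewrite (Series_ext (fun n => RInt (h n) 0 0) (fun n => 0 * 0)).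
  - rewrite Series_scal_l. change minus with Rminus. eqR. ring.
  - intros n. rewrite RInt_point. change zero with 0. eqR. ring.
Qed.

(** The factor is 1 / (2 PI) at every frequency, not 1 / PI, because k and - k both occur in the
    spanning set and contribute equally. *)
Definition fourier (g : R -> R) : coefs := fun i =>
  match i with
  | (k, true) => / (2 * PI) * RInt (fun x => g x * cos (IZR k * x)) 0 (2 * PI)
  | (k, false) => / (2 * PI) * RInt (fun x => g x * sin (IZR k * x)) 0 (2 * PI)
  end.

Lemma continuous_cos_lin k x : continuous (fun x => cos (k * x)) x.
Proof. eapply continuous_of_derive. auto_derive; auto. Qed.

Lemma continuous_sin_lin k x : continuous (fun x => sin (k * x)) x.
Proof. eapply continuous_of_derive. auto_derive; auto. Qed.

Lemma fourier_bound g M : (forall x, continuous g x) -> (forall x, 0 <= x <= 2 * PI -> Rabs (g x) <= M) ->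
  forall i, Rabs (fourier g i) <= M.
Proof.
  intros Hc HM [k b]. pose proof two_PI_pos as HP.
  assert (G : forall e : R -> R, (forall x, continuous e x) -> (forall x, Rabs (e x) <= 1) ->
    Rabs (/ (2 * PI) * RInt (fun x => g x * e x) 0 (2 * PI)) <= M).
  { intros e He He1. rewrite Rabs_mult, Rabs_pos_eq by (left; apply Rinv_0_lt_compat, HP).
    apply (Rmult_le_reg_l (2 * PI)); [exact HP|]. rewrite <- Rmult_assoc, Rinv_r, Rmult_1_l by lra.
    rewrite <- (Rminus_0_r (2 * PI)) at 2. apply abs_RInt_le_const; [lra| |].
    - apply ex_RInt_cont. intros x. apply continuous_mult_R; auto.
    - intros x Hx. rewrite Rabs_mult. specialize (HM x Hx). specialize (He1 x).
      pose proof (Rabs_pos (g x)). pose proof (Rabs_pos (e x)). nra. }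
  destruct b; cbn [fourier]; apply G; auto using continuous_cos_lin, continuous_sin_lin, Rabs_cos_le, Rabs_sin_le.
Qed.

Lemma periodic_continuous_bounded g : (forall x, continuous g x) -> space_periodic g ->
  exists M, 0 <= M /\ forall x, Rabs (g x) <= M.
Proof.
  intros Hc Hp. destruct (jcont_bounded 0 0 (fun _ x => g x)) as [M [HM HB]].
  - apply jcont_space, Hc.
  - intros; exact Hp.
  - exists M. split; [exact HM|]. intros x. apply (HB 0 x). lra.
Qed.

Lemma derive_periodic g g' : (forall x, is_derive g x (g' x)) -> space_periodic g -> space_periodic g'.
Proof.
  intros Hd Hp x.
  assert (D : is_derive g x (g' (x + 2 * PI))).
  { apply (is_derive_ext (fun y => g (y + 2 * PI))); [intros y; apply Hp|].
    evar_last.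
    - apply (is_derive_comp g (fun y => y + 2 * PI) x (g' (x + 2 * PI)) 1); [apply Hd|]. auto_derive; auto.
    - change scal with Rmult. eqR. ring. }
  rewrite <- (is_derive_unique _ _ _ D). apply is_derive_unique, Hd.
Qed.

Lemma cos_sin_2kPI (k : Z) : cos (IZR k * (2 * PI)) = 1 /\ sin (IZR k * (2 * PI)) = 0.
Proof.
  assert (Pc : space_periodic cos).
  { intros x. replace (x + 2 * PI) with (x + 2 * INR 1 * PI) by (simpl; ring). apply cos_period. }
  assert (Ps : space_periodic sin).
  { intros x. replace (x + 2 * PI) with (x + 2 * INR 1 * PI) by (simpl; ring). apply sin_period. }
  split.
  - rewrite <- (Rplus_0_l (IZR k * _)), (periodic_shift_Z cos Pc). apply cos_0.
  - rewrite <- (Rplus_0_l (IZR k * _)), (periodic_shift_Z sin Ps). apply sin_0.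
Qed.

Lemma RInt_by_parts (f f' g g' : R -> R) (a b : R) :
  (forall x, is_derive f x (f' x)) -> (forall x, is_derive g x (g' x)) ->
  (forall x, continuous f' x) -> (forall x, continuous g' x) ->
  RInt (fun x => f x * g' x) a b = f b * g b - f a * g a - RInt (fun x => f' x * g x) a b.
Proof.
  intros Df Dg Cf Cg.
  assert (Cf0 : forall x, continuous f x) by (intros; eapply continuous_of_derive, Df).
  assert (Cg0 : forall x, continuous g x) by (intros; eapply continuous_of_derive, Dg).
  assert (I := is_RInt_derive (V := R_CompleteNormedModule) (fun x => f x * g x)
     (fun x => f' x * g x + f x * g' x) a b).
  assert (I' : is_RInt (fun x => f' x * g x + f x * g' x) a b (f b * g b - f a * g a)).
  { apply I; intros x _.
    - apply (is_derive_mult f g); auto. intros; apply Rmult_comm.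
    - apply (continuous_plus (V := R_NormedModule)); apply continuous_mult_R; auto. }
  rewrite <- (is_RInt_unique _ _ _ _ I').
  rewrite (RInt_plus (V := R_CompleteNormedModule) (fun x => f' x * g x) (fun x => f x * g' x)).
  - change plus with Rplus. eqR; ring.
  - apply ex_RInt_cont. intros x. apply continuous_mult_R; auto.
  - apply ex_RInt_cont. intros x. apply continuous_mult_R; auto.
Qed.

Lemma fourier_derive g g' : (forall x, is_derive g x (g' x)) -> (forall x, continuous g' x) ->
  space_periodic g -> forall k,
  IZR k * fourier g (k, true) = - fourier g' (k, false) /\
  IZR k * fourier g (k, false) = fourier g' (k, true).
Proof.
  intros Hd Hc Hp k. cbn [fourier].
  assert (Hg : g (2 * PI) = g 0) by (rewrite <- (Hp 0); f_equal; ring).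
  destruct (cos_sin_2kPI k) as [E1 E2].
  assert (Cg : forall x, continuous g x) by (intros; eapply continuous_of_derive, Hd).
  assert (S1 : RInt (fun x => g x * (IZR k * cos (IZR k * x))) 0 (2 * PI) = IZR k * RInt (fun x => g x * cos (IZR k * x)) 0 (2 * PI)).
  { rewrite <- (RInt_scal (V := R_CompleteNormedModule)).
    - apply RInt_ext. intros x _. change scal with Rmult. eqR. ring.
    - apply ex_RInt_cont. intros x. apply continuous_mult_R; auto. apply continuous_cos_lin. }
  assert (S2 : RInt (fun x => g x * (IZR k * sin (IZR k * x))) 0 (2 * PI) = IZR k * RInt (fun x => g x * sin (IZR k * x)) 0 (2 * PI)).
  { rewrite <- (RInt_scal (V := R_CompleteNormedModule)).
    - apply RInt_ext. intros x _. change scal with Rmult. eqR. ring.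
    - apply ex_RInt_cont. intros x. apply continuous_mult_R; auto. apply continuous_sin_lin. }
  split.
  - rewrite <- Rmult_assoc, (Rmult_comm (IZR k)), Rmult_assoc, <- S1.
    rewrite (RInt_by_parts g g' (fun x => sin (IZR k * x)) (fun x => IZR k * cos (IZR k * x))); auto.
    + rewrite E2, (Rmult_0_r (IZR k)), sin_0. eqR; ring.
    + intros x. auto_derive; auto. eqR; ring.
    + intros x. apply continuous_mult_R; [apply continuous_const|apply continuous_cos_lin].
  - rewrite <- Rmult_assoc, (Rmult_comm (IZR k)), Rmult_assoc, <- S2.
    rewrite (RInt_by_parts g g' (fun x => - cos (IZR k * x)) (fun x => IZR k * sin (IZR k * x))); auto.
    + rewrite E1, (Rmult_0_r (IZR k)), cos_0, Hg.
      replace (RInt (fun x => g' x * - cos (IZR k * x)) 0 (2 * PI)) with (- RInt (fun x => g' x * cos (IZR k * x)) 0 (2 * PI)); [eqR; ring|].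
      rewrite <- (RInt_opp (V := R_CompleteNormedModule)).
      * apply RInt_ext. intros x _. change opp with Ropp. eqR. ring.
      * apply ex_RInt_cont. intros x. apply continuous_mult_R; auto. apply continuous_cos_lin.
    + intros x. auto_derive; auto. eqR; ring.
    + intros x. apply continuous_mult_R; [apply continuous_const|apply continuous_sin_lin].
Qed.

Lemma fourier_decay m : forall g, Ck m g -> space_periodic g -> exists C, decay m C (fourier g).
Proof.
  induction m as [|m IH]; intros g Hg Hp.
  - destruct (periodic_continuous_bounded g (Ck_continuous _ _ Hg) Hp) as [M [HM HB]].
    exists M. intros k b. rewrite wt_0, Rmult_1_r.
    apply fourier_bound; [exact (Ck_continuous _ _ Hg)|auto].
  - destruct (periodic_continuous_bounded g (Ck_continuous _ _ Hg) Hp) as [M [HM HB]].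
    destruct Hg as [g' [Hd Hg']].
    assert (Cg : forall x, continuous g x) by (intros; eapply continuous_of_derive, Hd).
    destruct (IH g' Hg' (derive_periodic g g' Hd Hp)) as [C HC].
    assert (HC0 := decay_ge0 _ _ _ HC).
    (* [M] covers k = 0; for other k, 1 + |k| <= 2 |k| and an integration by parts give 2 C. *)
    exists (M + 2 * C). intros k b.
    pose proof (wt_pos m k). pose proof (wt_pos (S m) k).
    destruct (Z.eq_dec k 0) as [->|Hk].
    + unfold wt at 1. rewrite Rabs_R0, Rplus_0_r, pow1, Rinv_1, Rmult_1_r.
      assert (F := fourier_bound g M Cg (fun x _ => HB x) (0%Z, b)). lra.
    + assert (K1 : 1 <= Rabs (IZR k)) by (rewrite <- abs_IZR; apply IZR_le; lia).
      assert (E : Rabs (IZR k) * Rabs (fourier g (k, b)) <= C * wt m k).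
      { rewrite <- Rabs_mult. destruct (fourier_derive g g' Hd (Ck_continuous _ _ Hg') Hp k) as [F1 F2].
        destruct b; [rewrite F1, Rabs_Ropp|rewrite F2]; apply HC. }
      assert (W : wt m k = (1 + Rabs (IZR k)) * wt (S m) k).
      { unfold wt. rewrite <- tech_pow_Rmult. field.
        split; [apply pow_nonzero|]; lra. }
      pose proof (Rabs_pos (fourier g (k, b))).
      apply (Rmult_le_reg_l (1 + Rabs (IZR k))); [lra|].
      replace ((1 + Rabs (IZR k)) * ((M + 2 * C) * wt (S m) k)) with ((M + 2 * C) * wt m k) by (rewrite W; ring).
      assert (0 <= M * wt m k) by (apply Rmult_le_pos; lra). nra.
Qed.

(** * Orthogonality of the trigonometric system *)

Lemma zsum_delta (m : Z) (v : R) : zsum (fun k => if Z.eq_dec k m then v else 0) = v.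
Proof.
  set (h := fun k : Z => if Z.eq_dec k 0 then v else 0).
  assert (D : zdom (Rabs v) h).
  { intros k. unfold h. destruct (Z.eq_dec k 0) as [->|_].
    - unfold wt. rewrite Rabs_R0, Rplus_0_r, pow1, Rinv_1. lra.
    - rewrite Rabs_R0. apply Rmult_le_pos; [apply Rabs_pos|left; apply wt_pos]. }
  transitivity (zsum (fun k => h (k + - m)%Z)).
  - apply zsum_ext. intros k. unfold h. destruct Z.eq_dec, Z.eq_dec; auto; lia.
  - rewrite (zsum_shift (Rabs v) h _ D). unfold zsum.
    rewrite (Series_incr_1 _ (ex_zsum _ _ D)).
    rewrite (Series_ext _ (fun n => 0 * 0)).
    + rewrite Series_scal_l. unfold zfold, h. simpl. eqR; ring.
    + intros n. unfold zfold, h. destruct Z.eq_dec; [lia|]. destruct Z.eq_dec; [lia|]. eqR; ring.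
Qed.

Lemma RInt_cos_Z (k : Z) : RInt (fun x => cos (IZR k * x)) 0 (2 * PI) = if Z.eq_dec k 0 then 2 * PI else 0.
Proof.
  destruct Z.eq_dec as [->|Hk].
  - rewrite (RInt_ext _ (fun _ => 1)).
    + rewrite RInt_const. change scal with Rmult. eqR. ring.
    + intros x _. rewrite Rmult_0_l. apply cos_0.
  - assert (Hk0 : IZR k <> 0) by (apply not_0_IZR; exact Hk).
    assert (I : is_RInt (fun x => cos (IZR k * x)) 0 (2 * PI)
      (/ IZR k * sin (IZR k * (2 * PI)) - / IZR k * sin (IZR k * 0))).
    { apply (is_RInt_derive (V := R_CompleteNormedModule) (fun x => / IZR k * sin (IZR k * x))).
      - intros x _. auto_derive; auto. field. exact Hk0.
      - intros x _. apply continuous_cos_lin. }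
    rewrite (is_RInt_unique _ _ _ _ I). destruct (cos_sin_2kPI k) as [_ ->].
    rewrite (Rmult_0_r (IZR k)), sin_0. eqR; ring.
Qed.

Lemma RInt_sin_Z (k : Z) : RInt (fun x => sin (IZR k * x)) 0 (2 * PI) = 0.
Proof.
  destruct (Z.eq_dec k 0) as [->|Hk].
  - rewrite (RInt_ext _ (fun _ => 0)).
    + rewrite RInt_const. change scal with Rmult. eqR. ring.
    + intros x _. rewrite Rmult_0_l. apply sin_0.
  - assert (Hk0 : IZR k <> 0) by (apply not_0_IZR; exact Hk).
    assert (I : is_RInt (fun x => sin (IZR k * x)) 0 (2 * PI)
      (- / IZR k * cos (IZR k * (2 * PI)) - - / IZR k * cos (IZR k * 0))).
    { apply (is_RInt_derive (V := R_CompleteNormedModule) (fun x => - / IZR k * cos (IZR k * x))).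
      - intros x _. auto_derive; auto. field. exact Hk0.
      - intros x _. apply continuous_sin_lin. }
    rewrite (is_RInt_unique _ _ _ _ I). destruct (cos_sin_2kPI k) as [-> _].
    rewrite (Rmult_0_r (IZR k)), cos_0. eqR; ring.
Qed.

Lemma RInt_lin2 (f g : R -> R) (a b u v : R) : (forall x, continuous f x) -> (forall x, continuous g x) ->
  RInt (fun x => u * f x + v * g x) a b = u * RInt f a b + v * RInt g a b.
Proof.
  intros Cf Cg.
  rewrite (RInt_plus (V := R_CompleteNormedModule) (fun x => u * f x) (fun x => v * g x)).
  - change plus with Rplus. f_equal.
    + apply (RInt_scal (V := R_CompleteNormedModule) f). apply ex_RInt_cont, Cf.
    + apply (RInt_scal (V := R_CompleteNormedModule) g). apply ex_RInt_cont, Cg.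
  - apply ex_RInt_cont. intros x. apply continuous_mult_R; [apply continuous_const|apply Cf].
  - apply ex_RInt_cont. intros x. apply continuous_mult_R; [apply continuous_const|apply Cg].
Qed.

(** The two cases add up at k = m = 0, where the value is 2 PI. *)
Lemma RInt_cos_cos (k m : Z) : RInt (fun x => cos (IZR k * x) * cos (IZR m * x)) 0 (2 * PI) =
  (if Z.eq_dec k m then PI else 0) + (if Z.eq_dec k (- m) then PI else 0).
Proof.
  rewrite (RInt_ext _ (fun x => / 2 * cos (IZR (k - m) * x) + / 2 * cos (IZR (k + m) * x))).
  - rewrite RInt_lin2, !RInt_cos_Z by (intros; apply continuous_cos_lin).
    repeat destruct Z.eq_dec; try lia; eqR; field.
  - intros x _. rewrite minus_IZR, plus_IZR, Rmult_minus_distr_r, Rmult_plus_distr_r, cos_minus, cos_plus. eqR. field.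
Qed.

Lemma RInt_sin_sin (k m : Z) : RInt (fun x => sin (IZR k * x) * sin (IZR m * x)) 0 (2 * PI) =
  (if Z.eq_dec k m then PI else 0) - (if Z.eq_dec k (- m) then PI else 0).
Proof.
  rewrite (RInt_ext _ (fun x => / 2 * cos (IZR (k - m) * x) + - / 2 * cos (IZR (k + m) * x))).
  - rewrite RInt_lin2, !RInt_cos_Z by (intros; apply continuous_cos_lin).
    repeat destruct Z.eq_dec; try lia; eqR; field.
  - intros x _. rewrite minus_IZR, plus_IZR, Rmult_minus_distr_r, Rmult_plus_distr_r, cos_minus, cos_plus. eqR. field.
Qed.

Lemma RInt_sin_cos (k m : Z) : RInt (fun x => sin (IZR k * x) * cos (IZR m * x)) 0 (2 * PI) = 0.
Proof.
  rewrite (RInt_ext _ (fun x => / 2 * sin (IZR (k - m) * x) + / 2 * sin (IZR (k + m) * x))).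
  - rewrite RInt_lin2, !RInt_sin_Z by (intros; apply continuous_sin_lin). eqR; ring.
  - intros x _. rewrite minus_IZR, plus_IZR, Rmult_minus_distr_r, Rmult_plus_distr_r, sin_minus, sin_plus. eqR. field.
Qed.

Lemma zdom_delta (m : Z) (v : R) :
  zdom (Rabs v * (1 + Rabs (IZR m)) ^ 2) (fun k => if Z.eq_dec k m then v else 0).
Proof.
  intros k. destruct Z.eq_dec as [->|_].
  - unfold wt. rewrite Rmult_assoc, Rinv_r, Rmult_1_r; [lra|].
    apply pow_nonzero. pose proof (Rabs_pos (IZR m)). lra.
  - rewrite Rabs_R0. apply Rmult_le_pos; [|left; apply wt_pos].
    apply Rmult_le_pos; [apply Rabs_pos|apply pow2_ge_0].
Qed.

Lemma continuous_mode p k x : continuous (fun x => mode p x k) x.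
Proof.
  unfold mode. apply (continuous_plus (V := R_NormedModule)); apply continuous_mult_R;
    try apply continuous_const; [apply continuous_cos_lin|apply continuous_sin_lin].
Qed.

Lemma RInt_trig_mult C p (e : R -> R) : decay 2 C p ->
  (forall x, continuous e x) -> (forall x, Rabs (e x) <= 1) ->
  RInt (fun x => trig p x * e x) 0 (2 * PI) = zsum (fun k => RInt (fun x => mode p x k * e x) 0 (2 * PI)).
Proof.
  intros Hp Ce He. pose proof two_PI_pos.
  assert (Cm : forall k x, continuous (fun x => mode p x k * e x) x).
  { intros k x. apply continuous_mult_R; [apply continuous_mode|apply Ce]. }
  transitivity (RInt (fun x => Series (fun n => zfold (fun k => mode p x k * e x) n)) 0 (2 * PI)).
  { apply RInt_ext. intros x _. unfold trig, zsum. rewrite <- Series_scal_r. apply Series_ext.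
    intros n. unfold zfold. ring. }
  rewrite (RInt_Series (fun n x => zfold (fun k => mode p x k * e x) n) (fun n => 2 * C * zbound n)).
  - apply Series_ext. intros n. unfold zfold.
    apply (RInt_plus (V := R_CompleteNormedModule)); apply ex_RInt_cont, Cm.
  - apply (ex_series_scal (V := R_NormedModule)), ex_series_zbound.
  - intros n x. unfold zfold. apply (continuous_plus (V := R_NormedModule)); apply Cm.
  - intros n x. replace (zfold (fun k => mode p x k * e x) n) with (zfold (mode p x) n * e x) by (unfold zfold; ring).
    rewrite Rabs_mult. pose proof (zfold_bound _ _ (decay_zdom C p x Hp) n) as B.
    pose proof (Rabs_pos (zfold (mode p x) n)). pose proof (Rabs_pos (e x)). specialize (He x). nra.
  - lra.
Qed.

Lemma RInt_trig_cos C p m : decay 2 C p ->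
  RInt (fun x => trig p x * cos (IZR m * x)) 0 (2 * PI) = PI * (p (m, true) + p ((- m)%Z, true)).
Proof.
  intros Hp. rewrite (RInt_trig_mult C p (fun x => cos (IZR m * x)) Hp);
    [|intros; apply continuous_cos_lin|intros; apply Rabs_cos_le].
  transitivity (zsum (fun k => (if Z.eq_dec k m then PI * p (m, true) else 0)
      + (if Z.eq_dec k (- m) then PI * p ((- m)%Z, true) else 0))).
  - apply zsum_ext. intros k.
    rewrite (RInt_ext _ (fun x => p (k, true) * (cos (IZR k * x) * cos (IZR m * x))
                                  + p (k, false) * (sin (IZR k * x) * cos (IZR m * x)))).
    + rewrite RInt_lin2, RInt_cos_cos, RInt_sin_cos.
      * destruct (Z.eq_dec k m) as [E1|E1]; destruct (Z.eq_dec k (- m)) as [E2|E2];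
          rewrite <- ?E2, <- ?E1; eqR; ring.
      * intros x; apply continuous_mult_R; apply continuous_cos_lin.
      * intros x; apply continuous_mult_R; [apply continuous_sin_lin|apply continuous_cos_lin].
    + intros x _. unfold mode. eqR. ring.
  - rewrite (zsum_plus _ _ _ _ (zdom_delta _ _) (zdom_delta _ _)), !zsum_delta. eqR; ring.
Qed.

Lemma RInt_trig_sin C p m : decay 2 C p ->
  RInt (fun x => trig p x * sin (IZR m * x)) 0 (2 * PI) = PI * (p (m, false) - p ((- m)%Z, false)).
Proof.
  intros Hp. rewrite (RInt_trig_mult C p (fun x => sin (IZR m * x)) Hp);
    [|intros; apply continuous_sin_lin|intros; apply Rabs_sin_le].
  transitivity (zsum (fun k => (if Z.eq_dec k m then PI * p (m, false) else 0)
      + (if Z.eq_dec k (- m) then - PI * p ((- m)%Z, false) else 0))).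
  - apply zsum_ext. intros k.
    rewrite (RInt_ext _ (fun x => p (k, true) * (sin (IZR m * x) * cos (IZR k * x))
                                  + p (k, false) * (sin (IZR k * x) * sin (IZR m * x)))).
    + rewrite RInt_lin2, RInt_sin_sin, RInt_sin_cos.
      * destruct (Z.eq_dec k m) as [E1|E1]; destruct (Z.eq_dec k (- m)) as [E2|E2];
          rewrite <- ?E2, <- ?E1; eqR; ring.
      * intros x; apply continuous_mult_R; [apply continuous_sin_lin|apply continuous_cos_lin].
      * intros x; apply continuous_mult_R; apply continuous_sin_lin.
    + intros x _. unfold mode. eqR. ring.
  - rewrite (zsum_plus _ _ _ _ (zdom_delta _ _) (zdom_delta _ _)), !zsum_delta. eqR; ring.
Qed.

Lemma fourier_sym g m : (forall x, continuous g x) ->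
  fourier g ((- m)%Z, true) = fourier g (m, true) /\ fourier g ((- m)%Z, false) = - fourier g (m, false).
Proof.
  intros Hc. cbn [fourier]. split.
  - f_equal. apply RInt_ext. intros x _. rewrite opp_IZR, Ropp_mult_distr_l_reverse, cos_neg. reflexivity.
  - rewrite Ropp_mult_distr_r. f_equal.
    transitivity (RInt (fun x => opp (g x * sin (IZR m * x))) 0 (2 * PI)).
    + apply RInt_ext. intros x _. rewrite opp_IZR, Ropp_mult_distr_l_reverse, sin_neg. change opp with Ropp. eqR. ring.
    + apply (RInt_opp (V := R_CompleteNormedModule)). apply ex_RInt_cont. intros x.
      apply continuous_mult_R; [apply Hc|apply continuous_sin_lin].
Qed.

(** * Completeness of the trigonometric system *)

Section Completeness.

Variable h : R -> R.
Hypothesis h_cont : forall x, continuous h x.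
Hypothesis h_cos : forall k, RInt (fun x => h x * cos (IZR k * x)) 0 (2 * PI) = 0.
Hypothesis h_sin : forall k, RInt (fun x => h x * sin (IZR k * x)) 0 (2 * PI) = 0.

Definition bump (x0 x : R) : R := 1 + cos (x - x0).

Lemma bump_cont x0 n x : continuous (fun x => bump x0 x ^ n) x.
Proof. unfold bump. eapply continuous_of_derive. auto_derive; auto. Qed.

(** Multiplication by 1 + cos (x - x0) only mixes frequencies k - 1, k and k + 1, so orthogonality
    to all modes survives every power. *)
Lemma orthogonal_bump x0 n : forall k,
  RInt (fun x => (h x * bump x0 x ^ n) * cos (IZR k * x)) 0 (2 * PI) = 0 /\
  RInt (fun x => (h x * bump x0 x ^ n) * sin (IZR k * x)) 0 (2 * PI) = 0.
Proof.
  induction n as [|n IH].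
  - intros k. split; [etransitivity; [|apply (h_cos k)]|etransitivity; [|apply (h_sin k)]].
    + apply RInt_ext; intros x _; simpl; eqR; ring.
    + apply RInt_ext; intros x _; simpl; eqR; ring.
  - set (w := fun x => h x * bump x0 x ^ n).
    assert (Cw : forall x, continuous w x).
    { intros x. apply continuous_mult_R; [apply h_cont|apply bump_cont]. }
    assert (Cc : forall k x, continuous (fun x => cos (IZR k * x)) x) by (intros; apply continuous_cos_lin).
    assert (Cs : forall k x, continuous (fun x => sin (IZR k * x)) x) by (intros; apply continuous_sin_lin).
    intros k. destruct (IH k) as [I1 I2]. destruct (IH (k + 1)%Z) as [I3 I4]. destruct (IH (k - 1)%Z) as [I5 I6].
    fold w in I1, I2, I3, I4, I5, I6. split.
    + rewrite (RInt_ext _ (fun x => 1 * (w x * cos (IZR k * x)) + 1 *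
         (1 * (cos x0 / 2 * (w x * cos (IZR (k + 1) * x)) + cos x0 / 2 * (w x * cos (IZR (k - 1) * x)))
          + 1 * (sin x0 / 2 * (w x * sin (IZR (k + 1) * x)) + - sin x0 / 2 * (w x * sin (IZR (k - 1) * x)))))).
      * rewrite !RInt_lin2 by (intros x; cont_tac).
        change (RInt (fun x => w x * cos (IZR k * x)) 0 (2 * PI) = 0) in I1.
        change (RInt (fun x => w x * cos (IZR (k + 1) * x)) 0 (2 * PI) = 0) in I3.
        change (RInt (fun x => w x * cos (IZR (k - 1) * x)) 0 (2 * PI) = 0) in I5.
        change (RInt (fun x => w x * sin (IZR (k + 1) * x)) 0 (2 * PI) = 0) in I4.
        change (RInt (fun x => w x * sin (IZR (k - 1) * x)) 0 (2 * PI) = 0) in I6.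
        rewrite I1, I3, I4, I5, I6. eqR; ring.
      * intros x _. unfold w. rewrite minus_IZR, plus_IZR, Rmult_minus_distr_r, Rmult_plus_distr_r, (Rmult_1_l x).
        rewrite <- tech_pow_Rmult. unfold bump at 1.
        rewrite !cos_minus, !cos_plus, !sin_minus, !sin_plus. eqR. field.
    + rewrite (RInt_ext _ (fun x => 1 * (w x * sin (IZR k * x)) + 1 *
         (1 * (cos x0 / 2 * (w x * sin (IZR (k + 1) * x)) + cos x0 / 2 * (w x * sin (IZR (k - 1) * x)))
          + 1 * (- sin x0 / 2 * (w x * cos (IZR (k + 1) * x)) + sin x0 / 2 * (w x * cos (IZR (k - 1) * x)))))).
      * rewrite !RInt_lin2 by (intros x; cont_tac).
        change (RInt (fun x => w x * sin (IZR k * x)) 0 (2 * PI) = 0) in I2.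
        change (RInt (fun x => w x * cos (IZR (k + 1) * x)) 0 (2 * PI) = 0) in I3.
        change (RInt (fun x => w x * cos (IZR (k - 1) * x)) 0 (2 * PI) = 0) in I5.
        change (RInt (fun x => w x * sin (IZR (k + 1) * x)) 0 (2 * PI) = 0) in I4.
        change (RInt (fun x => w x * sin (IZR (k - 1) * x)) 0 (2 * PI) = 0) in I6.
        rewrite I2, I3, I4, I5, I6. eqR; ring.
      * intros x _. unfold w. rewrite minus_IZR, plus_IZR, Rmult_minus_distr_r, Rmult_plus_distr_r, (Rmult_1_l x).
        rewrite <- tech_pow_Rmult. unfold bump at 1.
        rewrite !cos_minus, !cos_plus, !sin_minus, !sin_plus. eqR. field.
Qed.

Hypothesis h_per : space_periodic h.

Lemma RInt_period (g : R -> R) (a : R) : (forall x, continuous g x) -> space_periodic g ->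
  RInt g a (a + 2 * PI) = RInt g 0 (2 * PI).
Proof.
  intros Hc Hp. rewrite <- (RInt_shift g a Hc Hp).
  transitivity (RInt (fun y => scal 1 (g (1 * y + a))) 0 (2 * PI)).
  - rewrite (RInt_comp_lin (V := R_CompleteNormedModule)) by (apply ex_RInt_cont, Hc).
    f_equal; ring.
  - apply RInt_ext. intros x _. change scal with Rmult. rewrite !Rmult_1_l. reflexivity.
Qed.

(* The powers of [bump x0] concentrate at [x0]. *)
Lemma orthogonal_nonpos (x0 : R) : h x0 <= 0.
Proof.
  apply Rnot_lt_le. intros Hpos. pose proof PI_RGT_0 as HPI.
  destruct (periodic_continuous_bounded h h_cont h_per) as [M [HM HB]].
  assert (Hd : 0 < h x0 / 2) by lra.
  destruct (proj1 (filterlim_locally _ _) (h_cont x0) (mkposreal _ Hd)) as [e He].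
  set (eta := Rmin (e / 2) (PI / 2)).
  assert (Heta : 0 < eta) by (apply Rmin_glb_lt; [pose proof (cond_pos e)|]; lra).
  assert (Heta1 : eta < e) by (pose proof (Rmin_l (e / 2) (PI / 2)); pose proof (cond_pos e); unfold eta; lra).
  assert (Heta2 : eta <= PI / 2) by apply Rmin_r.
  assert (Hnear : forall x, Rabs (x - x0) <= eta -> h x0 / 2 <= h x).
  { intros x Hx. assert (A : Rabs (h x - h x0) < h x0 / 2).
    { apply He. apply Rle_lt_trans with eta; assumption. }
    apply Rabs_def2 in A. lra. }
  (* [h] is positive up to distance [eta]. Negative contributions therefore occur only where [bump]
     is at most [r], while within eta / 2 it is at least [r'], which is larger. *)
  set (r := 1 + cos eta). set (r' := 1 + cos (eta / 2)).
  assert (Hr : 1 <= r) by (pose proof (cos_ge_0 eta); unfold r; lra).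
  assert (Hrr : r < r').
  { unfold r, r'. assert (cos eta < cos (eta / 2)) by (apply cos_decreasing_1; lra). lra. }
  assert (Hcos : forall y, 0 <= y <= PI -> forall z, 0 <= z <= PI -> y <= z -> cos z <= cos y).
  { intros y Hy z Hz Hyz. apply cos_decr_1; lra. }
  assert (Heven : forall x, cos (x - x0) = cos (Rabs (x - x0))).
  { intros x. unfold Rabs. destruct Rcase_abs; [rewrite cos_neg|]; reflexivity. }
  assert (Hb0 : forall x, 0 <= bump x0 x) by (intros x; pose proof (COS_bound (x - x0)); unfold bump; lra).
  set (F := fun n x => h x * bump x0 x ^ n).
  assert (CF : forall n x, continuous (F n) x).
  { intros n x. apply continuous_mult_R; [apply h_cont|apply bump_cont]. }
  assert (Zero : forall n, RInt (F n) 0 (2 * PI) = 0).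
  { intros n. etransitivity; [|apply (proj1 (orthogonal_bump x0 n 0%Z))]. apply RInt_ext. intros x _.
    rewrite Rmult_0_l, cos_0, Rmult_1_r. reflexivity. }
  assert (PerF : forall n, space_periodic (F n)).
  { intros n x. unfold F, bump. rewrite h_per. replace (x + 2 * PI - x0) with (x - x0 + 2 * INR 1 * PI) by (simpl; ring).
    rewrite cos_period. reflexivity. }
  assert (Bin : forall n x, x0 - eta / 2 <= x <= x0 + eta / 2 -> h x0 / 2 * r' ^ n <= F n x).
  { intros n x Hx. unfold F.
    assert (Ax : Rabs (x - x0) <= eta / 2) by (apply Rabs_le; lra).
    assert (A1 := Hnear x ltac:(lra)).
    apply Rmult_le_compat; [lra|apply pow_le; lra|exact A1|].
    apply pow_incr. split; [lra|]. unfold r', bump. rewrite Heven.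
    pose proof (Rabs_pos (x - x0)).
    assert (cos (eta / 2) <= cos (Rabs (x - x0))) by (apply Hcos; lra). lra. }
  assert (Bout : forall n x, x0 - PI <= x <= x0 + PI -> eta / 2 <= Rabs (x - x0) -> - M * r ^ n <= F n x).
  { intros n x Hx Hfar. unfold F.
    assert (0 <= r ^ n) by (apply pow_le; lra).
    assert (0 <= bump x0 x ^ n) by (apply pow_le, Hb0).
    destruct (Rle_dec (Rabs (x - x0)) eta) as [Hin|Hout].
    - assert (A1 := Hnear x Hin).
      assert (0 <= h x * bump x0 x ^ n) by (apply Rmult_le_pos; lra).
      assert (0 <= M * r ^ n) by (apply Rmult_le_pos; lra). lra.
    - assert (bump x0 x ^ n <= r ^ n).
      { apply pow_incr. split; [apply Hb0|]. unfold r, bump. rewrite Heven.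
        assert (Rabs (x - x0) <= PI) by (apply Rabs_le; lra).
        assert (cos (Rabs (x - x0)) <= cos eta) by (apply Hcos; lra). lra. }
      assert (A := HB x). apply Rabs_le_between in A. nra. }
  (* The integral over a period vanishes: the inner interval contributes at least the left side and
     the rest at least minus the right side. The growth of (r' / r)^n then contradicts this. *)
  assert (Main : forall n, eta * (h x0 / 2) * r' ^ n <= 2 * PI * M * r ^ n).
  { intros n.
    assert (E : RInt (F n) (x0 - PI) (x0 + PI) = 0).
    { replace (x0 + PI) with (x0 - PI + 2 * PI) by ring. rewrite RInt_period; auto. }
    assert (Hex : forall u v, ex_RInt (F n) u v) by (intros; apply ex_RInt_cont, CF).
    rewrite <- (RInt_Chasles (F n) (x0 - PI) (x0 - eta / 2) (x0 + PI)) in E by apply Hex.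
    rewrite <- (RInt_Chasles (F n) (x0 - eta / 2) (x0 + eta / 2) (x0 + PI)) in E by apply Hex.
    change plus with Rplus in E.
    assert (LB : forall u v k, u <= v -> (forall x, u <= x <= v -> k <= F n x) -> (v - u) * k <= RInt (F n) u v).
    { intros u v k Huv Hk. replace ((v - u) * k) with (RInt (fun _ => k) u v).
      - apply RInt_le; [exact Huv|apply ex_RInt_const|apply Hex|]. intros x Hx. apply Hk. lra.
      - rewrite RInt_const. reflexivity. }
    assert (L1 := LB (x0 - PI) (x0 - eta / 2) (- M * r ^ n) ltac:(lra)).
    assert (L2 := LB (x0 - eta / 2) (x0 + eta / 2) (h x0 / 2 * r' ^ n) ltac:(lra) (fun x Hx => Bin n x Hx)).
    assert (L3 := LB (x0 + eta / 2) (x0 + PI) (- M * r ^ n) ltac:(lra)).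
    assert (P1 : (x0 - eta / 2 - (x0 - PI)) * (- M * r ^ n) <= RInt (F n) (x0 - PI) (x0 - eta / 2)).
    { apply L1. intros x Hx. apply Bout; [lra|]. rewrite Rabs_left1; lra. }
    assert (P3 : (x0 + PI - (x0 + eta / 2)) * (- M * r ^ n) <= RInt (F n) (x0 + eta / 2) (x0 + PI)).
    { apply L3. intros x Hx. apply Bout; [lra|]. rewrite Rabs_pos_eq; lra. }
    assert (0 <= M * r ^ n) by (apply Rmult_le_pos; [lra|apply pow_le; lra]). 
    assert (0 <= eta * (M * r ^ n)) by (apply Rmult_le_pos; lra). nra. }
  assert (Hq : 1 < r' / r).
  { apply (Rmult_lt_reg_r r); [lra|]. unfold Rdiv. rewrite Rmult_assoc, Rinv_l; lra. }
  assert (Hq' : Rabs (r' / r) > 1) by (rewrite Rabs_pos_eq; lra).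
  assert (Hc : 0 < eta * (h x0 / 2)) by (apply Rmult_lt_0_compat; lra).
  destruct (Pow_x_infinity _ Hq' (2 * PI * M / (eta * (h x0 / 2)) + 1)) as [N HN].
  specialize (HN N (le_n N)). rewrite Rabs_pos_eq in HN by (apply pow_le; lra).
  specialize (Main N).
  assert (Hrn : 0 < r ^ N) by (apply pow_lt; lra).
  assert (Ep : (r' / r) ^ N = r' ^ N / r ^ N).
  { unfold Rdiv. rewrite Rpow_mult_distr, pow_inv. reflexivity. }
  rewrite Ep in HN.
  assert (r' ^ N / r ^ N <= 2 * PI * M / (eta * (h x0 / 2))).
  { apply (Rmult_le_reg_r (r ^ N)); [exact Hrn|].
    replace (r' ^ N / r ^ N * r ^ N) with (r' ^ N) by (field; lra).
    apply (Rmult_le_reg_l (eta * (h x0 / 2))); [exact Hc|].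
    replace (eta * (h x0 / 2) * (2 * PI * M / (eta * (h x0 / 2)) * r ^ N)) with (2 * PI * M * r ^ N);
      [exact Main|field; lra]. }
  lra.
Qed.

End Completeness.

Lemma fourier_complete h : (forall x, continuous h x) -> space_periodic h ->
  (forall k, RInt (fun x => h x * cos (IZR k * x)) 0 (2 * PI) = 0) ->
  (forall k, RInt (fun x => h x * sin (IZR k * x)) 0 (2 * PI) = 0) ->
  forall x, h x = 0.
Proof.
  intros Hc Hp H1 H2 x. apply Rle_antisym; [apply orthogonal_nonpos; auto|].
  assert (Hopp : forall e : R -> R, (forall x, continuous e x) -> RInt (fun x => h x * e x) 0 (2 * PI) = 0 ->
    RInt (fun x => - h x * e x) 0 (2 * PI) = 0).
  { intros e Ce He. rewrite (RInt_ext _ (fun x => opp (h x * e x))).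
    - rewrite (RInt_opp (V := R_CompleteNormedModule)), He; [apply Ropp_0|].
      apply ex_RInt_cont. intros y. apply continuous_mult_R; auto.
    - intros y _. change opp with Ropp. eqR. ring. }
  assert (- h x <= 0); [|lra].
  apply (orthogonal_nonpos (fun x => - h x)).
  - intros y. apply (continuous_opp (V := R_NormedModule)), Hc.
  - intros k. apply (Hopp (fun x => cos (IZR k * x))); [intros; apply continuous_cos_lin|apply H1].
  - intros k. apply (Hopp (fun x => sin (IZR k * x))); [intros; apply continuous_sin_lin|apply H2].
  - intros y. rewrite Hp. reflexivity.
Qed.

Lemma trig_continuous C p x : decay 2 C p -> continuous (trig p) x.
Proof.
  intros Hp.
  assert (J : jcont (fun _ => True) (fun t x => trig p (x - 0 * t))).
  { apply (jcont_trig (fun _ => True) 0 (fun _ => p)).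
    - intros t _. exists C, (mkposreal 1 Rlt_0_1). auto.
    - intros i t _. apply filterlim_const. }
  apply (continuous_ext (fun x => trig p (x - 0 * 0))).
  - intros y. f_equal. ring.
  - apply (jcont_slice _ _ J 0 x I).
Qed.

(** Both functions have the same integrals against every mode: the equal contributions of m and - m,
    each with factor PI, undo the factor 1 / (2 PI). Completeness concludes. *)
Lemma trig_fourier C g : (forall x, continuous g x) -> space_periodic g ->
  decay 2 C (fourier g) -> forall x, trig (fourier g) x = g x.
Proof.
  intros Hc Hp Hd x. apply Rminus_diag_uniq. pose proof two_PI_pos as HP.
  assert (Ct : forall x, continuous (trig (fourier g)) x) by (intros; eapply trig_continuous, Hd).
  apply (fourier_complete (fun x => trig (fourier g) x - g x)).
  - intros y. apply (continuous_minus (V := R_NormedModule)); auto.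
  - intros y. rewrite trig_periodic, Hp. reflexivity.
  - intros k. rewrite (RInt_ext _ (fun x => 1 * (trig (fourier g) x * cos (IZR k * x)) + -1 * (g x * cos (IZR k * x)))).
    + rewrite RInt_lin2, (RInt_trig_cos C) by (auto; intros; apply continuous_mult_R; auto; apply continuous_cos_lin).
      destruct (fourier_sym g k Hc) as [-> _]. cbn [fourier]. eqR; field. lra.
    + intros y _. eqR. ring.
  - intros k. rewrite (RInt_ext _ (fun x => 1 * (trig (fourier g) x * sin (IZR k * x)) + -1 * (g x * sin (IZR k * x)))).
    + rewrite RInt_lin2, (RInt_trig_sin C) by (auto; intros; apply continuous_mult_R; auto; apply continuous_sin_lin).
      destruct (fourier_sym g k Hc) as [_ ->]. cbn [fourier]. eqR; field. lra.
    + intros y _. eqR. ring.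
Qed.

(** * Energy estimates *)

(** The precision matters: 2 PI^2 / 3 has to lie below 7, and 28 PI / 6 below 15. *)
Lemma PI_lt_3_2 : PI < 3.2.
Proof.
  destruct (PI_2_3_7_ineq 1) as [_ H].
  unfold PI_2_3_7_tg, tg_alt, Ratan_seq in H. simpl in H. lra.
Qed.

Lemma RInt_le_cont (f g : R -> R) (a b : R) : a <= b -> (forall x, continuous f x) ->
  (forall x, continuous g x) -> (forall x, a <= x <= b -> f x <= g x) -> RInt f a b <= RInt g a b.
Proof.
  intros Hab Cf Cg H. apply RInt_le; auto using ex_RInt_cont. intros x Hx. apply H. lra.
Qed.

Lemma RInt_nonneg_cont (f : R -> R) (a b : R) : a <= b -> (forall x, continuous f x) ->
  (forall x, a <= x <= b -> 0 <= f x) -> 0 <= RInt f a b.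
Proof.
  intros Hab Cf H. apply RInt_ge_0; auto using ex_RInt_cont. intros x Hx. apply H. lra.
Qed.

Lemma cauchy_schwarz (f g : R -> R) (a b : R) : a <= b -> (forall x, continuous f x) ->
  (forall x, continuous g x) ->
  RInt (fun x => f x * g x) a b * RInt (fun x => f x * g x) a b
  <= RInt (fun x => f x * f x) a b * RInt (fun x => g x * g x) a b.
Proof.
  intros Hab Cf Cg.
  set (U := RInt (fun x => f x * f x) a b). set (V := RInt (fun x => f x * g x) a b).
  set (W := RInt (fun x => g x * g x) a b).
  assert (P : forall l, 0 <= U - 2 * l * V + l * l * W).
  { intros l.
    replace (U - 2 * l * V + l * l * W) with (RInt (fun x => (f x - l * g x) * (f x - l * g x)) a b).
    - apply RInt_nonneg_cont; [exact Hab|intros x; cont_tac|intros x _; apply Rle_0_sqr].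
    - rewrite (RInt_ext _ (fun x => 1 * (1 * (f x * f x) + (- 2 * l) * (f x * g x)) + (l * l) * (g x * g x))).
      + rewrite !RInt_lin2; [fold U V W; eqR; ring|..]; intros x; cont_tac.
      + intros x _. eqR. ring. }
  assert (HW : 0 <= W) by (apply RInt_nonneg_cont; [exact Hab|intros x; cont_tac|intros x _; apply Rle_0_sqr]).
  destruct (Rle_lt_or_eq_dec 0 W HW) as [Hp|Hz].
  - specialize (P (V / W)). apply Rmult_le_compat_r with (r := W) in P; [|exact HW].
    replace ((U - 2 * (V / W) * V + V / W * (V / W) * W) * W) with (U * W - V * V) in P by (field; lra). lra.
  - assert (V = 0).
    { rewrite <- Hz in P. apply NNPP. intros HV.
      (* When [W] is 0 the quadratic is affine in [l]; this value makes it equal to -1. *)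
      specialize (P ((U + 1) / (2 * V))).
      replace (U - 2 * ((U + 1) / (2 * V)) * V + (U + 1) / (2 * V) * ((U + 1) / (2 * V)) * 0) with (-1) in P by (field; exact HV).
      lra. }
    rewrite H, <- Hz. lra.
Qed.

Lemma RInt_derive_periodic (H h : R -> R) : (forall x, is_derive H x (h x)) ->
  (forall x, continuous h x) -> space_periodic H -> RInt h 0 (2 * PI) = 0.
Proof.
  intros HD Hc Hp.
  rewrite (is_RInt_unique _ _ _ _ (is_RInt_derive (V := R_CompleteNormedModule) H h 0 (2 * PI)
     (fun x _ => HD x) (fun x _ => Hc x))).
  replace (H (2 * PI)) with (H 0) by (rewrite <- (Hp 0); f_equal; ring).
  change minus with Rminus. eqR. ring.
Qed.

(** All integrations by parts of an energy identity are done at once by exhibiting the periodic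
    function [H] whose derivative is the difference. *)
Lemma RInt_eq_mod_exact (f g H : R -> R) : (forall x, continuous f x) -> (forall x, continuous g x) ->
  (forall x, is_derive H x (f x - g x)) -> space_periodic H ->
  RInt f 0 (2 * PI) = RInt g 0 (2 * PI).
Proof.
  intros Cf Cg HD Hp. apply Rminus_diag_uniq.
  etransitivity; [|apply (RInt_derive_periodic H (fun x => f x - g x) HD); [intros x; cont_tac|exact Hp]].
  symmetry. apply (RInt_minus (V := R_CompleteNormedModule)); apply ex_RInt_cont; auto.
Qed.

(* Sawtooth representation: [2 PI w x] is the integral of [(z - PI) w' (x + z)]. *)
Lemma sobolev_mean_zero (w w' : R -> R) : (forall x, is_derive w x (w' x)) ->
  (forall x, continuous w' x) -> space_periodic w -> RInt w 0 (2 * PI) = 0 ->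
  forall x, w x * w x <= PI / 6 * RInt (fun y => w' y * w' y) 0 (2 * PI).
Proof.
  intros Hd Hc Hp H0 x. pose proof PI_RGT_0 as HPI.
  assert (Cw : forall x, continuous w x) by (intros; eapply continuous_of_derive, Hd).
  assert (Ds : forall z, is_derive (fun z => w (z + x)) z (w' (z + x))).
  { intros z. evar_last.
    - apply (is_derive_comp w (fun z => z + x) z (w' (z + x)) 1); [apply Hd|]. auto_derive; auto.
    - change scal with Rmult. eqR. ring. }
  assert (Cs : forall z, continuous (fun z => w' (z + x)) z).
  { intros z. apply (continuous_comp (fun z => z + x) w'); [|apply Hc].
    eapply continuous_of_derive. auto_derive; auto. }
  assert (Ci : forall z, continuous (fun z => z - PI) z).
  { intros z. eapply continuous_of_derive. auto_derive; auto. }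
  assert (E : RInt (fun z => (z - PI) * w' (z + x)) 0 (2 * PI) = 2 * PI * w x).
  { rewrite (RInt_by_parts (fun z => z - PI) (fun _ => 1) (fun z => w (z + x)) (fun z => w' (z + x))); auto.
    - rewrite (RInt_ext (fun z => 1 * w (z + x)) (fun z => w (z + x))) by (intros; eqR; ring).
      rewrite RInt_shift, H0 by assumption.
      replace (2 * PI + x) with (x + 2 * PI) by ring. rewrite Hp, Rplus_0_l. eqR. ring.
    - intros z. auto_derive; auto.
    - intros z. apply continuous_const. }
  assert (S := cauchy_schwarz (fun z => z - PI) (fun z => w' (z + x)) 0 (2 * PI) ltac:(lra) Ci Cs).
  cbv beta in S. rewrite E in S.
  (* Divided by (2 PI)^2, this integral gives the constant PI / 6. *)
  assert (I1 : RInt (fun z => (z - PI) * (z - PI)) 0 (2 * PI) = 2 * PI ^ 3 / 3).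
  { rewrite (is_RInt_unique _ _ _ _ (is_RInt_derive (V := R_CompleteNormedModule) (fun z => (z - PI) ^ 3 / 3)
      (fun z => (z - PI) * (z - PI)) 0 (2 * PI) ltac:(intros; auto_derive; auto; field) ltac:(intros; cont_tac))).
    change minus with Rminus. eqR. field. }
  rewrite I1 in S.
  rewrite (RInt_shift (fun z => w' z * w' z) x) in S.
  - set (D := RInt (fun y => w' y * w' y) 0 (2 * PI)) in *.
    assert (Hpp : 0 < 4 * PI ^ 2) by (apply Rmult_lt_0_compat; [lra|apply pow_lt, HPI]).
    apply (Rmult_le_reg_l (4 * PI ^ 2)); [exact Hpp|].
    replace (4 * PI ^ 2 * (w x * w x)) with (2 * PI * w x * (2 * PI * w x)) by ring.
    replace (4 * PI ^ 2 * (PI / 6 * D)) with (2 * PI ^ 3 / 3 * D) by field. exact S.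
  - intros z. cont_tac.
  - intros z. rewrite (derive_periodic w w' Hd Hp). reflexivity.
Qed.

(** Obtained by integrating the pointwise bound over a period; the constant PI^2 / 3 is not the
    sharp one, 1, but suffices. *)
Lemma poincare_mean_zero (w w' : R -> R) : (forall x, is_derive w x (w' x)) ->
  (forall x, continuous w' x) -> space_periodic w -> RInt w 0 (2 * PI) = 0 ->
  RInt (fun x => w x * w x) 0 (2 * PI) <= PI ^ 2 / 3 * RInt (fun y => w' y * w' y) 0 (2 * PI).
Proof.
  intros Hd Hc Hp H0. pose proof PI_RGT_0 as HPI.
  assert (Cw : forall x, continuous w x) by (intros; eapply continuous_of_derive, Hd).
  set (D := RInt (fun y => w' y * w' y) 0 (2 * PI)).
  replace (PI ^ 2 / 3 * D) with (RInt (fun _ => PI / 6 * D) 0 (2 * PI)).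
  - apply RInt_le_cont; [lra|intros x; cont_tac|intros x; cont_tac|].
    intros x _. apply sobolev_mean_zero; assumption.
  - rewrite RInt_const. change scal with Rmult. eqR. field.
Qed.

(** The convection term integrates to zero, the viscous term gives - 4 int u_x^2, and the forcing
    becomes - 2 int F u_x, so that the size of the primitive [F] is what counts. *)
Lemma energy_rate (u u1 u2 F f : R -> R) (c : R) :
  (forall x, is_derive u x (u1 x)) -> (forall x, is_derive u1 x (u2 x)) ->
  (forall x, is_derive F x (f x)) -> (forall x, continuous u2 x) -> (forall x, continuous f x) ->
  space_periodic u -> space_periodic F -> RInt (fun x => u x - c) 0 (2 * PI) = 0 ->
  RInt (fun x => 2 * (u x - c) * (f x - u x * u1 x + 2 * u2 x)) 0 (2 * PI)
  <= - (6 / PI ^ 2) * RInt (fun x => (u x - c) * (u x - c)) 0 (2 * PI)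
     + / 2 * RInt (fun x => F x * F x) 0 (2 * PI).
Proof.
  intros Du Du1 DF Cu2 Cf Pu PF H0. pose proof PI_RGT_0 as HPI.
  assert (Cu : forall x, continuous u x) by (intros; eapply continuous_of_derive, Du).
  assert (Cu1 : forall x, continuous u1 x) by (intros; eapply continuous_of_derive, Du1).
  assert (CF : forall x, continuous F x) by (intros; eapply continuous_of_derive, DF).
  assert (Pu1 := derive_periodic _ _ Du Pu).
  rewrite (RInt_eq_mod_exact _ (fun x => -4 * (u1 x * u1 x) + -2 * (F x * u1 x))
    (fun x => 4 * ((u x - c) * u1 x) + 2 * ((u x - c) * F x) - 2 / 3 * u x ^ 3 + c * u x ^ 2)).
  - set (D := RInt (fun x => u1 x * u1 x) 0 (2 * PI)).
    assert (B1 : RInt (fun x => -4 * (u1 x * u1 x) + -2 * (F x * u1 x)) 0 (2 * PI)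
      <= RInt (fun x => -2 * (u1 x * u1 x) + / 2 * (F x * F x)) 0 (2 * PI)).
    (* Young's inequality keeps half of the dissipation for the Poincare inequality. *)
    { apply RInt_le_cont; [lra|intros x; cont_tac|intros x; cont_tac|]. intros x _.
      pose proof (Rle_0_sqr (2 * u1 x + F x)). unfold Rsqr in *. lra. }
    rewrite (RInt_lin2 (fun x => u1 x * u1 x) (fun x => F x * F x)) in B1 by (intros x; cont_tac).
    fold D in B1.
    assert (B2 := poincare_mean_zero (fun x => u x - c) u1).
    assert (B3 : RInt (fun x => (u x - c) * (u x - c)) 0 (2 * PI) <= PI ^ 2 / 3 * D).
    { apply B2; auto.
      - intros x. rewrite <- (Rminus_0_r (u1 x)). apply is_derive_minus_R; [apply Du|apply (is_derive_const (V := R_NormedModule))].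
      - intros x. rewrite Pu. reflexivity. }
    assert (Hp2 : 0 < PI ^ 2) by (apply pow_lt, HPI).
    assert (B4 : 6 / PI ^ 2 * RInt (fun x => (u x - c) * (u x - c)) 0 (2 * PI) <= 2 * D).
    { replace (2 * D) with (6 / PI ^ 2 * (PI ^ 2 / 3 * D)) by (field; lra).
      apply Rmult_le_compat_l; [|exact B3]. apply Rmult_le_pos; [lra|left; apply Rinv_0_lt_compat, Hp2]. }
    lra.
  - intros x; cont_tac.
  - intros x; cont_tac.
  - intros x. specialize (Du x). specialize (Du1 x). specialize (DF x).
    auto_derive.
    + repeat split; eexists; eassumption.
    + assert (E : Derive (fun y => u y) x = u1 x) by exact (is_derive_unique _ _ _ Du).
      assert (E1 : Derive (fun y => u1 y) x = u2 x) by exact (is_derive_unique _ _ _ Du1).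
      assert (E2 : Derive (fun y => F y) x = f x) by exact (is_derive_unique _ _ _ DF).
      rewrite E, E1, E2. field.
  - intros x. rewrite Pu, Pu1, PF. reflexivity.
Qed.

(** With w = u - v, the convection terms leave int w_x w (u + v); subtracting 2 c from u + v changes
    only an exact derivative and makes both factors of [s] controllable by the energies.
    Cauchy-Schwarz then compares with 4 int w_x^2. *)
Lemma difference_rate (u u1 u2 v v1 v2 f : R -> R) (c : R) :
  (forall x, is_derive u x (u1 x)) -> (forall x, is_derive u1 x (u2 x)) ->
  (forall x, is_derive v x (v1 x)) -> (forall x, is_derive v1 x (v2 x)) ->
  (forall x, continuous u2 x) -> (forall x, continuous v2 x) -> (forall x, continuous f x) ->
  space_periodic u -> space_periodic v -> 
  RInt (fun x => u x - v x) 0 (2 * PI) = 0 ->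
  RInt (fun x => (u x - c) * (u x - c)) 0 (2 * PI) <= 7 ->
  RInt (fun x => (v x - c) * (v x - c)) 0 (2 * PI) <= 7 ->
  RInt (fun x => 2 * (u x - v x) * ((f x - u x * u1 x + 2 * u2 x) - (f x - v x * v1 x + 2 * v2 x))) 0 (2 * PI)
  <= - (1 / 50) * RInt (fun x => (u x - v x) * (u x - v x)) 0 (2 * PI).
Proof.
  intros Du Du1 Dv Dv1 Cu2 Cv2 Cf Pu Pv H0 HEu HEv. pose proof PI_RGT_0 as HPI. pose proof PI_lt_3_2 as HPI'.
  assert (Cu : forall x, continuous u x) by (intros; eapply continuous_of_derive, Du).
  assert (Cu1 : forall x, continuous u1 x) by (intros; eapply continuous_of_derive, Du1).
  assert (Cv : forall x, continuous v x) by (intros; eapply continuous_of_derive, Dv).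
  assert (Cv1 : forall x, continuous v1 x) by (intros; eapply continuous_of_derive, Dv1).
  assert (Pu1 := derive_periodic _ _ Du Pu). assert (Pv1 := derive_periodic _ _ Dv Pv).
  set (w := fun x => u x - v x). set (w1 := fun x => u1 x - v1 x).
  set (s := fun x => (u x - c) + (v x - c)).
  assert (Cw : forall x, continuous w x) by (intros x; unfold w; cont_tac).
  assert (Cw1 : forall x, continuous w1 x) by (intros x; unfold w1; cont_tac).
  assert (Cs : forall x, continuous s x) by (intros x; unfold s; cont_tac).
  assert (Dw : forall x, is_derive w x (w1 x)) by (intros x; apply is_derive_minus_R; auto).
  assert (Pw : space_periodic w) by (intros x; unfold w; rewrite Pu, Pv; reflexivity).
  set (D := RInt (fun x => w1 x * w1 x) 0 (2 * PI)).
  assert (HD : 0 <= D) by (apply RInt_nonneg_cont; [lra|intros x; cont_tac|intros x _; apply Rle_0_sqr]).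
  rewrite (RInt_eq_mod_exact _ (fun x => -4 * (w1 x * w1 x) + 1 * (w1 x * (w x * s x)))
    (fun x => 4 * ((u x - v x) * (u1 x - v1 x)) - (u x + v x) * (u x - v x) ^ 2 + c * (u x - v x) ^ 2)).
  - rewrite RInt_lin2 by (intros x; cont_tac). fold D.
    set (X := RInt (fun x => w1 x * (w x * s x)) 0 (2 * PI)).
    assert (S2 : RInt (fun x => s x * s x) 0 (2 * PI) <= 28).
    { eapply Rle_trans; [apply (RInt_le_cont _ (fun x => 2 * ((u x - c) * (u x - c)) + 2 * ((v x - c) * (v x - c))))|].
      - lra.
      - intros x; cont_tac.
      - intros x; cont_tac.
      - intros x _. unfold s. pose proof (Rle_0_sqr ((u x - c) - (v x - c))). unfold Rsqr in *. lra.
      - rewrite RInt_lin2 by (intros x; cont_tac). lra. }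
    (* The sup bound for [w] gives 28 PI / 6, which is less than 15. *)
    assert (W2 : RInt (fun x => (w x * s x) * (w x * s x)) 0 (2 * PI) <= 15 * D).
    { eapply Rle_trans; [apply (RInt_le_cont _ (fun x => (PI / 6 * D) * (s x * s x) + 0 * (s x * s x)))|].
      - lra.
      - intros x; cont_tac.
      - intros x; cont_tac.
      - intros x _. assert (Sb := sobolev_mean_zero w w1 Dw Cw1 Pw H0 x). fold D in Sb.
        replace (w x * s x * (w x * s x)) with ((w x * w x) * (s x * s x)) by ring.
        rewrite Rmult_0_l, Rplus_0_r. apply Rmult_le_compat_r; [apply Rle_0_sqr|exact Sb].
      - rewrite RInt_lin2 by (intros x; cont_tac). rewrite Rmult_0_l, Rplus_0_r.
        assert (0 <= PI / 6 * D) by (apply Rmult_le_pos; lra). nra. }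
    assert (CS := cauchy_schwarz w1 (fun x => w x * s x) 0 (2 * PI) ltac:(lra) Cw1 ltac:(intros x; cont_tac)).
    cbv beta in CS. fold D in CS. fold X in CS.
    (* 3.9^2 exceeds 15, so dissipation 0.1 D is left over; with PI^2 / 3 <= 5 this is at least 1 /
       50 of int w^2. *)
    assert (HX : X <= 3.9 * D).
    { apply Rnot_lt_le. intros Hlt. assert (D * RInt (fun x => w x * s x * (w x * s x)) 0 (2 * PI) <= D * (15 * D)) by (apply Rmult_le_compat_l; assumption). nra. }
    assert (Po := poincare_mean_zero w w1 Dw Cw1 Pw H0). fold D in Po.
    change (RInt (fun x => (u x - v x) * (u x - v x)) 0 (2 * PI)) with (RInt (fun x => w x * w x) 0 (2 * PI)).
    assert (PI ^ 2 / 3 * D <= 5 * D) by (apply Rmult_le_compat_r; nra). lra.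
  - intros x; cont_tac.
  - intros x; cont_tac.
  - intros x. specialize (Du x). specialize (Du1 x). specialize (Dv x). specialize (Dv1 x).
    auto_derive.
    + repeat split; eexists; eassumption.
    + assert (E : Derive (fun y => u y) x = u1 x) by exact (is_derive_unique _ _ _ Du).
      assert (E1 : Derive (fun y => u1 y) x = u2 x) by exact (is_derive_unique _ _ _ Du1).
      assert (E2 : Derive (fun y => v y) x = v1 x) by exact (is_derive_unique _ _ _ Dv).
      assert (E3 : Derive (fun y => v1 y) x = v2 x) by exact (is_derive_unique _ _ _ Dv1).
      rewrite E, E1, E2, E3. unfold w, w1, s. field.
  - intros x. rewrite Pu, Pv, Pu1, Pv1. reflexivity.
Qed.

(** * Time derivatives of integrals and Gronwall's inequality *)

Lemma is_derive_RInt_jcont (t0 a b t : R) (g g' : R -> R -> R) : a <= b -> t0 < t ->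
  jcont (fun s => t0 <= s) g -> jcont (fun s => t0 < s) g' ->
  (forall s x, t0 < s -> is_derive (fun r => g r x) s (g' s x)) ->
  is_derive (fun s => RInt (g s) a b) t (RInt (g' t) a b).
Proof.
  intros Hab Ht Jg Jg' Hd.
  assert (Hp : 0 < t - t0) by lra.
  assert (Hloc : locally t (fun s => t0 < s)).
  { exists (mkposreal _ Hp). intros s Hs. change (Rabs (s - t) < t - t0) in Hs. apply Rabs_def2 in Hs. lra. }
  replace (RInt (g' t) a b) with (RInt (fun x => Derive (fun s => g s x) t) a b).
  2:{ apply RInt_ext. intros x _. apply is_derive_unique, Hd, Ht. }
  apply (is_derive_RInt_param g a b t).
  - revert Hloc. apply filter_imp. intros s Hs x _. eexists. apply Hd, Hs.
  - intros x _. intros eps. destruct (jcont_eps _ _ Jg' t x Ht eps) as [del Hdel].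
    assert (Hm : 0 < Rmin del (t - t0)) by (apply Rmin_glb_lt; [apply cond_pos|exact Hp]).
    exists (mkposreal _ Hm). simpl. intros s y Hs Hy.
    assert (Hs' := Rlt_le_trans _ _ _ Hs (Rmin_r _ _)). apply Rabs_def2 in Hs'.
    assert (DE : forall r z, t0 < r -> Derive (fun q => g q z) r = g' r z).
    { intros r z Hr. exact (is_derive_unique _ _ _ (Hd r z Hr)). }
    rewrite (DE s y), (DE t x) by lra.
    apply Hdel; [lra| |]; (eapply Rlt_le_trans; [eassumption|apply Rmin_l]).
  - revert Hloc. apply filter_imp. intros s Hs. apply ex_RInt_cont. intros x.
    apply (jcont_slice _ _ Jg). lra.
Qed.

Lemma RInt_jcont_continuous (t0 a b t : R) (g : R -> R -> R) : a < b -> t0 <= t ->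
  jcont (fun s => t0 <= s) g ->
  filterlim (fun s => RInt (g s) a b) (within (fun s => t0 <= s) (locally t)) (locally (RInt (g t) a b)).
Proof.
  intros Hab Ht Jg. apply filterlim_locally. intros eps.
  assert (He : 0 < eps / (2 * (b - a))) by (apply Rdiv_lt_0_compat; [apply cond_pos|lra]).
  destruct (jcont_tube _ g a b Jg t Ht (mkposreal _ He)) as [del Hdel]. simpl in Hdel.
  exists del. intros s Hs Hs0. change (Rabs (s - t) < del) in Hs.
  change (Rabs (RInt (g s) a b - RInt (g t) a b) < eps).
  assert (Ex : forall r, t0 <= r -> ex_RInt (g r) a b).
  { intros r Hr. apply ex_RInt_cont. intros x. apply (jcont_slice _ _ Jg), Hr. }
  rewrite <- (RInt_minus (V := R_CompleteNormedModule) (g s) (g t)) by (apply Ex; assumption).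
  eapply Rle_lt_trans.
  - apply (abs_RInt_le_const (fun x => g s x - g t x) a b (eps / (2 * (b - a)))); [lra| |].
    + apply (ex_RInt_minus (V := R_NormedModule)); apply Ex; assumption.
    + intros x Hx. left. apply Hdel; assumption.
  - replace ((b - a) * (eps / (2 * (b - a)))) with (eps / 2) by (field; lra).
    pose proof (cond_pos eps). lra.
Qed.

Lemma gronwall (t0 al be : R) (E E' : R -> R) : 0 < al ->
  filterlim E (within (fun s => t0 <= s) (locally t0)) (locally (E t0)) ->
  (forall t, t0 < t -> is_derive E t (E' t)) ->
  (forall t, t0 < t -> E' t <= - al * E t + be) ->
  forall t, t0 <= t -> E t <= be / al + (E t0 - be / al) * exp (- al * (t - t0)).
Proof.
  intros Hal Hc Hd Hle t Ht.
  destruct (Req_dec t t0) as [->|Hne]; [rewrite Rminus_diag, Rmult_0_r, exp_0; lra|].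
  (* The integrating factor makes [h] nonincreasing; [Rmax] extends [E] to the left of [t0] so that
     [h] is continuous from both sides there. *)
  set (h := fun s => (E (Rmax t0 s) - be / al) * exp (al * (s - t0))).
  set (h' := fun s => (E' s + al * (E s - be / al)) * exp (al * (s - t0))).
  (* [MVT_gen] may return the end point [t0], where [E'] is not controlled. *)
  destruct (MVT_gen h t0 t (fun s => if Rle_dec s t0 then 0 else h' s)) as [c [Hcc Eq]].
  - intros s Hs. rewrite Rmin_left, Rmax_right in Hs by lra.
    destruct (Rle_dec s t0) as [|_]; [lra|].
    assert (Hp : 0 < s - t0) by lra.
    apply (is_derive_ext_loc (fun s => (E s - be / al) * exp (al * (s - t0)))).
    { exists (mkposreal _ Hp). intros r Hr. change (Rabs (r - s) < s - t0) in Hr. apply Rabs_def2 in Hr.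
      unfold h. rewrite Rmax_right by lra. reflexivity. }
    evar_last.
    + apply (is_derive_mult (fun s => E s - be / al) (fun s => exp (al * (s - t0)))).
      * apply is_derive_minus_R; [apply Hd; lra|apply (is_derive_const (V := R_NormedModule))].
      * apply is_derive_exp_lin.
      * intros; apply Rmult_comm.
    + change plus with Rplus. change mult with Rmult. change zero with 0. unfold h'. eqR. ring.
  - intros s Hs. rewrite Rmin_left, Rmax_right in Hs by lra. apply continuity_pt_filterlim.
    apply continuous_mult_R; [|apply continuous_exp_lin]. apply continuous_minus_R; [|apply continuous_const].
    destruct (Req_dec s t0) as [->|Hne'].
    + apply filterlim_locally. intros e. rewrite (Rmax_left t0 t0) by lra.
      destruct (proj1 (filterlim_locally _ _) Hc e) as [d Hdd]. exists d. intros r Hr.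
      apply Hdd; [|apply Rmax_l]. change (Rabs (r - t0) < d) in Hr. change (Rabs (Rmax t0 r - t0) < d).
      revert Hr. unfold Rmax. destruct Rle_dec; auto. rewrite Rminus_diag, Rabs_R0.
      intros _. apply cond_pos.
    + assert (Hp : 0 < s - t0) by lra.
      apply (continuous_ext_loc (fun s => E (Rmax t0 s)) E s).
      * exists (mkposreal _ Hp). intros r Hr. change (Rabs (r - s) < s - t0) in Hr. apply Rabs_def2 in Hr.
        rewrite Rmax_right by lra. reflexivity.
      * eapply continuous_of_derive, Hd. lra.
  - rewrite Rmin_left, Rmax_right in Hcc by lra.
    assert (Hle' : h t <= h t0).
    { destruct (Rle_dec c t0) as [Hc0|Hc0]; [lra|].
      assert (h' c <= 0).
      { unfold h'. specialize (Hle c ltac:(lra)).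
        assert (E' c + al * (E c - be / al) <= 0).
        { replace (al * (E c - be / al)) with (al * E c - be) by (field; lra). lra. }
        pose proof (exp_pos (al * (c - t0))). nra. }
      nra. }
    unfold h in Hle'. rewrite (Rmax_right t0 t), (Rmax_left t0 t0), Rminus_diag, Rmult_0_r, exp_0, Rmult_1_r in Hle' by lra.
    assert (Ee : exp (- al * (t - t0)) * exp (al * (t - t0)) = 1).
    { rewrite <- exp_plus, <- exp_0. f_equal. ring. }
    pose proof (exp_pos (- al * (t - t0))). 
    assert (E t - be / al <= (E t0 - be / al) * exp (- al * (t - t0))).
    { replace (E t - be / al) with ((E t - be / al) * exp (al * (t - t0)) * exp (- al * (t - t0))).
      - apply Rmult_le_compat_r; lra.
      - rewrite Rmult_assoc, (Rmult_comm (exp (al * _))), Ee. ring. }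
    lra.
Qed.

(** * Energy decay and contraction for solutions *)

Lemma smooth_solution_restrict f t0 t1 u u1 u2 : t0 <= t1 ->
  smooth_solution f t0 u u1 u2 -> smooth_solution f t1 u u1 u2.
Proof.
  intros Ht H.
  assert (J : forall g, jcont (fun t => t0 <= t) g -> jcont (fun t => t1 <= t) g).
  { intros g. apply jcont_subset. intros t Ht'. lra. }
  split; intros; try (apply J); try (apply H; lra).
Qed.

Definition energy (u : R -> R -> R) (t : R) : R :=
  RInt (fun x => (u t x - cm) * (u t x - cm)) 0 (2 * PI).

Definition dist2 (u v : R -> R -> R) (t : R) : R :=
  RInt (fun x => (u t x - v t x) * (u t x - v t x)) 0 (2 * PI).

(* The equilibrium of the energy inequality [E' <= - (6 / PI ^ 2) * E + 4]. *)
Definition energy_level : R := 2 * PI ^ 2 / 3.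

Lemma energy_level_bounds : 0 < energy_level < 7.
Proof. unfold energy_level. pose proof PI_RGT_0. pose proof PI_lt_3_2. split; nra. Qed.

Lemma square_sub_le (a b : R) : (a - b) * (a - b) <= 2 * (a * a) + 2 * (b * b).
Proof. pose proof (Rle_0_sqr (a + b)). unfold Rsqr in *. lra. Qed.

Section Energy.

Variables f F : R -> R -> R.
Hypothesis f_jcont : forall D, jcont D f.
Hypothesis F_derive : forall t x, is_derive (F t) x (f t x).
Hypothesis F_periodic : forall t, space_periodic (F t).
Hypothesis F_norm : forall t, RInt (fun x => F t x * F t x) 0 (2 * PI) <= 8.

Lemma smooth_cont t0 u u1 u2 t : smooth_solution f t0 u u1 u2 -> t0 <= t ->
  (forall x, continuous (u t) x) /\ (forall x, continuous (u1 t) x) /\ (forall x, continuous (u2 t) x)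
  /\ (forall x, continuous (f t) x).
Proof.
  intros H Ht. repeat split; intros x.
  - apply (jcont_slice _ _ (ss_jcont _ _ _ _ _ H)), Ht.
  - apply (jcont_slice _ _ (ss_jcont1 _ _ _ _ _ H)), Ht.
  - apply (jcont_slice _ _ (ss_jcont2 _ _ _ _ _ H)), Ht.
  - apply (jcont_slice _ _ (f_jcont (fun t => t0 <= t))), Ht.
Qed.

Lemma smooth_mean_zero t0 u u1 u2 t : smooth_solution f t0 u u1 u2 -> t0 <= t ->
  RInt (fun x => u t x - cm) 0 (2 * PI) = 0.
Proof.
  intros H Ht. destruct (smooth_cont _ _ _ _ _ H Ht) as [Cu _].
  rewrite (RInt_minus (V := R_CompleteNormedModule) (u t) (fun _ => cm)).
  - rewrite (ss_mean _ _ _ _ _ H t Ht), RInt_const. change minus with Rminus. change scal with Rmult.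
    unfold cm. eqR. field.
  - apply ex_RInt_cont, Cu.
  - apply ex_RInt_const.
Qed.

Lemma jcont_rate t0 u u1 u2 : smooth_solution f t0 u u1 u2 ->
  jcont (fun t => t0 <= t) (fun t x => f t x - u t x * u1 t x + 2 * u2 t x).
Proof.
  intros H. apply jcont_plus; [apply jcont_minus|]; [apply f_jcont|apply jcont_mult; apply H|].
  apply (jcont_mult _ (fun _ _ => 2)); [apply jcont_const|apply H].
Qed.

Lemma energy_bound t0 u u1 u2 : smooth_solution f t0 u u1 u2 -> forall t, t0 <= t ->
  energy u t <= energy_level + (energy u t0 - energy_level) * exp (- (6 / PI ^ 2) * (t - t0)).
Proof.
  intros H t Ht. pose proof PI_RGT_0 as HPI. assert (Hp2 : 0 < PI ^ 2) by (apply pow_lt, HPI).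
  assert (Jw : jcont (fun t => t0 <= t) (fun t x => u t x - cm)).
  { apply jcont_minus; [apply H|apply jcont_const]. }
  replace energy_level with (4 / (6 / PI ^ 2)) by (unfold energy_level; field; lra).
  (* The source term 4 is half of the bound 8 on the integral of F^2. *)
  apply (gronwall t0 (6 / PI ^ 2) 4 (energy u)
    (fun t => RInt (fun x => 2 * (u t x - cm) * (f t x - u t x * u1 t x + 2 * u2 t x)) 0 (2 * PI))).
  - apply Rdiv_lt_0_compat; lra.
  - apply (RInt_jcont_continuous t0 0 (2 * PI) t0 (fun t x => (u t x - cm) * (u t x - cm))); [lra|lra|].
    apply jcont_mult; exact Jw.
  - intros s Hs.
    apply (is_derive_RInt_jcont t0 0 (2 * PI) s (fun t x => (u t x - cm) * (u t x - cm))
       (fun t x => 2 * (u t x - cm) * (f t x - u t x * u1 t x + 2 * u2 t x))); [lra|exact Hs| | |].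
    + apply jcont_mult; exact Jw.
    + apply (jcont_subset (fun t => t0 <= t)); [intros; lra|].
      apply jcont_mult; [|apply (jcont_rate _ _ _ _ H)].
      apply (jcont_mult _ (fun _ _ => 2)); [apply jcont_const|exact Jw].
    + intros r x Hr.
      assert (D : is_derive (fun r => u r x - cm) r (f r x - u r x * u1 r x + 2 * u2 r x)).
      { rewrite <- (Rminus_0_r (_ + _)).
        apply is_derive_minus_R; [apply (ss_derive_t _ _ _ _ _ H), Hr|apply (is_derive_const (V := R_NormedModule))]. }
      evar_last; [apply (is_derive_mult _ _ _ _ _ D D); intros; apply Rmult_comm|].
      change plus with Rplus. change mult with Rmult. eqR. ring.
  - intros s Hs. assert (Hs' : t0 <= s) by lra.
    destruct (smooth_cont _ _ _ _ _ H Hs') as [Cu [Cu1 [Cu2 Cf]]].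
    assert (A := energy_rate (u s) (u1 s) (u2 s) (F s) (f s) cm
      (fun x => ss_derive _ _ _ _ _ H s x Hs') (fun x => ss_derive1 _ _ _ _ _ H s x Hs')
      (F_derive s) Cu2 Cf (ss_periodic _ _ _ _ _ H s Hs') (F_periodic s) (smooth_mean_zero _ _ _ _ _ H Hs')).
    specialize (F_norm s). unfold energy. lra.
  - exact Ht.
Qed.

Lemma energy_nonneg t0 u u1 u2 t : smooth_solution f t0 u u1 u2 -> t0 <= t -> 0 <= energy u t.
Proof.
  intros H Ht. destruct (smooth_cont _ _ _ _ _ H Ht) as [Cu _].
  apply RInt_nonneg_cont; [pose proof two_PI_pos; lra|intros x; cont_tac|intros x _; apply Rle_0_sqr].
Qed.

Lemma contraction t0 u u1 u2 v v1 v2 : smooth_solution f t0 u u1 u2 -> smooth_solution f t0 v v1 v2 ->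
  (forall t, t0 <= t -> energy u t <= 7) -> (forall t, t0 <= t -> energy v t <= 7) ->
  forall t, t0 <= t -> dist2 u v t <= dist2 u v t0 * exp (- (1 / 50) * (t - t0)).
Proof.
  intros Hu Hv Eu Ev t Ht. pose proof PI_RGT_0 as HPI.
  assert (Jw : jcont (fun t => t0 <= t) (fun t x => u t x - v t x)).
  { apply jcont_minus; [apply Hu|apply Hv]. }
  assert (G : dist2 u v t <= 0 / (1 / 50) + (dist2 u v t0 - 0 / (1 / 50)) * exp (- (1 / 50) * (t - t0))).
  { apply (gronwall t0 (1 / 50) 0 (dist2 u v)
      (fun t => RInt (fun x => 2 * (u t x - v t x) * ((f t x - u t x * u1 t x + 2 * u2 t x)
         - (f t x - v t x * v1 t x + 2 * v2 t x))) 0 (2 * PI))); [lra| | | |exact Ht].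
    - apply (RInt_jcont_continuous t0 0 (2 * PI) t0 (fun t x => (u t x - v t x) * (u t x - v t x))); [lra|lra|].
      apply jcont_mult; exact Jw.
    - intros s Hs.
      apply (is_derive_RInt_jcont t0 0 (2 * PI) s (fun t x => (u t x - v t x) * (u t x - v t x))
         (fun t x => 2 * (u t x - v t x) * ((f t x - u t x * u1 t x + 2 * u2 t x)
         - (f t x - v t x * v1 t x + 2 * v2 t x)))); [lra|exact Hs| | |].
      + apply jcont_mult; exact Jw.
      + apply (jcont_subset (fun t => t0 <= t)); [intros; lra|].
        apply jcont_mult; [apply (jcont_mult _ (fun _ _ => 2)); [apply jcont_const|exact Jw]|].
        apply jcont_minus; [apply (jcont_rate _ _ _ _ Hu)|apply (jcont_rate _ _ _ _ Hv)].
      + intros r x Hr.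
        assert (D := is_derive_minus_R _ _ _ _ _ (ss_derive_t _ _ _ _ _ Hu r x Hr) (ss_derive_t _ _ _ _ _ Hv r x Hr)).
        evar_last; [apply (is_derive_mult _ _ _ _ _ D D); intros; apply Rmult_comm|].
        change plus with Rplus. change mult with Rmult. eqR. ring.
    - intros s Hs. assert (Hs' : t0 <= s) by lra.
      destruct (smooth_cont _ _ _ _ _ Hu Hs') as [Cu [Cu1 [Cu2 Cf]]].
      destruct (smooth_cont _ _ _ _ _ Hv Hs') as [Cv [Cv1 [Cv2 _]]].
      assert (M0 : RInt (fun x => u s x - v s x) 0 (2 * PI) = 0).
      { rewrite (RInt_minus (V := R_CompleteNormedModule) (u s) (v s)) by (apply ex_RInt_cont; assumption).
        rewrite (ss_mean _ _ _ _ _ Hu s Hs'), (ss_mean _ _ _ _ _ Hv s Hs'). apply Rminus_diag. }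
      assert (A := difference_rate (u s) (u1 s) (u2 s) (v s) (v1 s) (v2 s) (f s) cm
        (fun x => ss_derive _ _ _ _ _ Hu s x Hs') (fun x => ss_derive1 _ _ _ _ _ Hu s x Hs')
        (fun x => ss_derive _ _ _ _ _ Hv s x Hs') (fun x => ss_derive1 _ _ _ _ _ Hv s x Hs')
        Cu2 Cv2 Cf (ss_periodic _ _ _ _ _ Hu s Hs') (ss_periodic _ _ _ _ _ Hv s Hs') M0 (Eu s Hs') (Ev s Hs')).
      unfold dist2. lra. }
  unfold Rdiv in G. rewrite Rmult_0_l, Rplus_0_l, Rminus_0_r in G. exact G.
Qed.

Lemma dist2_le_energy t0 u u1 u2 v v1 v2 t : smooth_solution f t0 u u1 u2 -> smooth_solution f t0 v v1 v2 ->
  t0 <= t -> dist2 u v t <= 2 * energy u t + 2 * energy v t.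
Proof.
  intros Hu Hv Ht. pose proof PI_RGT_0.
  destruct (smooth_cont _ _ _ _ _ Hu Ht) as [Cu _]. destruct (smooth_cont _ _ _ _ _ Hv Ht) as [Cv _].
  unfold dist2, energy. rewrite <- RInt_lin2 by (intros x; cont_tac).
  apply RInt_le_cont; [lra|intros x; cont_tac|intros x; cont_tac|]. intros x _.
  replace (u t x - v t x) with ((u t x - cm) - (v t x - cm)) by ring. apply square_sub_le.
Qed.

(** [K] is chosen before [v], hence is uniform over the family [Vsol s], and this is what lets [s]
    tend to minus infinity afterwards. Only [u] needs a waiting time to come below 7. *)
Lemma exponential_attraction t0 u u1 u2 : smooth_solution f t0 u u1 u2 ->
  exists K, forall v v1 v2, smooth_solution f t0 v v1 v2 -> (forall t, t0 <= t -> energy v t <= 7) ->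
  forall t, t0 <= t -> dist2 u v t <= K * exp (- (1 / 50) * (t - t0)).
Proof.
  intros Hu. pose proof energy_level_bounds as HL. pose proof PI_RGT_0 as HPI.
  assert (Hp2 : 0 < PI ^ 2) by (apply pow_lt, HPI).
  assert (Hal : 0 < 6 / PI ^ 2) by (apply Rdiv_lt_0_compat; lra).
  set (E0 := energy u t0). set (a := Rabs (E0 - energy_level)).
  assert (HE0 : 0 <= E0) by (apply (energy_nonneg t0 u u1 u2); [exact Hu|lra]).
  assert (Ha : 0 <= a) by apply Rabs_pos.
  (* After the time [T] the excess over [energy_level] has shrunk by the factor 1 / q, hence to at
     most 7 - [energy_level]. *)
  set (q := 1 + a / (7 - energy_level)).
  assert (Hq0 : 0 <= a / (7 - energy_level)) by (apply Rmult_le_pos; [lra|left; apply Rinv_0_lt_compat; lra]).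
  assert (Hq : 1 <= q) by (unfold q; lra).
  set (T := ln q / (6 / PI ^ 2)).
  assert (HT : 0 <= T).
  { apply Rmult_le_pos; [|left; apply Rinv_0_lt_compat, Hal].
    rewrite <- ln_1. destruct Hq as [Hq|<-]; [left; apply ln_increasing; lra|lra]. }
  assert (Late : forall t, t0 + T <= t -> energy u t <= 7).
  { intros t Ht. eapply Rle_trans; [apply (energy_bound t0 u u1 u2 Hu t); lra|]. fold E0.
    assert (B : exp (- (6 / PI ^ 2) * (t - t0)) <= / q).
    { rewrite <- (exp_ln q) by lra. rewrite <- exp_Ropp. apply exp_le_compat.
      replace (- ln q) with (- (6 / PI ^ 2) * T) by (unfold T; field; lra).
      assert (6 / PI ^ 2 * T <= 6 / PI ^ 2 * (t - t0)) by (apply Rmult_le_compat_l; lra). lra. }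
    pose proof (exp_pos (- (6 / PI ^ 2) * (t - t0))).
    assert (E0 - energy_level <= a) by apply Rle_abs.
    assert (a * / q <= 7 - energy_level).
    { apply (Rmult_le_reg_r q); [lra|]. rewrite Rmult_assoc, Rinv_l, Rmult_1_r by lra.
      unfold q. replace ((7 - energy_level) * (1 + a / (7 - energy_level))) with (7 - energy_level + a) by (field; lra). lra. }
    assert ((E0 - energy_level) * exp (- (6 / PI ^ 2) * (t - t0)) <= a * / q); [|lra].
    apply Rle_trans with (a * exp (- (6 / PI ^ 2) * (t - t0))).
    - apply Rmult_le_compat_r; lra.
    - apply Rmult_le_compat_l; lra. }
  assert (Early : forall t, t0 <= t -> energy u t <= 7 + E0).
  { intros t Ht. eapply Rle_trans; [apply (energy_bound t0 u u1 u2 Hu t Ht)|]. fold E0.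
    pose proof (exp_pos (- (6 / PI ^ 2) * (t - t0))).
    assert (0 <= 6 / PI ^ 2 * (t - t0)) by (apply Rmult_le_pos; lra).
    assert (exp (- (6 / PI ^ 2) * (t - t0)) <= 1) by (rewrite <- exp_0; apply exp_le_compat; lra).
    set (e := exp (- (6 / PI ^ 2) * (t - t0))) in *.
    assert (0 <= E0 * (1 - e)) by (apply Rmult_le_pos; lra).
    assert (0 <= energy_level * e) by (apply Rmult_le_pos; lra). lra. }
  (* [M] bounds the squared distance at all times; the factor exp (T / 50) makes the exponential
     bound trivial before t0 + T. *)
  set (M := 2 * (7 + E0) + 2 * 7).
  exists (M * exp (1 / 50 * T)). intros v v1 v2 Hv Ev t Ht.
  assert (HM : forall t, t0 <= t -> dist2 u v t <= M).
  { intros s Hs. eapply Rle_trans; [apply (dist2_le_energy t0 u u1 u2 v v1 v2 s Hu Hv Hs)|].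
    specialize (Early s Hs). specialize (Ev s Hs). unfold M. lra. }
  assert (HM0 : 0 <= M) by (unfold M; lra).
  rewrite Rmult_assoc, <- exp_plus.
  replace (1 / 50 * T + - (1 / 50) * (t - t0)) with (- (1 / 50) * (t - (t0 + T))) by ring.
  destruct (Rle_dec (t0 + T) t) as [Hlate|Hearly].
  - eapply Rle_trans.
    + apply (contraction (t0 + T) u u1 u2 v v1 v2).
      * apply (smooth_solution_restrict f t0); [lra|exact Hu].
      * apply (smooth_solution_restrict f t0); [lra|exact Hv].
      * exact Late.
      * intros s Hs. apply Ev. lra.
      * exact Hlate.
    + apply Rmult_le_compat_r; [left; apply exp_pos|]. apply HM. lra.
  - apply Rnot_le_lt in Hearly. eapply Rle_trans; [apply HM, Ht|]. rewrite <- (Rmult_1_r M) at 1.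
    apply Rmult_le_compat_l; [exact HM0|]. apply Rle_trans with (exp 0); [rewrite exp_0; lra|]. apply exp_le_compat; lra.
Qed.

End Energy.

(** * The attracting solution *)

Lemma RInt_sqr_le (w : R -> R) (a b x : R) : (forall y, continuous w y) -> a <= x <= b ->
  RInt w a x * RInt w a x <= (b - a) * RInt (fun y => w y * w y) a b.
Proof.
  intros Cw Hx.
  assert (S := cauchy_schwarz (fun _ => 1) w a x ltac:(lra) ltac:(intros; apply continuous_const) Cw).
  cbv beta in S.
  rewrite (RInt_ext (fun y => 1 * w y) w), (RInt_ext (fun _ => 1 * 1) (fun _ => 1)) in S
    by (intros; eqR; ring).
  rewrite RInt_const in S. change scal with Rmult in S. rewrite Rmult_1_r in S.
  assert (C2 : forall y, continuous (fun y => w y * w y) y) by (intros y; cont_tac).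
  assert (E : RInt (fun y => w y * w y) a b = RInt (fun y => w y * w y) a x + RInt (fun y => w y * w y) x b).
  { symmetry. apply (RInt_Chasles (V := R_CompleteNormedModule)); apply ex_RInt_cont, C2. }
  assert (P1 : 0 <= RInt (fun y => w y * w y) a x) by (apply RInt_nonneg_cont; auto; [lra|intros; apply Rle_0_sqr]).
  assert (P2 : 0 <= RInt (fun y => w y * w y) x b) by (apply RInt_nonneg_cont; auto; [lra|intros; apply Rle_0_sqr]).
  rewrite E. nra.
Qed.

(** Turns L2 bounds on velocities into uniform bounds on logarithms of transforms normalised at 0.
    The constant comes from 2 PI / 16 <= 1 / 2. *)
Lemma log_derivative_bound (h w : R -> R) (G : R) : (forall x, is_derive h x (- (1 / 4) * w x)) ->
  (forall x, continuous w x) -> h 0 = 0 -> RInt (fun x => w x * w x) 0 (2 * PI) <= G ->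
  forall x, 0 <= x <= 2 * PI -> h x * h x <= G / 2.
Proof.
  intros Hd Cw H0 HG x Hx. pose proof PI_4. pose proof PI_RGT_0.
  assert (E : h x = - (1 / 4) * RInt w 0 x).
  { transitivity (RInt (fun x => - (1 / 4) * w x) 0 x).
    - rewrite (is_RInt_unique _ _ _ _ (is_RInt_derive (V := R_CompleteNormedModule) h
        (fun x => - (1 / 4) * w x) 0 x (fun x _ => Hd x) ltac:(intros; cont_tac))).
      rewrite H0. change minus with Rminus. eqR. ring.
    - apply (RInt_scal (V := R_CompleteNormedModule) w). apply ex_RInt_cont, Cw. }
  assert (S := RInt_sqr_le w 0 (2 * PI) x Cw Hx). rewrite E.
  assert (0 <= RInt (fun x => w x * w x) 0 (2 * PI)) by (apply RInt_nonneg_cont; [lra|intros y; cont_tac|intros; apply Rle_0_sqr]).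
  nra.
Qed.

Lemma exp_lipschitz (a b m : R) : a <= m -> b <= m -> Rabs (exp a - exp b) <= exp m * Rabs (a - b).
Proof.
  intros Ha Hb.
  destruct (MVT_gen exp b a exp) as [c [Hc E]].
  - intros x _. apply is_derive_Reals, derivable_pt_lim_exp.
  - intros x _. apply derivable_continuous_pt, derivable_pt_exp.
  - rewrite E, Rabs_mult, (Rabs_pos_eq (exp c)) by (left; apply exp_pos).
    apply Rmult_le_compat_r; [apply Rabs_pos|]. apply exp_le_compat.
    apply Rle_trans with (Rmax b a); [apply Hc|apply Rmax_lub; assumption].
Qed.

Lemma Rabs_le_of_sqr (x m : R) : 0 <= m -> x * x <= m * m -> Rabs x <= m.
Proof. intros Hm H. apply Rabs_le. nra. Qed.

Lemma fourier_minus (g h : R -> R) i : (forall x, continuous g x) -> (forall x, continuous h x) ->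
  fourier (fun x => g x - h x) i = fourier g i - fourier h i.
Proof.
  intros Cg Ch.
  assert (G : forall e : R -> R, (forall x, continuous e x) ->
    / (2 * PI) * RInt (fun x => (g x - h x) * e x) 0 (2 * PI) =
    / (2 * PI) * RInt (fun x => g x * e x) 0 (2 * PI) - / (2 * PI) * RInt (fun x => h x * e x) 0 (2 * PI)).
  { intros e Ce. rewrite (RInt_ext _ (fun x => 1 * (g x * e x) + -1 * (h x * e x))).
    - rewrite RInt_lin2 by (intros x; cont_tac). eqR. ring.
    - intros x _. eqR. ring. }
  destruct i as [k [|]]; cbn [fourier]; apply G; intros x; [apply continuous_cos_lin|apply continuous_sin_lin].
Qed.

Lemma ratio_diff_bound (a b a' b' be M e : R) : 0 < be -> be <= b -> be <= b' ->
  Rabs a' <= M -> Rabs (a - a') <= e -> Rabs (b - b') <= e ->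
  Rabs (a / b - a' / b') <= (1 / be + M / (be * be)) * e.
Proof.
  intros Hbe Hb Hb' Ha' Ha Hbb.
  assert (0 <= e) by (eapply Rle_trans; [apply Rabs_pos|exact Ha]).
  assert (0 <= M) by (eapply Rle_trans; [apply Rabs_pos|exact Ha']).
  replace (a / b - a' / b') with ((a - a') * / b + a' * (b' - b) * / (b * b')) by (field; lra).
  assert (I1 : 0 < / b <= 1 / be).
  { split; [apply Rinv_0_lt_compat; lra|]. unfold Rdiv. rewrite Rmult_1_l. apply Rinv_le_contravar; lra. }
  assert (I2 : 0 < / (b * b') <= / (be * be)).
  { split; [apply Rinv_0_lt_compat; nra|]. apply Rinv_le_contravar; nra. }
  eapply Rle_trans; [apply Rabs_triang|]. rewrite !Rabs_mult.
  rewrite (Rabs_pos_eq (/ b)), (Rabs_pos_eq (/ (b * b'))), (Rabs_minus_sym b' b) by lra.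
  replace ((1 / be + M / (be * be)) * e) with (e * (1 / be) + M * e * / (be * be)) by (unfold Rdiv; ring).
  apply Rplus_le_compat.
  - apply Rmult_le_compat; try lra. apply Rabs_pos.
  - apply Rmult_le_compat; try lra.
    + apply Rmult_le_pos; apply Rabs_pos.
    + apply Rmult_le_compat; try lra; apply Rabs_pos.
Qed.

(** Coefficients of the datum in the moving coordinate y = x - cm t0. *)
Definition init (t0 : R) (w : R -> R) : coefs := fourier (fun y => w (y + cm * t0)).

Section Attractor.

Variables (A B : nat -> R -> R) (Q : R).
Hypothesis A_cont : forall j t, continuous (A j) t.
Hypothesis B_cont : forall j t, continuous (B j) t.
Hypothesis A_bound : forall j t, Rabs (A j t) <= Q.
Hypothesis B_bound : forall j t, Rabs (B j t) <= Q.

Let f := trig_force A B.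
Let pc := pot_cos A B.
Let ps := pot_sin A B.
Let pc_cont : forall j t, continuous (pc j) t := pot_cos_cont A B A_cont B_cont.
Let ps_cont : forall j t, continuous (ps j) t := pot_sin_cont A B A_cont B_cont.
Let pc_bound : forall j t, Rabs (pc j t) <= Q := pot_cos_bound A B Q A_bound B_bound.
Let ps_bound : forall j t, Rabs (ps j t) <= Q := pot_sin_bound A B Q A_bound B_bound.
Let hflow : R -> coefs -> R -> coefs := heat_flow pc ps.
Let f_jcont : forall D, jcont D f := jcont_force A B A_cont B_cont.

Lemma init_decay t0 w : Ck 5 w -> space_periodic w -> exists N, decay 5 N (init t0 w).
Proof.
  intros Hw Hp. apply fourier_decay; [apply (Ck_shift 5 w (cm * t0)), Hw|].
  intros x. replace (x + 2 * PI + cm * t0) with (x + cm * t0 + 2 * PI) by ring. apply Hp.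
Qed.

Lemma init_solution t0 w : Ck 5 w -> space_periodic w ->
  heat_solution pc ps t0 (hflow t0 (init t0 w)).
Proof.
  intros Hw Hp. destruct (init_decay t0 w Hw Hp) as [N HN].
  apply (heat_flow_solution pc ps Q pc_cont ps_cont pc_bound ps_bound t0 N _ HN).
Qed.

Lemma phi0_init t0 w x : Ck 5 w -> space_periodic w ->
  phi cm (hflow t0 (init t0 w)) 0 t0 x = w x.
Proof.
  intros Hw Hp. destruct (init_decay t0 w Hw Hp) as [N HN].
  assert (HN2 : decay 2 N (init t0 w)) by (apply (decay_mono 5 2 N N); [lia|lra|exact HN]).
  unfold phi, dcoefs. cbn.
  rewrite (trig_ext _ (init t0 w)).
  - unfold init. rewrite (trig_fourier N).
    + f_equal. ring.
    + apply (Ck_continuous 5), Ck_shift, Hw.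
    + intros y. replace (y + 2 * PI + cm * t0) with (y + cm * t0 + 2 * PI) by ring. apply Hp.
    + exact HN2.
  - intros i. apply flow_init.
Qed.

Lemma phi1_init t0 w w' x : Ck 5 w -> space_periodic w -> (forall x, is_derive w x (w' x)) ->
  phi cm (hflow t0 (init t0 w)) 1 t0 x = w' x.
Proof.
  intros Hw Hp Hd.
  assert (D := phi_derive_x pc ps cm t0 _ (init_solution t0 w Hw Hp) 0 t0 x ltac:(lia) ltac:(lra)).
  rewrite <- (is_derive_unique _ _ _ D). apply is_derive_unique.
  apply (is_derive_ext w); [|apply Hd]. intros y. symmetry. apply phi0_init; assumption.
Qed.

Lemma phi0_init_bound t0 w delta : Ck 5 w -> space_periodic w -> 0 < delta -> (forall x, delta <= w x) ->
  forall t x, t0 <= t ->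
  delta * exp (- (6 * Q + 1) * (t - t0)) <= phi cm (hflow t0 (init t0 w)) 0 t x.
Proof.
  intros Hw Hp Hdel Hb t x Ht.
  apply (phi_lower_bound A B Q A_bound B_bound t0 _ (init_solution t0 w Hw Hp) delta Hdel); [|exact Ht].
  intros y. rewrite phi0_init; auto.
Qed.

Lemma init_smooth t0 w delta : Ck 5 w -> space_periodic w -> 0 < delta -> (forall x, delta <= w x) ->
  let p := hflow t0 (init t0 w) in
  (forall t x, t0 <= t -> 0 < phi cm p 0 t x) /\
  smooth_solution f t0 (cole p) (cole1 p) (cole2 p).
Proof.
  intros Hw Hp Hdel Hb p.
  assert (Pos : forall t x, t0 <= t -> 0 < phi cm p 0 t x).
  { intros t x Ht. eapply Rlt_le_trans; [|apply (phi0_init_bound t0 w delta); auto].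
    apply Rmult_lt_0_compat; [exact Hdel|apply exp_pos]. }
  split; [exact Pos|].
  apply (cole_hopf A B Q A_bound B_bound t0 p (init_solution t0 w Hw Hp) Pos).
Qed.

(* [Vsol s] starts from the constant [cm] at time [s]. *)
Definition Psol (s : R) : R -> coefs := hflow s (init s (fun _ => 1)).
Definition Vsol (s : R) : R -> R -> R := cole (Psol s).

Lemma Psol_pos s t x : s <= t -> 0 < phi cm (Psol s) 0 t x.
Proof.
  intros Ht. apply (init_smooth s (fun _ => 1) 1); auto; [apply Ck_const|intros y; reflexivity|lra|intros; lra].
Qed.

Lemma Vsol_smooth s : smooth_solution f s (Vsol s) (cole1 (Psol s)) (cole2 (Psol s)).
Proof.
  apply (init_smooth s (fun _ => 1) 1); auto; [apply Ck_const|intros y; reflexivity|lra|intros; lra].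
Qed.

Lemma Vsol_init s x : Vsol s s x = cm.
Proof.
  unfold Vsol, cole, Psol.
  rewrite (phi1_init s (fun _ => 1) (fun _ => 0)); [unfold Rdiv; ring|apply (Ck_const 5)|intros y; reflexivity|].
  intros y. apply (is_derive_const (V := R_NormedModule)).
Qed.

Lemma force_unique t0 u u1 u2 v v1 v2 : smooth_solution f t0 u u1 u2 -> smooth_solution f t0 v v1 v2 ->
  (forall x, v t0 x = u t0 x) -> forall t x, t0 <= t -> v t x = u t x.
Proof.
  intros Hu Hv. apply (classical_solution_unique f t0 u u1 u2 v (f_jcont _) Hu).
  exact (smooth_solution_classical f t0 v v1 v2 (f_jcont _) Hv).
Qed.

Variable F : R -> R -> R.
Hypothesis F_derive : forall t x, is_derive (F t) x (f t x).
Hypothesis F_periodic : forall t, space_periodic (F t).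
Hypothesis F_norm : forall t, RInt (fun x => F t x * F t x) 0 (2 * PI) <= 8.

Lemma Vsol_energy s t : s <= t -> energy (Vsol s) t <= 7.
Proof.
  intros Ht. pose proof energy_level_bounds as HL.
  assert (E0 : energy (Vsol s) s = 0).
  { unfold energy. rewrite (RInt_ext _ (fun _ => 0)).
    - rewrite RInt_const. change scal with Rmult. eqR. ring.
    - intros x _. rewrite Vsol_init. eqR. ring. }
  assert (Eb := energy_bound f F f_jcont F_derive F_periodic F_norm s _ _ _ (Vsol_smooth s) t Ht).
  rewrite E0 in Eb. pose proof (exp_pos (- (6 / PI ^ 2) * (t - s))). nra.
Qed.

(** At time [s] the later solution equals the constant [cm], so the squared distance starts as the
    energy of the earlier one, at most 7. *)
Lemma Vsol_dist s s' t : s' <= s -> s <= t ->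
  dist2 (Vsol s) (Vsol s') t <= 7 * exp (- (1 / 50) * (t - s)).
Proof.
  intros Hs Ht.
  eapply Rle_trans.
  - apply (contraction f f_jcont s _ _ _ _ _ _ (Vsol_smooth s)
      (smooth_solution_restrict f s' s _ _ _ Hs (Vsol_smooth s'))); [| |exact Ht].
    + intros r Hr. apply Vsol_energy, Hr.
    + intros r Hr. apply Vsol_energy. lra.
  - apply Rmult_le_compat_r; [left; apply exp_pos|].
    eapply Rle_trans; [|apply (Vsol_energy s' s Hs)]. right.
    unfold dist2, energy. apply RInt_ext. intros x _. rewrite Vsol_init. eqR. ring.
Qed.

(** The velocity determines the transform only up to a factor depending on time; dividing by the
    value at 0 fixes it, so that transforms with different [s] become comparable. *)
Definition Phi (tau s x : R) : R := phi cm (Psol s) 0 tau x / phi cm (Psol s) 0 tau 0.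

Lemma Phi_pos tau s x : s <= tau -> 0 < Phi tau s x.
Proof. intros Hs. apply Rdiv_lt_0_compat; apply Psol_pos, Hs. Qed.

Lemma Phi_periodic tau s : space_periodic (Phi tau s).
Proof. intros x. unfold Phi. rewrite phi_periodic. reflexivity. Qed.

Lemma Phi_Ck tau s : s < tau -> Ck 5 (Phi tau s).
Proof.
  intros Hs.
  destruct (init_decay s (fun _ => 1) (Ck_const 5 1) ltac:(intros y; reflexivity)) as [N HN].
  assert (He : 0 < tau - s) by lra.
  (* Decay of order 8 = 5 + 3 is what [Ck_trig] asks for regularity 5. *)
  destruct (heat_flow_decay pc ps Q pc_cont ps_cont pc_bound ps_bound s (tau - s) tau 8 He) as [C [HC HB]].
  assert (Hd := HB N _ (decay_le_const _ _ _ HN) tau ltac:(lra)).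
  apply (Ck_ext 5 (fun x => (fun x => trig (Psol s tau) (x + - (cm * tau))) x * / phi cm (Psol s) 0 tau 0)).
  - intros x. reflexivity.
  - apply Ck_mult; [|apply Ck_const]. apply Ck_shift, (Ck_trig 5 (C * N)), Hd.
Qed.

Lemma ln_Phi_derive tau s x : s <= tau ->
  is_derive (fun x => ln (Phi tau s x)) x (- (1 / 4) * (Vsol s tau x - cm)).
Proof.
  intros Hs. assert (H1 := Psol_pos s tau x Hs). assert (H0 := Psol_pos s tau 0 Hs).
  evar_last.
  - apply (is_derive_comp ln (Phi tau s) x (/ Phi tau s x)).
    + apply is_derive_Reals, derivable_pt_lim_ln, Phi_pos, Hs.
    + unfold Phi. apply (is_derive_ext (fun x => / phi cm (Psol s) 0 tau 0 * phi cm (Psol s) 0 tau x)).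
      { intros y. unfold Rdiv. apply Rmult_comm. }
      apply (is_derive_scal (phi cm (Psol s) 0 tau)).
      apply (phi_derive_x pc ps cm s (Psol s)); [|lia|exact Hs].
      apply init_solution; [apply Ck_const|intros y; reflexivity].
  - change scal with Rmult. unfold Vsol, cole, Phi. eqR. field. split; apply Rgt_not_eq; assumption.
Qed.

Lemma ln_Phi_0 tau s : s <= tau -> ln (Phi tau s 0) = 0.
Proof.
  intros Hs. unfold Phi, Rdiv. rewrite Rinv_r; [apply ln_1|]. apply Rgt_not_eq, Psol_pos, Hs.
Qed.

Lemma Vsol_cont s t x : s <= t -> continuous (Vsol s t) x.
Proof. intros Ht. apply (jcont_slice _ _ (ss_jcont _ _ _ _ _ (Vsol_smooth s)) t x Ht). Qed.

Lemma ln_Phi_bound tau s x : s <= tau -> Rabs (ln (Phi tau s x)) <= 2.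
Proof.
  intros Hs. destruct (reduce_mod_period x) as [y [Hy E]].
  rewrite (E _ (Phi_periodic tau s)). apply Rabs_le_of_sqr; [lra|].
  eapply Rle_trans; [apply (log_derivative_bound (fun x => ln (Phi tau s x)) (fun x => Vsol s tau x - cm) 7)|].
  - intros z. apply ln_Phi_derive, Hs.
  - intros z. apply continuous_minus_R; [apply Vsol_cont, Hs|apply continuous_const].
  - apply ln_Phi_0, Hs.
  - apply (Vsol_energy s tau Hs).
  - exact Hy.
  - lra.
Qed.

(** 1 / 100 is half of 1 / 50, the distance being squared there; 2 bounds sqrt (7 / 2), and exp 2 is
    a Lipschitz constant of exp below 2. *)
Definition rate (tau s : R) : R := 2 * exp 2 * exp (- (1 / 100) * (tau - s)).

Lemma Phi_bounds tau s x : s <= tau -> exp (-2) <= Phi tau s x <= exp 2.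
Proof.
  intros Hs. assert (L := ln_Phi_bound tau s x Hs). apply Rabs_le_between in L.
  rewrite <- (exp_ln (Phi tau s x)) by (apply Phi_pos, Hs). split; apply exp_le_compat; lra.
Qed.

Lemma Phi_diff tau s s' x : s' <= s -> s <= tau -> Rabs (Phi tau s x - Phi tau s' x) <= rate tau s.
Proof.
  intros Hs Ht. destruct (reduce_mod_period x) as [y [Hy E]].
  rewrite (E _ (Phi_periodic tau s)), (E _ (Phi_periodic tau s')).
  assert (L : Rabs (ln (Phi tau s y) - ln (Phi tau s' y)) <= 2 * exp (- (1 / 100) * (tau - s))).
  { set (e := exp (- (1 / 100) * (tau - s))).
    assert (He : 0 < e) by apply exp_pos.
    assert (He2 : e * e = exp (- (1 / 50) * (tau - s))) by (unfold e; rewrite <- exp_plus; f_equal; field).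
    apply Rabs_le_of_sqr; [lra|].
    eapply Rle_trans; [apply (log_derivative_bound (fun x => ln (Phi tau s x) - ln (Phi tau s' x))
      (fun x => Vsol s tau x - Vsol s' tau x) (7 * (e * e)))|].
    - intros z. evar_last.
      + apply is_derive_minus_R; apply ln_Phi_derive; lra.
      + eqR. ring.
    - intros z. apply continuous_minus_R; apply Vsol_cont; lra.
    - rewrite !ln_Phi_0 by lra. ring.
    - rewrite He2. apply Vsol_dist; assumption.
    - exact Hy.
    - nra. }
  assert (L1 := ln_Phi_bound tau s y Ht). assert (L2 := ln_Phi_bound tau s' y ltac:(lra)).
  apply Rabs_le_between in L1. apply Rabs_le_between in L2.
  rewrite <- (exp_ln (Phi tau s y)), <- (exp_ln (Phi tau s' y)) by (apply Phi_pos; lra).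
  eapply Rle_trans; [apply (exp_lipschitz _ _ 2); lra|]. unfold rate.
  pose proof (exp_pos 2). nra.
Qed.

Definition gcoef (tau s : R) : coefs := init tau (Phi tau s).

Lemma Phi_shift_cont tau s a y : s < tau -> continuous (fun y => Phi tau s (y + a)) y.
Proof. intros Hs. apply (Ck_continuous 5), Ck_shift, Phi_Ck, Hs. Qed.

Lemma gcoef_bound tau s i : s < tau -> Rabs (gcoef tau s i) <= exp 2.
Proof.
  intros Hs. apply fourier_bound; [intros x; apply Phi_shift_cont, Hs|].
  intros x _. assert (P := Phi_bounds tau s (x + cm * tau) ltac:(lra)).
  rewrite Rabs_pos_eq; [apply P|]. pose proof (exp_pos (-2)). lra.
Qed.

Lemma gcoef_diff tau s s' i : s' <= s -> s < tau -> Rabs (gcoef tau s i - gcoef tau s' i) <= rate tau s.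
Proof.
  intros Hs Ht. unfold gcoef, init.
  rewrite <- fourier_minus by (intros x; apply Phi_shift_cont; lra).
  apply fourier_bound.
  - intros x. apply continuous_minus_R; apply Phi_shift_cont; lra.
  - intros x _. apply Phi_diff; lra.
Qed.

Lemma rate_small tau eps : 0 < eps -> exists S, S < tau /\ forall s, s <= S -> rate tau s < eps.
Proof.
  intros He. set (q := eps / (2 * exp 2)).
  assert (H2 : 0 < 2 * exp 2) by (pose proof (exp_pos 2); lra).
  assert (Hq : 0 < q) by (apply Rdiv_lt_0_compat; lra).
  exists (Rmin (tau - 1) (tau + 100 * ln q - 1)). split.
  - eapply Rle_lt_trans; [apply Rmin_l|]. lra.
  - intros s Hs. assert (Hs' := Rle_trans _ _ _ Hs (Rmin_r _ _)). unfold rate.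
    assert (exp (- (1 / 100) * (tau - s)) < q).
    { rewrite <- (exp_ln q Hq). apply exp_increasing. lra. }
    replace eps with (2 * exp 2 * q) by (unfold q; field; lra).
    apply Rmult_lt_compat_l; assumption.
Qed.

(** A sequence of starting times is enough for the definition, since [glim_diff] bounds the distance
    to the limit for every [s] before [tau]. *)
Definition glim (tau : R) : coefs := fun i => real (Lim_seq (fun n => gcoef tau (tau - 1 - INR n) i)).

Lemma glim_diff tau s i : s < tau -> Rabs (gcoef tau s i - glim tau i) <= rate tau s.
Proof.
  intros Hs. set (u := fun n => gcoef tau (tau - 1 - INR n) i).
  assert (Cv : ex_finite_lim_seq u).
  { apply ex_lim_seq_cauchy_corr. intros eps.
    assert (He : 0 < eps / 2) by (pose proof (cond_pos eps); lra).
    destruct (rate_small tau (eps / 2) He) as [S [HS HR]].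
    destruct (INR_unbounded (tau - 1 - S)) as [N HN].
    exists N.
    assert (G : forall n, (N <= n)%nat -> Rabs (u N - u n) < eps / 2).
    { intros n Hn. apply le_INR in Hn. pose proof (pos_INR N). unfold u.
      eapply Rle_lt_trans; [apply (gcoef_diff tau (tau - 1 - INR N) (tau - 1 - INR n) i); lra|].
      apply HR. lra. }
    intros n m Hn Hm. assert (G1 := G n Hn). assert (G2 := G m Hm).
    apply Rabs_def2 in G1. apply Rabs_def2 in G2. apply Rabs_def1; lra. }
  destruct Cv as [l Hl].
  assert (El : glim tau i = l) by (unfold glim; fold u; rewrite (is_lim_seq_unique _ _ Hl); reflexivity).
  rewrite El.
  assert (L : is_lim_seq (fun n => Rabs (gcoef tau s i - u n)) (Rabs (gcoef tau s i - l))).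
  { apply (is_lim_seq_abs _ (Finite (gcoef tau s i - l))).
    apply is_lim_seq_minus'; [apply is_lim_seq_const|exact Hl]. }
  destruct (INR_unbounded (tau - 1 - s)) as [N HN].
  apply (is_lim_seq_le_loc (fun n => Rabs (gcoef tau s i - u n)) (fun _ => rate tau s)
    (Rabs (gcoef tau s i - l)) (rate tau s)); [|exact L|apply is_lim_seq_const].
  exists N. intros n Hn. apply le_INR in Hn. unfold u. apply (gcoef_diff tau s (tau - 1 - INR n) i); lra.
Qed.

Lemma glim_bound tau : exists N, 0 <= N /\ (forall i, Rabs (glim tau i) <= N) /\
  (forall s i, s < tau -> Rabs (gcoef tau s i) <= N).
Proof.
  exists (exp 2 + rate tau (tau - 1)).
  assert (0 < rate tau (tau - 1)).
  { unfold rate. pose proof (exp_pos 2). apply Rmult_lt_0_compat; [lra|apply exp_pos]. }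
  pose proof (exp_pos 2). split; [lra|split].
  - intros i. assert (G := glim_diff tau (tau - 1) i ltac:(lra)).
    assert (G' := gcoef_bound tau (tau - 1) i ltac:(lra)).
    apply Rabs_le_between in G. apply Rabs_le_between in G'. apply Rabs_le. lra.
  - intros s i Hs. assert (G' := gcoef_bound tau s i Hs). lra.
Qed.

(** A constant factor in the transform does not change the velocity, so restarting from the
    normalised transform gives the same solution, by uniqueness. All solutions are thereby launched
    at the common time [tau], with constants independent of [s]. *)
Lemma Vsol_restart tau s t x : s < tau -> tau <= t ->
  Vsol s t x = cole (hflow tau (gcoef tau s)) t x.
Proof.
  intros Hs Ht.
  assert (HPhi : forall y, exp (-2) <= Phi tau s y) by (intros y; apply Phi_bounds; lra).
  destruct (init_smooth tau (Phi tau s) (exp (-2)) (Phi_Ck tau s Hs) (Phi_periodic tau s) (exp_pos _) HPhi) as [_ Sm].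
  apply (force_unique tau _ _ _ _ _ _ Sm (smooth_solution_restrict f s tau _ _ _ ltac:(lra) (Vsol_smooth s))); [|exact Ht].
  intros y. unfold cole, Vsol.
  rewrite phi0_init by (apply Phi_Ck || apply Phi_periodic; exact Hs).
  rewrite (phi1_init tau (Phi tau s) (fun y => phi cm (Psol s) 1 tau y / phi cm (Psol s) 0 tau 0)).
  - unfold cole, Phi. field. split; apply Rgt_not_eq, Psol_pos; lra.
  - apply Phi_Ck, Hs.
  - apply Phi_periodic.
  - intros z. unfold Phi. apply (is_derive_ext (fun x => / phi cm (Psol s) 0 tau 0 * phi cm (Psol s) 0 tau x)).
    { intros y'. unfold Rdiv. apply Rmult_comm. }
    unfold Rdiv. rewrite Rmult_comm. apply (is_derive_scal (phi cm (Psol s) 0 tau)).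
    apply (phi_derive_x pc ps cm s (Psol s)); [|lia|lra].
    apply init_solution; [apply Ck_const|intros y'; reflexivity].
Qed.

(** The flow is linear, so the difference evolves from a datum of size [rate tau s]; the strict
    delay upgrades this sup bound to decay of order 3, enough for one space derivative. *)
Lemma phi_restart_diff tau t : tau < t -> exists C, 0 <= C /\ forall s x n, s < tau -> (n <= 1)%nat ->
  Rabs (phi cm (hflow tau (gcoef tau s)) n t x - phi cm (hflow tau (glim tau)) n t x) <= C * rate tau s.
Proof.
  intros Ht. assert (He : 0 < t - tau) by lra.
  destruct (glim_bound tau) as [N [HN [HB1 HB2]]].
  destruct (heat_flow_decay pc ps Q pc_cont ps_cont pc_bound ps_bound tau (t - tau) t 3 He) as [C [HC HB]].
  assert (Z0 : 0 <= Series zbound).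
  { eapply Rle_trans; [apply Rabs_pos|apply (Series_abs_le (fun _ => 0) zbound); [|apply ex_series_zbound]].
    intros n. rewrite Rabs_R0. apply Rmult_le_pos; [lra|]. left. apply Rinv_0_lt_compat, pow_lt.
    pose proof (pos_INR n). lra. }
  exists (2 * C * Series zbound). split; [apply Rmult_le_pos; lra|].
  intros s x n Hs Hn.
  set (q := hflow tau (gcoef tau s) t). set (q' := hflow tau (glim tau) t).
  assert (D1 : decay 3 (C * N) q) by (apply HB; [auto|lra]).
  assert (D2 : decay 3 (C * N) q') by (apply HB; [auto|lra]).
  assert (D3 : decay 3 (C * rate tau s) (fun i => q i + -1 * q' i)).
  { intros k b. assert (E := heat_flow_minus pc ps Q pc_cont ps_cont pc_bound ps_bound tau
      (gcoef tau s) (glim tau) N t (fun i => HB2 s i Hs) HB1 ltac:(lra) (k, b)).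
    replace (q (k, b) + -1 * q' (k, b)) with (hflow tau (fun j => gcoef tau s j - glim tau j) t (k, b)).
    - apply HB; [|lra]. intros i. apply glim_diff, Hs.
    - unfold q, q', hflow. rewrite E. ring. }
  assert (G : forall (r r' : coefs) y, decay 2 (C * N) r -> decay 2 (C * N) r' ->
     decay 2 (C * rate tau s) (fun i => r i + -1 * r' i) ->
     Rabs (trig r y - trig r' y) <= 2 * C * Series zbound * rate tau s).
  { intros r r' y Hr Hr' Hrr. replace (trig r y - trig r' y) with (trig (fun i => r i + -1 * r' i) y).
    - replace (2 * C * Series zbound * rate tau s) with (2 * (C * rate tau s) * Series zbound) by ring.
      apply trig_bound, Hrr.
    - rewrite (trig_plus (C * N) (Rabs (-1) * (C * N)) r (fun i => -1 * r' i)); [|exact Hr|apply decay_scal, Hr'].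
      rewrite trig_scal. ring. }
  unfold phi. destruct n as [|[|n]]; [| |lia].
  - apply G; [apply (decay_mono 3 2 (C * N) (C * N)); [lia|lra|exact D1]
      |apply (decay_mono 3 2 (C * N) (C * N)); [lia|lra|exact D2]
      |apply (decay_mono 3 2 (C * rate tau s) (C * rate tau s)); [lia|lra|exact D3]].
  - apply G; [apply decay_dcoef, D1|apply decay_dcoef, D2|].
    intros k b. assert (E := decay_dcoef 2 _ _ D3 k b).
    replace (dcoefs (hflow tau (gcoef tau s)) 1 t (k, b) + -1 * dcoefs (hflow tau (glim tau)) 1 t (k, b))
      with (dcoef (fun i => q i + -1 * q' i) (k, b)); [exact E|].
    change (dcoef (fun i => q i + -1 * q' i) (k, b) = dcoef q (k, b) + -1 * dcoef q' (k, b)).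
    destruct b; cbn [dcoef]; ring.
Qed.

(** The form in which the limits as [s] tends to minus infinity are taken below. *)
Lemma le_of_rate_limit tau a b C : 0 <= C -> (forall s, s < tau -> a <= b + C * rate tau s) -> a <= b.
Proof.
  intros HC H. apply Rnot_lt_le. intros Hlt.
  assert (He : 0 < (a - b) / (2 * (C + 1))) by (apply Rdiv_lt_0_compat; lra).
  destruct (rate_small tau _ He) as [S [HS HR]].
  specialize (H S HS). specialize (HR S (Rle_refl S)).
  assert (C * rate tau S <= C * ((a - b) / (2 * (C + 1)))) by (apply Rmult_le_compat_l; lra).
  assert (C * ((a - b) / (2 * (C + 1))) <= (a - b) / 2).
  { apply (Rmult_le_reg_r (2 * (C + 1))); [lra|].
    replace (C * ((a - b) / (2 * (C + 1))) * (2 * (C + 1))) with (C * (a - b)) by (field; lra).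
    replace ((a - b) / 2 * (2 * (C + 1))) with ((C + 1) * (a - b)) by field. nra. }
  lra.
Qed.

(** Independent of [s], hence inherited by the limit, where it keeps the Cole-Hopf quotient
    defined. *)
Definition floor_phi (tau t : R) : R := exp (-2) * exp (- (6 * Q + 1) * (t - tau)).

Lemma phi_restart_lower tau s t x : s < tau -> tau <= t ->
  floor_phi tau t <= phi cm (hflow tau (gcoef tau s)) 0 t x.
Proof.
  intros Hs Ht.
  apply (phi0_init_bound tau (Phi tau s)); auto; [apply Phi_Ck, Hs|apply Phi_periodic|apply exp_pos|].
  intros y. apply Phi_bounds. lra.
Qed.

Lemma phi_glim_lower tau t x : tau < t -> floor_phi tau t <= phi cm (hflow tau (glim tau)) 0 t x.
Proof.
  intros Ht. destruct (phi_restart_diff tau t Ht) as [C [HC HB]].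
  apply (le_of_rate_limit tau _ _ C HC). intros s Hs.
  assert (H1 := HB s x 0%nat Hs ltac:(lia)). assert (H2 := phi_restart_lower tau s t x Hs ltac:(lra)).
  apply Rabs_le_between in H1. lra.
Qed.

Definition Vlim (tau : R) : R -> R -> R := cole (hflow tau (glim tau)).

Lemma Vsol_Vlim tau t : tau < t -> exists M, 0 <= M /\ forall s x, s < tau ->
  Rabs (Vsol s t x - Vlim tau t x) <= M * rate tau s.
Proof.
  intros Ht. destruct (phi_restart_diff tau t Ht) as [C [HC HB]].
  assert (Hfl : 0 < floor_phi tau t) by (apply Rmult_lt_0_compat; apply exp_pos).
  assert (He : 0 < t - tau) by lra.
  destruct (glim_bound tau) as [N [HN [HB1 HB2]]].
  destruct (heat_flow_decay pc ps Q pc_cont ps_cont pc_bound ps_bound tau (t - tau) t 3 He) as [C' [HC' HB']].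
  set (M1 := 2 * (C' * N) * Series zbound).
  assert (HM1 : forall x, Rabs (phi cm (hflow tau (glim tau)) 1 t x) <= M1).
  { intros x. apply trig_bound. apply decay_dcoef. apply HB'; [exact HB1|lra]. }
  assert (HM1' : 0 <= M1) by (eapply Rle_trans; [apply Rabs_pos|apply (HM1 0)]).
  set (K := 1 / floor_phi tau t + M1 / (floor_phi tau t * floor_phi tau t)).
  assert (HK : 0 <= K).
  { apply Rplus_le_le_0_compat; apply Rmult_le_pos; try lra; left; apply Rinv_0_lt_compat; nra. }
  exists (4 * (K * C)). split; [apply Rmult_le_pos; [lra|apply Rmult_le_pos; assumption]|].
  intros s x Hs. rewrite (Vsol_restart tau s t x Hs) by lra. unfold Vlim, cole.
  replace (_ - _ - _) with (-4 * (phi cm (hflow tau (gcoef tau s)) 1 t x / phi cm (hflow tau (gcoef tau s)) 0 t x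
    - phi cm (hflow tau (glim tau)) 1 t x / phi cm (hflow tau (glim tau)) 0 t x)) by ring.
  rewrite Rabs_mult, Rabs_left by lra.
  replace (4 * (K * C) * rate tau s) with (- -4 * (K * (C * rate tau s))) by ring.
  apply Rmult_le_compat_l; [lra|]. unfold K.
  apply ratio_diff_bound; auto.
  - apply phi_restart_lower; [exact Hs|lra].
  - apply phi_glim_lower, Ht.
Qed.

Lemma Vlim_smooth tau eta : 0 < eta ->
  smooth_solution f (tau + eta) (Vlim tau) (cole1 (hflow tau (glim tau))) (cole2 (hflow tau (glim tau))).
Proof.
  intros He. destruct (glim_bound tau) as [N [HN [HB1 _]]].
  apply (cole_hopf A B Q A_bound B_bound (tau + eta) (hflow tau (glim tau))).
  - apply (heat_flow_solution_later pc ps Q pc_cont ps_cont pc_bound ps_bound tau eta N _ He HB1).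
  - intros t x Ht. eapply Rlt_le_trans; [|apply phi_glim_lower; lra].
    apply Rmult_lt_0_compat; apply exp_pos.
Qed.

(** The restart time t - 1 is an arbitrary choice before [t], by [Vlim_independent]. *)
Definition attractor (t x : R) : R := Vlim (t - 1) t x.

(** Both values are the limit of [Vsol s t x] as [s] tends to minus infinity. *)
Lemma Vlim_independent tau tau' t x : tau < t -> tau' < t -> Vlim tau t x = Vlim tau' t x.
Proof.
  assert (G : forall tau tau', tau <= tau' -> tau' < t -> Vlim tau t x = Vlim tau' t x).
  { clear tau tau'. intros tau tau' H1 H2.
    destruct (Vsol_Vlim tau t ltac:(lra)) as [M [HM HB]].
    destruct (Vsol_Vlim tau' t ltac:(lra)) as [M' [HM' HB']].
    assert (Hr : forall s, rate tau' s <= rate tau s).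
    { intros s. unfold rate. apply Rmult_le_compat_l; [pose proof (exp_pos 2); lra|].
      apply exp_le_compat. lra. }
    assert (Z : Rabs (Vlim tau t x - Vlim tau' t x) <= 0).
    { apply (le_of_rate_limit tau _ _ (M + M')); [lra|]. intros s Hs.
      assert (B1 := HB s x Hs). assert (B2 := HB' s x ltac:(lra)).
      assert (M' * rate tau' s <= M' * rate tau s) by (apply Rmult_le_compat_l; auto).
      apply Rabs_le_between in B1. apply Rabs_le_between in B2. apply Rabs_le. lra. }
    apply Rminus_diag_uniq. pose proof (Rabs_pos (Vlim tau t x - Vlim tau' t x)).
    apply Rabs_eq_0. lra. }
  intros H1 H2. destruct (Rle_dec tau tau'); [apply G; lra|symmetry; apply G; lra].
Qed.

Lemma attractor_eq tau t x : tau < t -> attractor t x = Vlim tau t x.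
Proof. intros Ht. unfold attractor. apply Vlim_independent; lra. Qed.

Lemma attractor_classical : classical_solution 2 f (fun _ => True) attractor.
Proof.
  assert (J : forall t, exists tau, tau + 1 < t /\ forall s y, Rabs (s - t) < 1 -> attractor s y = Vlim tau s y).
  (* One fixed restart time serves a whole neighbourhood of [t], so local properties of [Vlim tau]
     pass to [attractor]. *)
  { intros t. exists (t - 3). split; [lra|]. intros s y Hs. apply Rabs_def2 in Hs. apply attractor_eq. lra. }
  split.
  - intros t x _. destruct (J t) as [tau [H1 H2]].
    assert (Sm := Vlim_smooth tau 1 Rlt_0_1).
    rewrite (H2 t x) by (rewrite Rminus_diag, Rabs_R0; lra).
    apply filterlim_locally. intros eps.
    destruct (jcont_eps _ _ (ss_jcont _ _ _ _ _ Sm) t x ltac:(lra) eps) as [del Hdel].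
    assert (Hm : 0 < Rmin del (Rmin 1 (t - (tau + 1)))).
    { apply Rmin_glb_lt; [apply cond_pos|]. apply Rmin_glb_lt; lra. }
    exists (mkposreal _ Hm). intros [s y] [Hs Hy] _. cbn [fst snd] in *.
    change (Rabs (s - t) < Rmin del (Rmin 1 (t - (tau + 1)))) in Hs.
    change (Rabs (y - x) < Rmin del (Rmin 1 (t - (tau + 1)))) in Hy.
    assert (A1 := Rlt_le_trans _ _ _ Hs (Rmin_l _ _)). assert (A2 := Rlt_le_trans _ _ _ Hs (Rmin_r _ _)).
    assert (A3 := Rlt_le_trans _ _ _ A2 (Rmin_l _ _)). assert (A4 := Rlt_le_trans _ _ _ A2 (Rmin_r _ _)).
    assert (A5 := Rlt_le_trans _ _ _ Hy (Rmin_l _ _)).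
    rewrite (H2 s y A3). apply Hdel; [|exact A1|exact A5]. apply Rabs_def2 in A4. lra.
  - intros t _ x. destruct (J t) as [tau [H1 H2]].
    assert (Ht : Rabs (t - t) < 1) by (rewrite Rminus_diag, Rabs_R0; lra).
    rewrite (H2 t (x + 2 * PI) Ht), (H2 t x Ht). apply (ss_periodic _ _ _ _ _ (Vlim_smooth tau 1 Rlt_0_1)). lra.
  - intros t x _. destruct (J t) as [tau [H1 H2]].
    assert (Ht : Rabs (t - t) < 1) by (rewrite Rminus_diag, Rabs_R0; lra).
    assert (Sm := Vlim_smooth tau 1 Rlt_0_1).
    set (u1 := cole1 (hflow tau (glim tau))) in Sm. set (u2 := cole2 (hflow tau (glim tau))) in Sm.
    assert (Dx : forall y, is_derive (attractor t) y (u1 t y)).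
    { intros y. apply (is_derive_ext (Vlim tau t)); [intros z; symmetry; apply H2, Ht|].
      apply (ss_derive _ _ _ _ _ Sm). lra. }
    exists (f t x - Vlim tau t x * u1 t x + 2 * u2 t x), (u1 t x), (u2 t x).
    split; [|split; [|split]].
    + apply is_derive_within_of_derive.
      * intros e. pose proof (cond_pos e). exists (t + e / 2).
        replace (t + e / 2 - t) with (e / 2) by ring. rewrite Rabs_pos_eq by lra.
        split; [exact I|lra].
      * apply (is_derive_ext_loc (fun s => Vlim tau s x)).
        { exists (mkposreal 1 Rlt_0_1). intros s Hs. symmetry. apply H2, Hs. }
        apply (ss_derive_t _ _ _ _ _ Sm). lra.
    + apply Dx.
    + apply (is_derive_2_intro (attractor t) (u1 t)); [exact Dx|].
      apply (ss_derive1 _ _ _ _ _ Sm). lra.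
    + rewrite (H2 t x Ht). ring.
Qed.

Lemma Vsol_attractor t : exists M, 0 <= M /\ forall s x, s < t - 1 ->
  Rabs (Vsol s t x - attractor t x) <= M * rate (t - 1) s.
Proof. apply (Vsol_Vlim (t - 1) t). lra. Qed.

Lemma smooth_solution_shift T s u u1 u2 : (forall t x, f (t + T) x = f t x) ->
  smooth_solution f s u u1 u2 ->
  smooth_solution f (s - T) (fun t => u (t + T)) (fun t => u1 (t + T)) (fun t => u2 (t + T)).
Proof.
  intros Hf H.
  assert (J : forall g, jcont (fun t => s <= t) g -> jcont (fun t => s - T <= t) (fun t => g (t + T))).
  { intros g Hg t x Ht. apply filterlim_locally. intros eps.
    destruct (jcont_eps _ _ Hg (t + T) x ltac:(lra) eps) as [del Hdel].
    exists del. intros [r y] [Hr Hy] Hr0. cbn [fst snd] in *. apply Hdel; [lra| |exact Hy].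
    change (Rabs (r - t) < del) in Hr. replace (r + T - (t + T)) with (r - t) by ring. exact Hr. }
  split; intros; try (apply (J u)); try (apply (J u1)); try (apply (J u2)); try (apply H; lra).
  rewrite <- Hf. evar_last.
  - apply (is_derive_comp (fun r => u r x) (fun t => t + T) t); [apply (ss_derive_t _ _ _ _ _ H); lra|].
    instantiate (1 := 1). auto_derive; auto.
  - change scal with Rmult. eqR. ring.
Qed.

(** Shifting time by [T] maps the solution launched at [s] to the one launched at s - T, and both
    families have the same limit. *)
Lemma attractor_time_periodic T : (forall t x, f (t + T) x = f t x) ->
  forall t x, attractor (t + T) x = attractor t x.
Proof.
  intros Hf t x.
  assert (Sh : forall s, s <= t + T -> Vsol s (t + T) x = Vsol (s - T) t x).
  { intros s Hs.
    apply (force_unique (s - T) _ _ _ _ _ _ (Vsol_smooth (s - T)) (smooth_solution_shift T s _ _ _ Hf (Vsol_smooth s))); [|lra].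
    intros y. replace (s - T + T) with s by ring. rewrite !Vsol_init. reflexivity. }
  destruct (Vsol_attractor (t + T)) as [M [HM HB]]. destruct (Vsol_attractor t) as [M' [HM' HB']].
  assert (Z : Rabs (attractor (t + T) x - attractor t x) <= 0).
  { apply (le_of_rate_limit (t - 1) _ _ (M + M')); [lra|]. intros s Hs.
    assert (B1 := HB (s + T) x ltac:(lra)). assert (B2 := HB' s x Hs).
    rewrite Sh in B1 by lra. replace (s + T - T) with s in B1 by ring.
    replace (rate (t + T - 1) (s + T)) with (rate (t - 1) s) in B1 by (unfold rate; do 2 f_equal; ring).
    apply Rabs_le_between in B1. apply Rabs_le_between in B2. apply Rabs_le. lra. }
  apply Rminus_diag_uniq, Rabs_eq_0. pose proof (Rabs_pos (attractor (t + T) x - attractor t x)). lra.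
Qed.

End Attractor.

(** * Admissible initial data *)

Lemma class_C_Ck n u : class_C n u -> Ck n u.
Proof.
  intros [Hd Hc].
  assert (G : forall m k, (m + k = n)%nat -> Ck m (Derive_n u k)).
  { induction m as [|m IH]; intros k Hk.
    - simpl in Hk. subst k. exact Hc.
    - exists (Derive_n u (S k)). split; [|apply IH; lia].
      intros x. apply Derive_correct. apply (Hd (S k) x). lia. }
  apply (G n 0%nat). lia.
Qed.

(* Cole-Hopf transform of the datum: [u0 = cm - 4 w' / w]. *)
Definition hopf_datum (u0 : R -> R) (x : R) : R := exp (- (1 / 4) * RInt (fun y => u0 y - cm) 0 x).

Lemma hopf_datum_derive u0 x : (forall y, continuous u0 y) ->
  is_derive (hopf_datum u0) x (- (1 / 4) * (u0 x - cm) * hopf_datum u0 x).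
Proof.
  intros Hc. assert (Hc' : forall y, continuous (fun y => u0 y - cm) y) by (intros y; cont_tac).
  evar_last.
  - apply (is_derive_comp exp (fun x => - (1 / 4) * RInt (fun y => u0 y - cm) 0 x)).
    + apply is_derive_Reals, derivable_pt_lim_exp.
    + apply (is_derive_scal (fun x => RInt (fun y => u0 y - cm) 0 x)).
      apply (is_derive_RInt (fun y => u0 y - cm) (fun x => RInt (fun y => u0 y - cm) 0 x) 0 x); [|apply Hc'].
      apply filter_forall. intros b. apply (RInt_correct (V := R_CompleteNormedModule)), ex_RInt_cont, Hc'.
  - change scal with Rmult. reflexivity.
Qed.

(** The gain of one derivative gives regularity 5 for a datum of class 4, matching the decay asked
    in [heat_solution]. *)
Lemma hopf_datum_Ck n u0 : Ck n u0 -> Ck (S n) (hopf_datum u0).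
Proof.
  intros Hu. apply (Ck_log_derivative n (fun x => - (1 / 4) * (u0 x + - cm))).
  - apply Ck_mult; [apply Ck_const|]. apply Ck_plus; [exact Hu|apply Ck_const].
  - intros x. apply hopf_datum_derive, (Ck_continuous _ _ Hu).
Qed.

(** Here the prescribed integral enters: u0 - cm has mean zero exactly when the integral of u0 is
    PI. *)
Lemma hopf_datum_periodic u0 : (forall y, continuous u0 y) -> space_periodic u0 ->
  RInt u0 0 (2 * PI) = PI -> space_periodic (hopf_datum u0).
Proof.
  intros Hc Hp HI x. unfold hopf_datum. do 2 f_equal.
  assert (Hc' : forall y, continuous (fun y => u0 y - cm) y) by (intros y; cont_tac).
  rewrite <- (RInt_Chasles (fun y => u0 y - cm) 0 x (x + 2 * PI)) by (apply ex_RInt_cont, Hc').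
  rewrite (RInt_period (fun y => u0 y - cm)); [|exact Hc'|intros y; rewrite Hp; reflexivity].
  assert (E : RInt (fun y => u0 y - cm) 0 (2 * PI) = 0).
  { etransitivity.
    - apply (RInt_minus (V := R_CompleteNormedModule) u0 (fun _ => cm) 0 (2 * PI));
        [apply ex_RInt_cont, Hc|apply ex_RInt_const].
    - rewrite HI, RInt_const. change minus with Rminus. change scal with Rmult. unfold cm. eqR. field. }
  rewrite E. change plus with Rplus. apply Rplus_0_r.
Qed.

Lemma hopf_datum_lower u0 : (forall y, continuous u0 y) -> space_periodic (hopf_datum u0) ->
  exists delta, 0 < delta /\ forall x, delta <= hopf_datum u0 x.
Proof.
  intros Hc Hp.
  assert (Ch : forall x, continuous (hopf_datum u0) x) by (intros x; eapply continuous_of_derive, hopf_datum_derive, Hc).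
  destruct (continuity_ab_min (hopf_datum u0) 0 (2 * PI)) as [m [Hm _]].
  - pose proof two_PI_pos. lra.
  - intros x _. apply continuity_pt_filterlim, Ch.
  - exists (hopf_datum u0 m). split; [apply exp_pos|]. intros x.
    destruct (reduce_mod_period x) as [y [Hy E]]. rewrite (E _ Hp). apply Hm, Hy.
Qed.

(** * Fourier distance *)

Lemma fourier_coef_fourier w k : (forall x, continuous w x) ->
  fourier_coef w k = (fourier w (k, true), - fourier w (k, false)).
Proof.
  intros Hw. unfold fourier_coef. cbn [fourier].
  set (ic := RInt (fun x => w x * cos (IZR k * x)) 0 (2 * PI)).
  set (is := RInt (fun x => w x * sin (IZR k * x)) 0 (2 * PI)).
  assert (E : is_RInt (V := C_R_NormedModule) (fun x => Cmult (RtoC (w x)) (cexpi (- (IZR k * x)))) 0 (2 * PI) (ic, - is)).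
  { apply (is_RInt_fct_extend_pair (U := R_NormedModule) (V := R_NormedModule)).
    - apply (is_RInt_ext (fun x => w x * cos (IZR k * x))).
      + intros x _. simpl. rewrite cos_neg. ring.
      + apply (RInt_correct (V := R_CompleteNormedModule)), ex_RInt_cont. intros x.
        apply continuous_mult_R; [apply Hw|apply continuous_cos_lin].
    - apply (is_RInt_ext (fun x => opp (w x * sin (IZR k * x)))).
      + intros x _. change opp with Ropp. simpl. rewrite sin_neg. ring.
      + apply (is_RInt_opp (V := R_NormedModule)).
        apply (RInt_correct (V := R_CompleteNormedModule)), ex_RInt_cont. intros x.
        apply continuous_mult_R; [apply Hw|apply continuous_sin_lin]. }
  rewrite (is_RInt_unique (V := C_R_CompleteNormedModule) _ _ _ _ E).
  unfold Cmult, RtoC. cbn [fst snd]. pose proof two_PI_pos. f_equal; field; lra.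
Qed.

Lemma fourier_sqr_le w i : (forall x, continuous w x) ->
  fourier w i * fourier w i <= RInt (fun x => w x * w x) 0 (2 * PI).
Proof.
  intros Hw. pose proof PI_RGT_0 as HPI. pose proof PI2_3_2.
  set (G := RInt (fun x => w x * w x) 0 (2 * PI)).
  assert (HG : 0 <= G) by (apply RInt_nonneg_cont; [lra|intros x; cont_tac|intros; apply Rle_0_sqr]).
  assert (P : forall e : R -> R, (forall x, continuous e x) -> (forall x, Rabs (e x) <= 1) ->
    (/ (2 * PI) * RInt (fun x => w x * e x) 0 (2 * PI)) * (/ (2 * PI) * RInt (fun x => w x * e x) 0 (2 * PI)) <= G).
  { intros e Ce He.
    assert (Cwe : forall x, continuous (fun x => w x * e x) x) by (intros x; cont_tac).
    assert (S := RInt_sqr_le (fun x => w x * e x) 0 (2 * PI) (2 * PI) Cwe ltac:(lra)).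
    assert (L : RInt (fun x => w x * e x * (w x * e x)) 0 (2 * PI) <= G).
    { apply RInt_le_cont; [lra|intros x; cont_tac|intros x; cont_tac|]. intros x _.
      specialize (He x). apply Rabs_le_between in He.
      replace (w x * e x * (w x * e x)) with ((w x * w x) * (e x * e x)) by ring.
      rewrite <- (Rmult_1_r (w x * w x)) at 2. apply Rmult_le_compat_l; [apply Rle_0_sqr|nra]. }
    set (X := RInt (fun x => w x * e x) 0 (2 * PI)) in *.
    assert (X * X <= 2 * PI * G).
    { eapply Rle_trans; [exact S|]. rewrite Rminus_0_r. apply Rmult_le_compat_l; lra. }
    replace (/ (2 * PI) * X * (/ (2 * PI) * X)) with (X * X * / (2 * PI * (2 * PI))) by (field; lra).
    apply (Rmult_le_reg_r (2 * PI * (2 * PI))); [nra|].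
    rewrite Rmult_assoc, Rinv_l, Rmult_1_r by nra. nra. }
  destruct i as [k [|]]; cbn [fourier]; apply P; intros x;
    auto using continuous_cos_lin, continuous_sin_lin, Rabs_cos_le, Rabs_sin_le.
Qed.

Lemma fourier_sup_dist_le u v m : 0 <= m -> (forall x, continuous u x) -> (forall x, continuous v x) ->
  RInt (fun x => (u x - v x) * (u x - v x)) 0 (2 * PI) <= m * m ->
  Rbar_le (fourier_sup_dist u v) (Finite (2 * m)).
Proof.
  intros Hm Cu Cv HG. unfold fourier_sup_dist.
  apply (proj2 (Lub_Rbar_correct _)). intros r [k ->].
  rewrite !fourier_coef_fourier by assumption.
  assert (G : forall b, Rabs (fourier u (k, b) - fourier v (k, b)) <= m).
  { intros b. rewrite <- fourier_minus by assumption. apply Rabs_le_of_sqr; [exact Hm|].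
    eapply Rle_trans; [apply fourier_sqr_le; intros x; cont_tac|exact HG]. }
  assert (G1 := G true). assert (G2 := G false). clear G. revert G1 G2.
  generalize (fourier u (k, true)) (fourier v (k, true)) (fourier u (k, false)) (fourier v (k, false)).
  intros a a' b b' G1 G2.
  (* Real and imaginary parts are at most [m] each; sqrt 2 is rounded up to 2. *)
  eapply (Rbar_le_trans _ (Finite (sqrt 2 * m))).
  - simpl. eapply Rle_trans; [apply Cmod_2Rmax|]. apply Rmult_le_compat_l; [apply sqrt_pos|].
    apply Rmax_lub; simpl.
    + exact G1.
    + replace (- b + - - b') with (- (b - b')) by ring.
      rewrite Rabs_Ropp. exact G2.
  - simpl. apply Rmult_le_compat_r; [exact Hm|].
    rewrite <- (sqrt_square 2) at 2 by lra. apply sqrt_le_1; lra.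
Qed.

(** * The given forcing *)

Section Forcing.

Variables beta gamma : nat -> R -> R.

(** The value 0 outside 1, 2, 3 makes continuity and bounds hold for all indices, while the
    hypotheses on [beta] and [gamma] cover these three only. *)
Definition fcos (j : nat) (t : R) : R :=
  match j with
  | 1%nat => - 0.6 * sin t + gamma 1%nat t
  | 2%nat => 0.7 + 0.7 * sin t + gamma 2%nat t
  | 3%nat => - 0.8 - 0.8 * sin t + gamma 3%nat t
  | _ => 0
  end.

Definition fsin (j : nat) (t : R) : R :=
  match j with
  | 1%nat => - 0.6 + beta 1%nat t
  | 2%nat => 0.7 + 0.7 * sin t + beta 2%nat t
  | 3%nat => - 0.8 - 0.8 * sin t + beta 3%nat t
  | _ => 0
  end.

Lemma forcing_trig : forcing beta gamma = trig_force fcos fsin.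
Proof.
  apply functional_extensionality; intros t. apply functional_extensionality; intros x.
  unfold forcing, trig_force. cbn [fcos fsin].
  rewrite (sum_Sn_m _ 1 3), (sum_Sn_m _ 2 3), sum_n_n by lia.
  change plus with Rplus.
  replace (INR 1) with 1 by reflexivity. replace (INR 2) with 2 by (simpl; ring).
  replace (INR 3) with 3 by (simpl; ring). rewrite Rmult_1_l. lra.
Qed.

Hypothesis coef_cont : forall (k : nat) (t : R), (1 <= k <= 3)%nat ->
  continuous (beta k) t /\ continuous (gamma k) t.
Hypothesis coef_bound : forall (k : nat) (t : R), (1 <= k <= 3)%nat ->
  - 5e-5 <= beta k t <= 5e-5 /\ - 5e-5 <= gamma k t <= 5e-5.

Lemma continuous_sin_R t : continuous sin t.
Proof. eapply continuous_of_derive. apply is_derive_Reals, derivable_pt_lim_sin. Qed.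

Lemma fcos_cont j t : continuous (fcos j) t.
Proof.
  assert (G : forall k, (1 <= k <= 3)%nat -> continuous (gamma k) t) by (intros k Hk; apply coef_cont, Hk).
  destruct j as [|[|[|[|j]]]]; cbn [fcos]; try apply continuous_const;
    apply continuous_plus_R; try (apply G; lia); cont_tac; apply continuous_sin_R.
Qed.

Lemma fsin_cont j t : continuous (fsin j) t.
Proof.
  assert (G : forall k, (1 <= k <= 3)%nat -> continuous (beta k) t) by (intros k Hk; apply coef_cont, Hk).
  destruct j as [|[|[|[|j]]]]; cbn [fsin]; try apply continuous_const;
    apply continuous_plus_R; try (apply G; lia); cont_tac; apply continuous_sin_R.
Qed.

Lemma force_coef_bounds t :
  (Rabs (fcos 1 t) <= 0.601 /\ Rabs (fsin 1 t) <= 0.601) /\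
  (Rabs (fcos 2 t) <= 1.401 /\ Rabs (fsin 2 t) <= 1.401) /\
  (Rabs (fcos 3 t) <= 1.601 /\ Rabs (fsin 3 t) <= 1.601).
Proof.
  destruct (coef_bound 1 t ltac:(lia)) as [B1 G1]. destruct (coef_bound 2 t ltac:(lia)) as [B2 G2].
  destruct (coef_bound 3 t ltac:(lia)) as [B3 G3]. pose proof (SIN_bound t). cbn [fcos fsin].
  repeat split; apply Rabs_le; lra.
Qed.

Lemma fcos_bound j t : Rabs (fcos j t) <= 2.
Proof.
  destruct (force_coef_bounds t) as [[H1 _] [[H2 _] [H3 _]]].
  destruct j as [|[|[|[|j]]]]; try lra; cbn [fcos]; rewrite Rabs_R0; lra.
Qed.

Lemma fsin_bound j t : Rabs (fsin j t) <= 2.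
Proof.
  destruct (force_coef_bounds t) as [[_ H1] [[_ H2] [_ H3]]].
  destruct j as [|[|[|[|j]]]]; try lra; cbn [fsin]; rewrite Rabs_R0; lra.
Qed.

(** The mean-zero primitive, which has the least L2 norm among all primitives. *)
Definition fprim (t x : R) : R :=
  (- fsin 1 t * cos (1 * x) + fcos 1 t * sin (1 * x))
  + (- fsin 2 t / 2 * cos (2 * x) + fcos 2 t / 2 * sin (2 * x))
  + (- fsin 3 t / 3 * cos (3 * x) + fcos 3 t / 3 * sin (3 * x)).

Lemma fprim_derive t x : is_derive (fprim t) x (trig_force fcos fsin t x).
Proof.
  unfold fprim, trig_force. generalize (fsin 1 t) (fsin 2 t) (fsin 3 t) (fcos 1 t) (fcos 2 t) (fcos 3 t).
  intros. auto_derive; auto. field.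
Qed.

Lemma fprim_periodic t : space_periodic (fprim t).
Proof.
  intros x. unfold fprim. rewrite !Rmult_plus_distr_l.
  assert (G : forall k : Z, cos (IZR k * x + IZR k * (2 * PI)) = cos (IZR k * x) /\
     sin (IZR k * x + IZR k * (2 * PI)) = sin (IZR k * x)).
  { intros k. destruct (cos_sin_2kPI k) as [E1 E2]. rewrite cos_plus, sin_plus, E1, E2. split; ring. }
  destruct (G 1%Z) as [-> ->]. destruct (G 2%Z) as [-> ->]. destruct (G 3%Z) as [-> ->]. reflexivity.
Qed.

Lemma RInt_two_modes (a b a' b' : R) (k m : Z) : (0 < k)%Z -> (0 < m)%Z ->
  RInt (fun x => (a * cos (IZR k * x) + b * sin (IZR k * x)) * (a' * cos (IZR m * x) + b' * sin (IZR m * x))) 0 (2 * PI)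
  = if Z.eq_dec k m then PI * (a * a' + b * b') else 0.
Proof.
  intros Hk Hm.
  rewrite (RInt_ext _ (fun x => 1 * (a * a' * (cos (IZR k * x) * cos (IZR m * x)) + a * b' * (sin (IZR m * x) * cos (IZR k * x)))
     + 1 * (b * a' * (sin (IZR k * x) * cos (IZR m * x)) + b * b' * (sin (IZR k * x) * sin (IZR m * x))))).
  - assert (C1 : forall j x, continuous (fun x => cos (IZR j * x)) x) by (intros; apply continuous_cos_lin).
    assert (C2 : forall j x, continuous (fun x => sin (IZR j * x)) x) by (intros; apply continuous_sin_lin).
    rewrite !RInt_lin2 by (intros x; cont_tac).
    rewrite RInt_cos_cos, !RInt_sin_cos, RInt_sin_sin.
    destruct (Z.eq_dec k m); destruct (Z.eq_dec k (- m)); try lia; eqR; ring.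
  - intros x _. eqR. ring.
Qed.

Lemma fprim_norm t : RInt (fun x => fprim t x * fprim t x) 0 (2 * PI) <= 8.
Proof.
  set (G := fun (k : Z) (a b : R) x => a * cos (IZR k * x) + b * sin (IZR k * x)).
  assert (CG : forall k a b x, continuous (G k a b) x).
  { intros k a b x. apply continuous_plus_R; apply continuous_mult_R; try apply continuous_const;
      [apply continuous_cos_lin|apply continuous_sin_lin]. }
  assert (CGG : forall k a b k' a' b' x, continuous (fun x => G k a b x * G k' a' b' x) x).
  { intros. apply continuous_mult_R; apply CG. }
  destruct (force_coef_bounds t) as [[H1 H1'] [[H2 H2'] [H3 H3']]].
  set (a1 := - fsin 1 t). set (b1 := fcos 1 t). set (a2 := - fsin 2 t / 2). set (b2 := fcos 2 t / 2).
  set (a3 := - fsin 3 t / 3). set (b3 := fcos 3 t / 3).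
  rewrite (RInt_ext _ (fun x => 1 * (1 * (1 * (G 1%Z a1 b1 x * G 1%Z a1 b1 x) + 1 * (G 2%Z a2 b2 x * G 2%Z a2 b2 x))
      + 1 * (G 3%Z a3 b3 x * G 3%Z a3 b3 x))
      + 2 * (1 * (1 * (G 1%Z a1 b1 x * G 2%Z a2 b2 x) + 1 * (G 1%Z a1 b1 x * G 3%Z a3 b3 x))
      + 1 * (G 2%Z a2 b2 x * G 3%Z a3 b3 x)))).
  - rewrite !RInt_lin2 by (intros x; cont_tac). unfold G.
    rewrite !RInt_two_modes by lia.
    repeat (destruct Z.eq_dec; try lia).
    pose proof PI_lt_3_2 as HPI. pose proof PI_RGT_0 as HPI0.
    assert (S : forall y m, Rabs y <= m -> y * y <= m * m).
    { intros y m Hy. apply Rabs_le_between in Hy. nra. }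
    apply S in H1, H1', H2, H2', H3, H3'.
    (* By orthogonality the integral is PI times this sum, and 3.2 times 2.3 is below 8. *)
    assert (T : (a1 * a1 + b1 * b1) + (a2 * a2 + b2 * b2) + (a3 * a3 + b3 * b3) <= 2.3).
    { unfold a1, a2, a3, b1, b2, b3.
      replace (- fsin 1 t * - fsin 1 t) with (fsin 1 t * fsin 1 t) by ring.
      replace (- fsin 2 t / 2 * (- fsin 2 t / 2)) with (fsin 2 t * fsin 2 t / 4) by field.
      replace (fcos 2 t / 2 * (fcos 2 t / 2)) with (fcos 2 t * fcos 2 t / 4) by field.
      replace (- fsin 3 t / 3 * (- fsin 3 t / 3)) with (fsin 3 t * fsin 3 t / 9) by field.
      replace (fcos 3 t / 3 * (fcos 3 t / 3)) with (fcos 3 t * fcos 3 t / 9) by field.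
      lra. }
    set (s := _ + _ + _) in T.
    replace (_ + _) with (PI * s) by (unfold s; ring). 
    apply Rle_trans with (PI * 2.3); [apply Rmult_le_compat_l; lra|lra].
  - intros x _. unfold G, fprim, a1, a2, a3, b1, b2, b3. eqR. ring.
Qed.

Let f := trig_force fcos fsin.
Let f_jcont : forall D, jcont D f := jcont_force fcos fsin fcos_cont fsin_cont.
Let v := attractor fcos fsin.
Let V := Vsol fcos fsin.

Lemma v_classical : classical_solution 2 f (fun _ => True) v.
Proof.
  exact (attractor_classical fcos fsin 2 fcos_cont fsin_cont fcos_bound fsin_bound
    fprim fprim_derive fprim_periodic fprim_norm).
Qed.

Lemma v_cont t x : continuous (v t) x.
Proof. exact (jcont_slice _ _ (classical_solution_jcont _ _ _ _ v_classical) t x I). Qed.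

(** [Vsol s] stands between [u] and [v]: its distance to [u] decays with a constant independent of
    [s], and its distance to [v] at the fixed time [t] vanishes as [s] tends to minus infinity. *)
Lemma dist2_attractor t0 u u1 u2 : smooth_solution f t0 u u1 u2 ->
  exists K, forall t, t0 <= t -> dist2 u v t <= K * exp (- (1 / 50) * (t - t0)).
Proof.
  intros Hu. pose proof PI_RGT_0 as HPI.
  destruct (exponential_attraction f fprim f_jcont fprim_derive fprim_periodic fprim_norm t0 u u1 u2 Hu)
    as [K HK].
  exists (2 * K). intros t Ht.
  destruct (Vsol_attractor fcos fsin 2 fcos_cont fsin_cont fcos_bound fsin_bound
    fprim fprim_derive fprim_periodic fprim_norm t) as [M [HM HB]].
  fold V in HB. fold v in HB.
  assert (He2 := exp_pos 2).
  (* [s] must precede both [t0] and t - 1. The squared rate is made linear by bounding one factor by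
     2 exp 2, whence the constant. *)
  apply (le_of_rate_limit (Rmin t0 (t - 1)) _ _ (2 * (2 * PI * (M * M * (2 * exp 2))))).
  { repeat (apply Rmult_le_pos; try lra). }
  intros s Hs. assert (Hs1 := Rlt_le_trans _ _ _ Hs (Rmin_l _ _)).
  assert (Hs2 := Rlt_le_trans _ _ _ Hs (Rmin_r _ _)).
  set (r := rate (t - 1) s) in *.
  assert (Hr0 : 0 < r) by (apply Rmult_lt_0_compat; [lra|apply exp_pos]).
  assert (Hr1 : r <= 2 * exp 2).
  { unfold r, rate. rewrite <- (Rmult_1_r (2 * exp 2)) at 2. apply Rmult_le_compat_l; [lra|].
    apply Rle_trans with (exp 0); [apply exp_le_compat; lra|rewrite exp_0; lra]. }
  assert (Hr2 : r <= rate (Rmin t0 (t - 1)) s).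
  { apply Rmult_le_compat_l; [lra|]. apply exp_le_compat. pose proof (Rmin_r t0 (t - 1)). lra. }
  assert (SV := Vsol_smooth fcos fsin 2 fcos_cont fsin_cont fcos_bound fsin_bound s).
  fold V in SV. fold f in SV.
  assert (D2 : dist2 u (V s) t <= K * exp (- (1 / 50) * (t - t0))).
  { apply (HK (V s) _ _ (smooth_solution_restrict f s t0 _ _ _ ltac:(lra) SV)); [|exact Ht].
    intros t' Ht'. apply (Vsol_energy fcos fsin 2 fcos_cont fsin_cont fcos_bound fsin_bound
      fprim fprim_derive fprim_periodic fprim_norm). lra. }
  assert (Cu : forall x, continuous (u t) x) by (intros x; apply (jcont_slice _ _ (ss_jcont _ _ _ _ _ Hu)), Ht).
  assert (Cv : forall x, continuous (v t) x) by (intros x; apply v_cont).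
  assert (CV : forall x, continuous (V s t) x).
  { intros x. apply (jcont_slice _ _ (ss_jcont _ _ _ _ _ SV)). lra. }
  assert (D3 : RInt (fun x => (V s t x - v t x) * (V s t x - v t x)) 0 (2 * PI) <= 2 * PI * (M * M * (2 * exp 2) * r)).
  { replace (2 * PI * (M * M * (2 * exp 2) * r)) with (RInt (fun _ => M * M * (2 * exp 2) * r) 0 (2 * PI)).
    - apply RInt_le_cont; [lra|intros x; cont_tac|intros x; cont_tac|]. intros x _.
      specialize (HB s x Hs2). apply Rabs_le_between in HB.
      assert (0 <= M * r) by (apply Rmult_le_pos; lra).
      apply Rle_trans with ((M * r) * (M * r)).
      { assert (Sq : forall d m, - m <= d <= m -> d * d <= m * m) by (intros d m Hd; nra).
        apply Sq, HB. }
      replace (M * r * (M * r)) with (M * M * r * r) by ring.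
      replace (M * M * (2 * exp 2) * r) with (M * M * r * (2 * exp 2)) by ring.
      apply Rmult_le_compat_l; [|exact Hr1]. apply Rmult_le_pos; [apply Rle_0_sqr|lra].
    - rewrite RInt_const. change scal with Rmult. eqR. ring. }
  assert (D4 : dist2 u v t <= 2 * dist2 u (V s) t + 2 * RInt (fun x => (V s t x - v t x) * (V s t x - v t x)) 0 (2 * PI)).
  { unfold dist2. rewrite <- RInt_lin2 by (intros x; cont_tac).
    apply RInt_le_cont; [lra|intros x; cont_tac|intros x; cont_tac|]. intros x _.
    pose proof (Rle_0_sqr ((u t x - V s t x) - (V s t x - v t x))). unfold Rsqr in *. lra. }
  assert (D5 : 2 * PI * (M * M * (2 * exp 2) * r) <= 2 * PI * (M * M * (2 * exp 2)) * rate (Rmin t0 (t - 1)) s).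
  { replace (2 * PI * (M * M * (2 * exp 2) * r)) with (2 * PI * (M * M * (2 * exp 2)) * r) by ring.
    apply Rmult_le_compat_l; [|exact Hr2].
    apply Rmult_le_pos; [lra|]. apply Rmult_le_pos; [apply Rle_0_sqr|lra]. }
  lra.
Qed.

Lemma v_attracts : attracts_exponentially 2 f v
  (fun u0 => space_periodic u0 /\ class_C 4 u0 /\ RInt u0 0 (2 * PI) = PI).
Proof.
  (* Half of 1 / 50, the rate at which the squared distance decays. *)
  exists (1 / 100). split; [lra|]. intros u0 t0 [Pu0 [Hu0 Mu0]].
  apply class_C_Ck in Hu0. assert (Cu0 := Ck_continuous _ _ Hu0).
  set (w := hopf_datum u0).
  assert (Pw : space_periodic w) by (apply hopf_datum_periodic; assumption).
  assert (Hw : Ck 5 w) by (apply hopf_datum_Ck, Hu0).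
  destruct (hopf_datum_lower u0 Cu0 Pw) as [delta [Hdelta Hlow]].
  destruct (init_smooth fcos fsin 2 fcos_cont fsin_cont fcos_bound fsin_bound t0 w delta Hw Pw Hdelta Hlow)
    as [_ Sm].
  set (p := heat_flow (pot_cos fcos fsin) (pot_sin fcos fsin) t0 (init t0 w)) in Sm.
  assert (Init : forall x, cole p t0 x = u0 x).
  { intros x. unfold cole, p. rewrite phi0_init by assumption.
    rewrite (phi1_init fcos fsin 2 fcos_cont fsin_cont fcos_bound fsin_bound t0 w
       (fun x => - (1 / 4) * (u0 x - cm) * w x)); [|exact Hw|exact Pw|].
    - specialize (Hlow x). change (delta <= w x) in Hlow. field. lra.
    - intros y. apply hopf_datum_derive, Cu0. }
  exists (cole p). split; [|split].
  - split; [exact (smooth_solution_classical f t0 _ _ _ (f_jcont _) Sm)|exact Init].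
  - intros u' [Hu' Hi'] t x Ht.
    apply (classical_solution_unique f t0 _ _ _ u' (f_jcont _) Sm Hu'); [|exact Ht].
    intros y. rewrite Hi', Init. reflexivity.
  - destruct (dist2_attractor t0 _ _ _ Sm) as [K HK].
    (* (|K| + 1)^2 is at least K; the 2 is the factor in [fourier_sup_dist_le]. *)
    exists (2 * (Rabs K + 1)). intros t Ht.
    set (e := exp (- (1 / 100) * (t - t0))).
    assert (He : 0 < e) by apply exp_pos.
    assert (He2 : e * e = exp (- (1 / 50) * (t - t0))) by (unfold e; rewrite <- exp_plus; f_equal; field).
    pose proof (Rabs_pos K). pose proof (Rle_abs K).
    replace (2 * (Rabs K + 1) * e) with (2 * ((Rabs K + 1) * e)) by ring.
    apply fourier_sup_dist_le.
    + apply Rmult_le_pos; lra.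
    + intros x. apply (jcont_slice _ _ (ss_jcont _ _ _ _ _ Sm)), Ht.
    + intros x. apply v_cont.
    + eapply Rle_trans; [apply (HK t Ht)|]. rewrite <- He2.
      replace ((Rabs K + 1) * e * ((Rabs K + 1) * e)) with ((Rabs K + 1) * (Rabs K + 1) * (e * e)) by ring.
      apply Rmult_le_compat_r; [nra|nra].
Qed.

End Forcing.

Theorem theorem1p2 :
  forall (beta gamma : nat -> R -> R),
    (forall (k : nat) (t : R), (1 <= k <= 3)%nat ->
       continuous (beta k) t /\ continuous (gamma k) t) ->
    (forall (k : nat) (t : R), (1 <= k <= 3)%nat ->
       - 5e-5 <= beta k t <= 5e-5 /\ - 5e-5 <= gamma k t <= 5e-5) ->
    exists v : R -> R -> R,
      classical_solution 2 (forcing beta gamma) (fun _ : R => True) v /\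
      attracts_exponentially 2 (forcing beta gamma) v
        (fun u0 : R -> R =>
           space_periodic u0 /\ class_C 4 u0 /\ RInt u0 0 (2 * PI) = PI) /\
      (forall T : R, 0 < T ->
         time_periodic T (forcing beta gamma) -> time_periodic T v).
Proof.
  intros beta gamma Hc Hb. rewrite forcing_trig.
  exists (attractor (fcos gamma) (fsin beta)). split; [|split].
  - apply v_classical; assumption.
  - apply v_attracts; assumption.
  - intros T _ HT.
    exact (attractor_time_periodic _ _ 2 (fcos_cont _ _ Hc) (fsin_cont _ _ Hc) (fcos_bound _ _ Hb) (fsin_bound _ _ Hb)
      (fprim beta gamma) (fprim_derive _ _) (fprim_periodic _ _) (fprim_norm _ _ Hb) T HT).
Qed.
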